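(* Let $G$ be a $(P_2+P_3, C_4)$-free graph on $n$ vertices. Then, for all integers $k\ge \rho(G)+2$, the diameter of $\mathcal{R}_{k}(G)$ is at most $2n^{2}$.
   Context: All graphs are finite, simple and undirected. $P_t$ and $C_t$ are the chordless path and cycle on $t$ vertices; $P_2+P_3$ is the disjoint union of $P_2$ and $P_3$. For a set of graphs $\mathcal{F}$, a graph is $\mathcal{F}$-free if it has no induced subgraph isomorphic to a member of $\mathcal{F}$. The degeneracy $\rho(G)$ is the smallest positive integer $d$ such that every subgraph of $G$ contains a vertex of degree at most $d$. A $k$-coloring of $G$ is a map $\phi:V(G)\to\{1,\dots,k\}$ with $\phi(u)\ne\phi(v)$ for adjacent $u,v$. The reconfiguration graph $\mathcal{R}_k(G)$ has the $k$-colorings of $G$ as vertices, two being adjacent if they differ on exactly one vertex of $G$. (A diameter bound includes the assertion that $\mathcal{R}_k(G)$ is connected.) *)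

(* Defs.v *)
From HB Require Import structures.
From Stdlib Require List.
From mathcomp Require Import all_boot.

Set Implicit Arguments.
Unset Strict Implicit.
Unset Printing Implicit Defensive.

Record sgraph := SGraph {
  vertex :> finType;
  adj : rel vertex;
  adj_sym : symmetric adj;
  adj_irrefl : irreflexive adj }.

Section PathCycle.
Variable t : nat.

Definition path_adj : rel 'I_t := fun i j => (i.+1 == j) || (j.+1 == i).

Lemma path_adj_sym : symmetric path_adj.
Proof. by move=> i j; rewrite /path_adj orbC. Qed.

Lemma path_adj_irrefl : irreflexive path_adj.
Proof. by move=> i; rewrite /path_adj orbb gtn_eqF. Qed.

Definition path_graph : sgraph := SGraph path_adj_sym path_adj_irrefl.

(* This is the cycle C_t for t >= 3; the test i != j only matters for t = 1. *)
Definition cycle_adj : rel 'I_t := fun i j =>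
  (i != j) && ((i.+1 %% t == j) || (j.+1 %% t == i)).

Lemma cycle_adj_sym : symmetric cycle_adj.
Proof. by move=> i j; rewrite /cycle_adj eq_sym orbC. Qed.

Lemma cycle_adj_irrefl : irreflexive cycle_adj.
Proof. by move=> i; rewrite /cycle_adj eqxx. Qed.

Definition cycle_graph : sgraph := SGraph cycle_adj_sym cycle_adj_irrefl.

End PathCycle.

Section DisjointUnion.
Variables G H : sgraph.

Definition union_adj : rel (G + H)%type := fun x y =>
  match x, y with
  | inl u, inl v => adj u v
  | inr u, inr v => adj u v
  | _, _ => false
  end.

Lemma union_adj_sym : symmetric union_adj.
Proof. by move=> [u|u] [v|v] //=; apply: adj_sym. Qed.

Lemma union_adj_irrefl : irreflexive union_adj.
Proof. by move=> [u|u] /=; apply: adj_irrefl. Qed.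

Definition disjoint_union : sgraph := SGraph union_adj_sym union_adj_irrefl.

End DisjointUnion.

Section Induced.
Variables (G : sgraph) (S : {set G}).

Definition induced_adj : rel {x : G | x \in S} := fun x y => adj (val x) (val y).

Lemma induced_adj_sym : symmetric induced_adj.
Proof. by move=> x y; apply: adj_sym. Qed.

Lemma induced_adj_irrefl : irreflexive induced_adj.
Proof. by move=> x; apply: adj_irrefl. Qed.

Definition induced : sgraph := SGraph induced_adj_sym induced_adj_irrefl.

End Induced.

Definition isomorphic (G H : sgraph) : Prop :=
  exists2 f : G -> H, bijective f & forall x y, adj (f x) (f y) = adj x y.

Definition free (F : seq sgraph) (G : sgraph) : Prop :=
  forall (H : sgraph) (S : {set G}), List.In H F -> ~ isomorphic (induced S) H.

Section Degeneracy.
Variable G : sgraph.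

(* An undirected edge {u, v} is encoded by both ordered pairs (u, v), (v, u). *)
Definition is_subgraph (V : {set G}) (E : {set G * G}) : bool :=
  [forall u, forall v, ((u, v) \in E) ==>
    [&& u \in V, v \in V, adj u v & (v, u) \in E]].

Definition subdegree (E : {set G * G}) (v : G) : nat := #|[set u | (v, u) \in E]|.

(* Subgraphs are required to have at least one vertex. *)
Definition degenerate (d : nat) : bool :=
  [forall V : {set G}, forall E : {set G * G},
    (V != set0) && is_subgraph V E ==> [exists v in V, subdegree E v <= d]].

Lemma degenerate_exists : exists d, (0 < d) && degenerate d.
Proof.
exists #|G|.+1; apply/forallP => V; apply/forallP => E.
apply/implyP => /andP[/set0Pn[v vV] _]; apply/existsP; exists v.
by rewrite vV /= (leq_trans (max_card _)).
Qed.

Definition degeneracy : nat := ex_minn degenerate_exists.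

End Degeneracy.

Section Distance.
Variable G : sgraph.

Definition connected : Prop := forall x y : G, connect (@adj G) x y.

Definition has_walk (x y : G) (m : nat) : bool :=
  [exists p : m.-tuple G, path (@adj G) x p && (last x p == y)].

(* The least length of a walk from x to y, which is always smaller than #|G|
   when a walk exists; the value is #|G| when there is none. *)
Definition dist (x y : G) : nat := find (has_walk x y) (iota 0 #|G|).

(* The usual diameter only when G is connected. *)
Definition diameter : nat := \max_(x : G) \max_(y : G) dist x y.

End Distance.

Section Reconfiguration.
Variables (k : nat) (G : sgraph).

Definition proper_coloring (phi : {ffun G -> 'I_k}) : bool :=
  [forall u, forall v, adj u v ==> (phi u != phi v)].

Definition coloring : finType := {phi : {ffun G -> 'I_k} | proper_coloring phi}.

Definition recolor_adj : rel coloring := fun phi psi =>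
  #|[set v | val phi v != val psi v]| == 1.

Lemma recolor_adj_sym : symmetric recolor_adj.
Proof.
move=> phi psi; rewrite /recolor_adj; congr (_ == _).
by apply: eq_card => v; rewrite !inE eq_sym.
Qed.

Lemma recolor_adj_irrefl : irreflexive recolor_adj.
Proof.
move=> phi; rewrite /recolor_adj (_ : [set v | _] = set0) ?cards0 //.
by apply/setP => v; rewrite !inE eqxx.
Qed.

Definition reconfiguration_graph : sgraph :=
  SGraph recolor_adj_sym recolor_adj_irrefl.

End Reconfiguration.

(* Main.v *)
(* Put d = k - 2.  There is one partition of V(G) into d + 1 stable classes such
   that every coloring with d + 2 colors can be brought to a coloring constant on
   the classes while recoloring no vertex more than n - 1 times.  Two such
   colorings differ by an injective renaming of the classes, which costs at most
   two more moves per vertex, so 2(n - 1) + 2 = 2n moves per vertex suffice.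

   The partition is found by induction on n.  If N(u) is contained in N(v) for
   nonadjacent u and v, delete u and let it follow v; a universal vertex is deleted
   together with its color.  Otherwise one starts from a clique, whose colors are
   distinct already, and attaches the other vertices one at a time.  Giving a
   processed vertex a new color then needs at most one move of every vertex in
   two situations: when the graph off the clique is a disjoint union of cliques,
   since C4-freeness nests the neighbourhoods of each of them in the starting
   clique; and when degrees are small enough that the vertices in conflict can be
   moved in two rounds.  A graph without induced C5 and C6 is of the first kind.
   A graph with an induced C6 or C5 has few types of vertices with respect to the
   cycle, hence is a blow-up of one of a few small graphs, and degeneracy, applied
   to unions of its parts, bounds degrees as the second situation requires. *)
Require Import Defs.
From mathcomp Require Import all_boot zify.
From Stdlib Require List.

Set Implicit Arguments.
Unset Strict Implicit.
Unset Printing Implicit Defensive.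

(** The obstacle is that a new color at one vertex may displace others, and a displaced vertex must
    avoid the old and the new colors of its neighbours, up to twice its degree many. In both
    situations these colors exceed the degree by at most one, so d + 2 colors suffice where the
    degree is at most d: either every change in sight involves one fixed color, or each displaced
    vertex leaves a color that a neighbour is about to take. The degree bound comes from
    neighbourhoods that are cliques, or from the sizes of the parts of a blow-up. The bound n - 1 is
    a budget: the starting clique costs nothing and every later vertex one pass over the graph, in
    which no vertex moves twice. In the situation of small degrees a second clique is allowed whose
    vertices cost two passes each; it must be smaller than the first. Colors range over all finite
    types of the given size, because the color lost with a universal vertex leaves a subtype. *)

Definition nbr (G : sgraph) (x : G) (U : {set G}) : {set G} := [set y in U | adj x y].

Lemma in_nbr (G : sgraph) (x y : G) (U : {set G}) : (y \in nbr x U) = (y \in U) && adj x y.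
Proof. by rewrite inE. Qed.

(** * Sequences of moves and the recoloring of a single vertex *)

Section Recoloring.
Variables (G : sgraph) (C : finType).
Implicit Types (phi psi : {ffun G -> C}) (U L B : {set G}) (s : seq G).

Definition proper_on U phi := forall x y, x \in U -> y \in U -> adj x y -> phi x != phi y.

(* The vertices of [s] are recolored one after the other, and every coloring
   that occurs after a move is proper on [U]. *)
Inductive moves U : seq G -> {ffun G -> C} -> {ffun G -> C} -> Prop :=
| moves_nil phi : moves U [::] phi phi
| moves_cons v s phi phi1 psi : v \in U -> proper_on U phi1 ->
    (forall x, x != v -> phi1 x = phi x) -> moves U s phi1 psi ->
    moves U (v :: s) phi psi.

Definition update phi v c : {ffun G -> C} := [ffun x => if x == v then c else phi x].

Lemma updateE phi v c x : update phi v c x = if x == v then c else phi x.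
Proof. by rewrite ffunE. Qed.

Lemma moves_cat U s1 s2 phi1 phi2 phi3 :
  moves U s1 phi1 phi2 -> moves U s2 phi2 phi3 -> moves U (s1 ++ s2) phi1 phi3.
Proof.
elim=> [//|v s phi psi1 psi vU pr eq_phi _ IH] mv.
exact: moves_cons vU pr eq_phi (IH mv).
Qed.

Lemma moves_proper U s phi psi : moves U s phi psi -> proper_on U phi -> proper_on U psi.
Proof. by elim=> // v s' phi1 psi1 psi' _ pr _ _ IH _; apply: IH. Qed.

Lemma moves_rev U s phi psi : moves U s phi psi -> proper_on U phi -> moves U (rev s) psi phi.
Proof.
elim=> [phi1|v s' phi1 psi1 psi' vU pr eq_phi _ IH] pr1; first exact: moves_nil.
rewrite rev_cons -cats1; apply: moves_cat (IH pr) _.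
by apply: moves_cons vU pr1 _ (moves_nil _ _) => x /eq_phi ->.
Qed.

Lemma moves_out U s phi psi x : moves U s phi psi -> x \notin s -> psi x = phi x.
Proof.
elim=> // v s' phi1 psi1 psi' _ _ eq_phi _ IH.
by rewrite inE negb_or => /andP[xv /IH ->]; apply: eq_phi.
Qed.

Lemma exists_color (A : {set C}) : #|A| < #|C| -> exists c, c \notin A.
Proof.
rewrite ltnNge => ltA; apply/existsP; apply: contraR ltA => /existsPn allA.
by apply: subset_leq_card; apply/subsetP => c _; move: (allA c); rewrite negbK.
Qed.

Definition recolors (f : G -> nat) phi psi :=
  exists2 s, moves setT s phi psi & forall v, count_mem v s <= f v.

Lemma recolors_refl phi f : recolors f phi phi.
Proof. by exists [::] => //; apply: moves_nil. Qed.

Lemma recolors_weaken f g phi psi : (forall v, f v <= g v) -> recolors f phi psi -> recolors g phi psi.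
Proof. by move=> le_fg [s mv cnt]; exists s => // v; apply: leq_trans (le_fg v). Qed.

Lemma recolors_trans f g phi1 phi2 phi3 : recolors f phi1 phi2 -> recolors g phi2 phi3 ->
  recolors (fun v => f v + g v) phi1 phi3.
Proof.
move=> [s1 mv1 cnt1] [s2 mv2 cnt2]; exists (s1 ++ s2); first exact: moves_cat mv2.
by move=> v; rewrite count_cat leq_add.
Qed.

Lemma recolors_sym f phi psi : proper_on setT phi -> recolors f phi psi -> recolors f psi phi.
Proof.
move=> pr [s mv cnt]; exists (rev s); first exact: moves_rev.
by move=> v; rewrite count_rev.
Qed.

(** The vertices of [t] step aside before [U] moves: each takes a color that its neighbours in [U]
    have neither at the beginning, in [phi0], nor at the end, in [phi']. The counting hypothesis
    leaves such a color even if the neighbours in [L] all differ in color, whatever moves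
    preceded. *)
Lemma vacate U L phi0 phi' t phi :
  [disjoint U & L] -> {subset t <= L} -> uniq t -> {in U, phi =1 phi0} ->
  proper_on (U :|: L) phi ->
  (forall x, x \in L ->
     #|nbr x L| + #|(phi0 @: nbr x U) :|: (phi' @: nbr x U)| < #|C|) ->
  exists psi, [/\ moves (U :|: L) t phi psi, {in U, psi =1 phi0},
    forall x, x \notin t -> psi x = phi x, proper_on (U :|: L) psi &
    forall x y, x \in t -> y \in U -> adj x y -> psi x != phi0 y /\ psi x != phi' y].
Proof.
move=> dUL; elim: t phi => [|v t IH] phi tL ut eq0 pr cnt.
  by exists phi; split=> //; apply: moves_nil.
have vL : v \in L by apply: tL; rewrite inE eqxx.
have vU : v \notin U by move: dUL; rewrite disjoint_sym => /disjointFr ->.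
have [vt ut'] := andP ut.
have [c] : exists c, c \notin phi @: nbr v L :|: ((phi0 @: nbr v U) :|: (phi' @: nbr v U)).
  apply: exists_color; apply: leq_ltn_trans (leq_card_setU _ _) _.
  by apply: leq_ltn_trans (cnt _ vL); rewrite leq_add2r leq_imset_card.
rewrite !in_setU !negb_or => /and3P[cL c0 c'].
pose phi1 := update phi v c.
have eq1 : {in U, phi1 =1 phi0}.
  by move=> x xU; rewrite updateE; case: (eqVneq x v) => [xv|_]; [rewrite -xv xU in vU|apply: eq0].
have fresh y : y \in U :|: L -> adj v y -> c != phi y.
  rewrite inE => /orP[yU|yL] vy; apply/eqP=> cE.
    by case/negP: c0; apply/imsetP; exists y; rewrite ?in_nbr ?yU // cE eq0.
  by case/negP: cL; apply/imsetP; exists y; rewrite ?in_nbr ?yL.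
have pr1 : proper_on (U :|: L) phi1.
  move=> x y xUL yUL xy; rewrite !updateE.
  case: (eqVneq x v) => [xv|_]; case: (eqVneq y v) => [yv|_].
  - by move: xy; rewrite xv yv adj_irrefl.
  - by apply: fresh; rewrite -?xv.
  - by rewrite eq_sym; apply: fresh; rewrite // -yv adj_sym.
  - exact: pr.
have [|psi [mv eqU out prp away]] := IH phi1 _ ut' eq1 pr1 cnt.
  by move=> x xt; apply: tL; rewrite inE xt orbT.
exists psi; split=> //.
- apply: moves_cons mv => //; first by rewrite inE vL orbT.
  by move=> x xv; rewrite updateE (negbTE xv).
- move=> x; rewrite inE negb_or => /andP[xv xt].
  by rewrite out // updateE (negbTE xv).
- move=> x y; rewrite inE => /orP[/eqP->|xt] yU xy; last exact: away.
  rewrite out // updateE eqxx; split; apply/eqP=> cE.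
    by case/negP: c0; apply/imsetP; exists y; rewrite ?in_nbr ?yU.
  by case/negP: c'; apply/imsetP; exists y; rewrite ?in_nbr ?yU.
Qed.

(** As [uniq s] lets every vertex move only once, each color seen in [U] on the way is an initial or
    a final one. If [L] conflicts with neither, it can stand still. *)
Lemma moves_lift U L s phi phi' : [disjoint U & L] -> moves U s phi phi' -> uniq s ->
  forall phi1, {in U, phi1 =1 phi} -> proper_on (U :|: L) phi1 ->
  (forall x y, x \in L -> y \in U -> adj x y -> phi1 x != phi' y) ->
  exists psi, [/\ moves (U :|: L) s phi1 psi, {in U, psi =1 phi'} &
    forall x, x \notin U -> psi x = phi1 x].
Proof.
move=> dUL; elim=> [phi0|v s' phi0 phi2 psi vU pr2 eq02 mv IH] us phi1 eq1 pr1 away.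
  by exists phi1; split=> //; apply: moves_nil.
have [vs us'] := andP us.
(* [v] does not occur in [s'], so its color after this move is final. *)
have psiv : psi v = phi2 v by apply: moves_out mv vs.
have nL x : x \in L -> x \notin U by move=> xL; rewrite disjoint_sym in dUL; rewrite (disjointFr dUL).
pose phi3 := update phi1 v (phi2 v).
have eq3 : {in U, phi3 =1 phi2}.
  by move=> x xU; rewrite updateE; case: (eqVneq x v) => [->//|xv]; rewrite eq1 // eq02.
have eq3' x : x \notin U -> phi3 x = phi1 x.
  by move=> xU; rewrite updateE; case: (eqVneq x v) => // xv; rewrite xv vU in xU.
have LU x y : x \in L -> y \in U -> adj x y -> phi3 x != phi3 y.
  move=> xL yU xy; rewrite (eq3' _ (nL _ xL)) updateE; case: (eqVneq y v) => [yv|_].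
    by rewrite -psiv; apply: away; rewrite // -yv.
  by apply: pr1; rewrite ?in_setU ?xL ?yU ?orbT.
have pr3 : proper_on (U :|: L) phi3.
  move=> x y; rewrite !in_setU => /orP[xU|xL] /orP[yU|yL] xy.
  - by rewrite !eq3 //; apply: pr2.
  - by rewrite eq_sym; apply: LU => //; rewrite adj_sym.
  - exact: LU.
  - by rewrite !eq3' ?nL //; apply: pr1; rewrite ?in_setU ?xL ?yL ?orbT.
have [|psi' [mv' eqU out]] := IH us' phi3 eq3 pr3.
  by move=> x y xL yU xy; rewrite eq3' ?nL //; apply: away.
exists psi'; split=> //; last by move=> x xU; rewrite out // eq3'.
apply: moves_cons mv' => //; first by rewrite inE vU.
by move=> x xv; rewrite updateE (negbTE xv).
Qed.

(** Only the vertices of [L] in conflict with the final colors of [U] step aside, and they do so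
    before [U] starts to move. The last clause controls which new colors can arise when this is
    iterated. *)
Lemma moves_extend U L s phi phi' :
  [disjoint U & L] -> uniq s -> moves U s phi phi' -> proper_on (U :|: L) phi ->
  (forall x, x \in L ->
     #|nbr x L| + #|(phi @: nbr x U) :|: (phi' @: nbr x U)| < #|C|) ->
  exists psi s', [/\ uniq s', moves (U :|: L) s' phi psi, {in U, psi =1 phi'} &
    forall x, x \in L -> psi x != phi x -> exists y, [/\ y \in U, adj x y & phi' y = phi x]].
Proof.
move=> dUL us mv pr cnt.
have sU : {subset s <= U}.
  by elim: mv => // v s' ? ? ? vU _ _ _ IH x; rewrite inE => /orP[/eqP->|/IH].
pose bad := [set x in L | [exists y in U, adj x y && (phi' y == phi x)]].
have badL : {subset enum bad <= L} by move=> x; rewrite mem_enum inE => /andP[].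
have [phi1 [mv1 eq1 out1 pr1 away1]] :=
  vacate dUL badL (enum_uniq _) (fun x _ => erefl) pr cnt.
have [|psi [mv2 eq2 out2]] := moves_lift dUL mv us eq1 pr1.
  move=> x y xL yU xy; have [xb|xb] := boolP (x \in bad).
    by case: (away1 x y); rewrite ?mem_enum.
  rewrite out1 ?mem_enum //; apply: contra xb => /eqP E; rewrite inE xL.
  by apply/existsP; exists y; rewrite yU xy E eqxx.
exists psi, (enum bad ++ s); split=> //.
- rewrite cat_uniq enum_uniq us andbT /=; apply/hasPn => x /sU xU.
  by apply/negP=> /badL xL; move: (disjointFr dUL xU); rewrite xL.
- exact: moves_cat mv1 mv2.
- move=> x xL; rewrite out2; last by rewrite disjoint_sym in dUL; rewrite (disjointFr dUL).
  have [xb _|xb] := boolP (x \in bad); last by rewrite out1 ?mem_enum ?eqxx.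
  move: xb; rewrite inE => /andP[_ /existsP[y /and3P[yU xy /eqP E]]].
  by exists y.
Qed.

(** From the two colors of each [y] keep one different from [c] if there is one; the kept colors
    together with [c] cover both images. *)
Lemma card_two_images (N : {set G}) phi phi' c :
  (forall y, y \in N -> phi' y != phi y -> c = phi y \/ c = phi' y) ->
  #|(phi @: N) :|: (phi' @: N)| <= #|N|.+1.
Proof.
move=> hc; pose g y := if phi y == c then phi' y else phi y.
have sub : (phi @: N) :|: (phi' @: N) \subset c |: (g @: N).
  apply/subsetP => z; rewrite !inE => /orP[] /imsetP[y yN ->].
    have [//|ne_c /=] := eqVneq (phi y) c; apply/imsetP; exists y => //.
    by rewrite /g (negbTE ne_c).
  have [//|ne_c /=] := eqVneq (phi' y) c; apply/imsetP; exists y => //.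
  rewrite /g; case: (eqVneq (phi y) c) => // nc; apply/eqP; apply: contraNT ne_c => ne.
  by case: (hc _ yN ne) => cE; [rewrite cE eqxx in nc|rewrite cE].
apply: leq_trans (subset_leq_card sub) _; rewrite cardsU1.
by rewrite -add1n leq_add ?leq_imset_card // leq_b1.
Qed.

(* Moving [v] to color [c] displaces only vertices of color [c] in [L2], so all
   the changes that a vertex of [L1] sees involve [c]: together they block at
   most one color more than the degree. *)
Lemma step (d : nat) (B L2 L1 : {set G}) phi v c :
  #|C| = d.+2 -> B :|: L2 :|: L1 = setT -> [disjoint B & L2] -> [disjoint B :|: L2 & L1] ->
  (forall x, x \in L2 -> #|nbr x (B :|: L2)| <= d) ->
  (forall x, x \in L1 -> #|nbr x setT| <= d) ->
  proper_on setT phi -> v \in B -> c \notin phi @: nbr v B ->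
  exists psi, [/\ proper_on setT psi, psi v = c,
    forall x, x \in B -> x != v -> psi x = phi x & recolors (fun=> 1) phi psi].
Proof.
move=> cardC cover dB2 d1 deg2 deg1 pr vB fresh.
have prS U : proper_on U phi by move=> x y _ _; apply: pr.
pose phi' := update phi v c.
have mvB : moves B [:: v] phi phi'.
  apply: moves_cons (moves_nil _ _) => //; last first.
    by move=> x xv; rewrite updateE (negbTE xv).
  have vfresh y : y \in B -> adj v y -> c != phi y.
    by move=> yB vy; apply: contra fresh => /eqP->; rewrite imset_f // in_nbr yB.
  move=> x y xB yB xy; rewrite !updateE; case: (eqVneq x v) => [xv|_]; case: (eqVneq y v) => [yv|_].
  - by move: xy; rewrite xv yv adj_irrefl.
  - by apply: vfresh; rewrite -?xv.
  - by rewrite eq_sym; apply: vfresh; rewrite // -yv adj_sym.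
  - exact: pr.
have ch1 y : phi' y != phi y -> c = phi y \/ c = phi' y.
  by rewrite updateE; case: (eqVneq y v) => [_|_]; [right|rewrite eqxx].
have nbrU x (A D : {set G}) : [disjoint A & D] -> #|nbr x D| + #|nbr x A| = #|nbr x (A :|: D)|.
  move=> dAD; have -> : nbr x (A :|: D) = nbr x D :|: nbr x A.
    by apply/setP => y; rewrite !inE orbC andb_orl.
  rewrite cardsU (_ : nbr x D :&: nbr x A = set0) ?cards0 ?subn0 //.
  apply/setP => y; rewrite !inE; have [yA|//] := boolP (y \in A); rewrite ?andbF //.
  by rewrite (disjointFr dAD yA).
have [//|x xL|psi2 [s2 [us2 mv2 eq2 ch2]]] := moves_extend dB2 _ mvB (prS _).
  rewrite cardC; apply: (@leq_ltn_trans (#|nbr x L2| + #|nbr x B|.+1)).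
    by rewrite leq_add2l (@card_two_images _ _ _ c) // => y _; apply: ch1.
  by rewrite addnS nbrU // !ltnS deg2.
(* A displaced vertex of [L2] had color [c]: the neighbour in [B] that took its color must be [v],
   since an unchanged neighbour cannot share its color. *)
have {}ch2 x : x \in B :|: L2 -> psi2 x != phi x -> c = phi x \/ c = psi2 x.
  rewrite inE => /orP[xB|xL] ne; first by move: ne; rewrite eq2 //; apply: ch1.
  case: (ch2 _ xL ne) => y [yB xy]; rewrite updateE; case: (eqVneq y v) => [_ ->|_ E]; first by left.
  by move: (pr x y (in_setT _) (in_setT _) xy); rewrite E eqxx.
have [||psi [s1 [us1 mv1 eq1 _]]] := moves_extend d1 us2 mv2.
- by rewrite cover.
- move=> x xL; rewrite cardC.
  apply: (@leq_ltn_trans (#|nbr x L1| + #|nbr x (B :|: L2)|.+1)).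
    by rewrite leq_add2l (@card_two_images _ _ _ c) // => y; rewrite in_nbr => /andP[/ch2].
  by rewrite addnS nbrU // cover !ltnS deg1.
have eqB x : x \in B -> psi x = phi' x by move=> xB; rewrite eq1 ?inE ?xB // eq2.
move: mv1; rewrite cover => mv1.
exists psi; split.
- exact: moves_proper mv1 pr.
- by rewrite eqB // updateE eqxx.
- by move=> x xB xv; rewrite eqB // updateE (negbTE xv).
- by exists s1 => // x; rewrite count_uniq_mem //; case: (_ \in _).
Qed.

End Recoloring.

(** * Gathering into a canonical partition *)

Definition C4_free (G : sgraph) := forall a b c d : G,
  adj a b -> adj b c -> adj c d -> adj d a -> a != c -> b != d -> ~~ adj a c -> ~~ adj b d -> False.

(** Only [c != f] has to be stated: the other vertices are distinct by the adjacencies. *)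
Definition P2P3_free (G : sgraph) := forall a b c d f : G,
  adj a b -> adj c d -> adj d f -> c != f -> ~~ adj c f ->
  ~~ adj a c -> ~~ adj a d -> ~~ adj a f -> ~~ adj b c -> ~~ adj b d -> ~~ adj b f -> False.

Definition degen (d : nat) (G : sgraph) := forall X : {set G},
  X != set0 -> exists2 x, x \in X & #|nbr x X| <= d.

Definition clique (G : sgraph) (K : {set G}) := {in K &, forall x y, x != y -> adj x y}.

(** [P] holds the vertices already attached. There is one color more than there are classes, so an
    injective [sigma] always leaves a spare color, on which a whole class can be parked. *)
Definition settles d (G : sgraph) (P : {set G}) m (pi : G -> 'I_d.+1) :=
  forall (C : finType) (alpha : {ffun G -> C}), #|C| = d.+2 -> proper_on setT alpha ->
  exists (sigma : 'I_d.+1 -> C) (beta : {ffun G -> C}),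
    [/\ injective sigma, proper_on setT beta, forall x, x \in P -> beta x = sigma (pi x) &
        recolors (fun=> m) alpha beta].

(* There is one partition into [d.+1] classes to which every coloring with
   [d.+2] colors can be brought; [sigma] names the colors of the classes. *)
Definition gathers d (G : sgraph) m := exists pi : G -> 'I_d.+1, settles setT m pi.

Section Gathering.
Variables (d : nat) (G : sgraph).
Hypothesis deg : degen d G.
Implicit Types (K I P Q : {set G}).

(** With [x] added the neighbours still form a clique. All its vertices have the same degree in it,
    so the low vertex given by degeneracy speaks for [x]. *)
Lemma card_nbr_clique x Q : clique (nbr x Q) -> #|nbr x Q| <= d.
Proof.
move=> cl; have [|y yX low] := deg (X := x |: nbr x Q).
  by apply/set0Pn; exists x; rewrite !inE eqxx.
have xN : x \notin nbr x Q by rewrite inE adj_irrefl andbF.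
have adX z : z \in x |: nbr x Q -> z != y -> adj y z.
  move: yX; rewrite !in_setU1 !in_nbr => /orP[/eqP->|/andP[yQ xy]] /orP[/eqP->|/andP[zQ xz]] zy //.
  - by rewrite eqxx in zy.
  - by rewrite adj_sym.
  - by apply: cl; rewrite ?in_nbr ?yQ ?zQ // eq_sym.
have E : nbr y (x |: nbr x Q) = (x |: nbr x Q) :\ y.
  apply/setP => z; rewrite in_nbr in_setD1 andbC.
  have [->|zy] := eqVneq z y; first by rewrite adj_irrefl.
  by case: (boolP (z \in _)) => [/adX->//|_]; rewrite andbF.
move: low; rewrite E.
by have := cardsD1 y (x |: nbr x Q); rewrite yX cardsU1 xN /= => /eqP; rewrite eqSS => /eqP <-.
Qed.

Lemma card_clique K : clique K -> #|K| <= d.+1.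
Proof.
move=> cl; have [->|/set0Pn[x xK]] := eqVneq K set0; first by rewrite cards0.
rewrite (cardsD1 x) xK ltnS.
have -> : K :\ x = nbr x K.
  apply/setP => y; rewrite !inE andbC; have [yK|//] := boolP (y \in K) => /=.
  have [->|ne] := eqVneq y x; first by rewrite adj_irrefl.
  by rewrite cl // eq_sym.
by apply: card_nbr_clique => y z; rewrite !inE => /andP[yK _] /andP[zK _]; apply: cl.
Qed.

Lemma extend_injection (A : finType) (S : {set A}) (C : finType) (f : A -> C) (h : C) :
  #|A| < #|C| -> {in S &, injective f} -> exists2 g : A -> C, injective g & {in S, g =1 f}.
Proof.
move: {2}(#|~: S|) (erefl #|~: S|) => n; elim: n S f => [|n IH] S f En lt inj.
  have ST x : x \in S.
    by have := in_set0 x; rewrite -(cards0_eq En) inE; case: (x \in S).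
  by exists f => // x y; apply: inj.
have /card_gt0P[x] : 0 < #|~: S| by rewrite En.
rewrite inE => xS.
have [c cS] : exists c, c \notin f @: S.
  apply: exists_color; apply: leq_ltn_trans (leq_imset_card _ _) _.
  exact: leq_ltn_trans (max_card _) lt.
pose f1 y := if y == x then c else f y.
have [|||g injg eqg] := IH (x |: S) f1.
- by rewrite setCU setIC -setDE; apply/eqP; have := cardsD1 x (~: S); rewrite En inE xS add1n => -[<-].
- exact: lt.
- move=> y z; rewrite !inE /f1.
  have [->|yx] := eqVneq y x; have [->|zx] := eqVneq z x => //=.
  + by move=> _ zS E; case/negP: cS; rewrite E imset_f.
  + by move=> yS _ E; case/negP: cS; rewrite -E imset_f.
  + exact: inj.
- exists g => // y yS; rewrite eqg ?inE ?yS ?orbT // /f1.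
  by case: (eqVneq y x) => // yx; rewrite yx (negbTE xS) in yS.
Qed.

(** The colors of a clique are distinct in every proper coloring, so they can be read off as values
    of [sigma] and extended injectively to the remaining classes. *)
Lemma settles_clique K : clique K -> exists pi : G -> 'I_d.+1, settles K 0 pi.
Proof.
move=> cl; have leK := card_clique cl.
(* The position in the enumeration numbers the classes; [inord] is faithful on [K] because
   [#|K| <= d.+1]. *)
pose pi x : 'I_d.+1 := inord (index x (enum K)).
have piK : {in K &, injective pi}.
  move=> x y xK yK /(congr1 val); rewrite /= !inordK; last first.
  - by rewrite (leq_trans _ leK) // cardE index_mem mem_enum.
  - by rewrite (leq_trans _ leK) // cardE index_mem mem_enum.
  move=> E; rewrite -(nth_index x (s := enum K) (x := x)) ?mem_enum //.
  by rewrite E nth_index ?mem_enum.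
exists pi => C alpha cardC pr.
have [h] : exists c : C, c \notin set0 by apply: exists_color; rewrite cards0 cardC.
move=> _; pose f i := if [pick x in K | pi x == i] is Some x then alpha x else h.
have fK x : x \in K -> f (pi x) = alpha x.
  rewrite /f => xK; case: pickP => [y /andP[yK /eqP/piK ->] //|/(_ x)].
  by rewrite xK eqxx.
have [||sigma injs eqs] := @extend_injection 'I_d.+1 (pi @: K) C f h.
- by rewrite card_ord cardC.
- move=> i j /imsetP[x xK ->] /imsetP[y yK ->]; rewrite !fK // => E.
  have [->//|xy] := eqVneq x y.
  by move: (pr x y (in_setT _) (in_setT _) (cl _ _ xK yK xy)); rewrite E eqxx.
exists sigma, alpha; split=> //; last exact: recolors_refl.
by move=> x xK; rewrite eqs ?imset_f // fK.
Qed.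

(* [v] can be given any color that is absent from its neighbours in [P]. *)
Definition settable P m v := forall (C : finType) (phi : {ffun G -> C}) c,
  #|C| = d.+2 -> proper_on setT phi -> c \notin phi @: nbr v P ->
  exists psi, [/\ proper_on setT psi, psi v = c, {in P, psi =1 phi} & recolors (fun=> m) phi psi].

(** The class of [v] is chosen before any coloring is known: its neighbours in [P] occupy at most d
    of the d + 1 classes. For a given coloring [v] then has to receive [sigma i], which these
    neighbours lack because [sigma] is injective. *)
Lemma settles_step P m n (pi : G -> 'I_d.+1) v : settles P m pi -> v \notin P -> #|nbr v P| <= d ->
  settable P n v -> exists pi' : G -> 'I_d.+1, settles (v |: P) (m + n) pi'.
Proof.
move=> st vP lev sv.
have [i iP] : exists i, i \notin pi @: nbr v P.
  by apply: exists_color; rewrite card_ord ltnS (leq_trans (leq_imset_card _ _)).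
exists (fun x => if x == v then i else pi x) => C alpha cardC pr.
have [sigma [beta [injs prb eqb rec]]] := st C alpha cardC pr.
have [|gamma [prg gv eqg rec']] := sv C beta (sigma i) cardC prb.
  apply/imsetP => -[x]; rewrite in_nbr => /andP[xP vx]; rewrite eqb // => /injs E.
  by case/negP: iP; rewrite E imset_f // in_nbr xP.
exists sigma, gamma; split=> //; last by apply: recolors_weaken (recolors_trans rec rec').
move=> x; rewrite !inE; have [-> //|xv /= xP] := eqVneq x v.
by rewrite eqg // eqb.
Qed.

Lemma settles_seq P m n (pi : G -> 'I_d.+1) s : settles P m pi -> uniq s -> (forall x, x \in s -> x \notin P) ->
  (forall s1 v s2, s = s1 ++ v :: s2 ->
     #|nbr v (P :|: [set x in s1])| <= d /\ settable (P :|: [set x in s1]) n v) ->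
  exists pi' : G -> 'I_d.+1, settles (P :|: [set x in s]) (m + n * size s) pi'.
Proof.
elim: s P m pi => [|v s IH] P m pi st us dis good.
  exists pi; rewrite muln0 addn0 (_ : _ :|: _ = P) //.
  by apply/setP => x; rewrite !inE orbF.
have [vs us'] := andP us.
have [low sv] := good [::] v s erefl.
have E0 : P :|: [set x in [::]] = P by apply/setP => x; rewrite !inE orbF.
rewrite E0 in low sv.
have [|pi1 st1] := settles_step st _ low sv; first by apply: dis; rewrite inE eqxx.
have [|s1 w s2 E|pi2 st2] := IH _ _ _ st1 us'.
- move=> x xs; rewrite !inE negb_or dis ?inE ?xs ?orbT // andbT.
  by apply: contraNneq vs => <-.
- have := good (v :: s1) w s2; rewrite E => /(_ erefl).
  by rewrite (_ : P :|: _ = (v |: P) :|: [set x in s1]) //; apply/setP => x; rewrite !inE orbCA orbA.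
exists pi2; move: st2; rewrite -addnA -mulnS.
by rewrite (_ : P :|: _ = (v |: P) :|: [set x in s]) //; apply/setP => x; rewrite !inE orbCA orbA.
Qed.

End Gathering.

(** * Attaching vertices in layers of small degree *)

Section Layers.
Variables (d : nat) (G : sgraph).
Hypothesis deg : degen d G.
Implicit Types (K I L P Q U : {set G}).

Lemma nbrS x P Q : P \subset Q -> nbr x P \subset nbr x Q.
Proof.
by move=> /subsetP PQ; apply/subsetP => y; rewrite !in_nbr => /andP[/PQ-> ->].
Qed.

Lemma leq_nbr x P Q : P \subset Q -> #|nbr x P| <= #|nbr x Q|.
Proof. by move=> PQ; apply/subset_leq_card/nbrS. Qed.

Lemma settles_set P L m n (pi : G -> 'I_d.+1) : settles P m pi -> [disjoint P & L] ->
  (forall (S : {set G}) v, S \subset L -> v \in L -> v \notin S ->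
     #|nbr v (P :|: S)| <= d /\ settable d (P :|: S) n v) ->
  exists pi' : G -> 'I_d.+1, settles (P :|: L) (m + n * #|L|) pi'.
Proof.
move=> st dPL good; rewrite cardE.
have -> : P :|: L = P :|: [set x in enum L] by apply/setP => x; rewrite !inE mem_enum.
apply: (settles_seq st (enum_uniq _)) => [x|s1 v s2 E].
  by rewrite mem_enum => xL; rewrite disjoint_sym in dPL; rewrite (disjointFr dPL).
have uE : uniq (s1 ++ v :: s2) by rewrite -E enum_uniq.
have mE x : x \in L = (x \in s1 ++ v :: s2) by rewrite -E mem_enum.
apply: good.
- by apply/subsetP => x; rewrite inE mE mem_cat => ->.
- by rewrite mE mem_cat inE eqxx orbT.
- by rewrite inE; move: uE; rewrite cat_uniq /= negb_or => /and3P[_ /andP[]].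
Qed.

Lemma nbrU1 v P : nbr v (v |: P) = nbr v P.
Proof. by apply/setP => y; rewrite !inE; case: (eqVneq y v) => [->|//]; rewrite adj_irrefl !andbF. Qed.

Lemma settable_layers P L2 L1 v : v \notin P -> v |: P :|: L2 :|: L1 = setT ->
  [disjoint v |: P & L2] -> [disjoint v |: P :|: L2 & L1] ->
  (forall x, x \in L2 -> #|nbr x (v |: P :|: L2)| <= d) ->
  (forall x, x \in L1 -> #|nbr x setT| <= d) -> settable d P 1 v.
Proof.
move=> vP cover d2 d1 deg2 deg1 C phi c cardC pr fresh.
have [||psi [prp pv eqp rec]] := step cardC cover d2 d1 deg2 deg1 pr (v := v) (c := c).
- by rewrite !inE eqxx.
- by rewrite nbrU1.
exists psi; split=> // x xP; apply: eqp; first by rewrite inE xP orbT.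
by apply: contraNneq vP => <-.
Qed.

(** While [I] is being attached, [B] in [step] is all of [K :|: I], because the degree of a vertex
    of [I] is bounded only inside this set. A vertex of [I] may then find its new color on a vertex
    of [I] not yet attached, which has to be sent away in an additional pass. The inequality
    [#|I| < #|K|] pays for these passes. *)
Lemma gathers_layers K I L1 : clique K -> clique I -> #|I| < #|K| ->
  [disjoint K & I] -> [disjoint K :|: I & L1] ->
  (forall x, x \in I -> #|nbr x (K :|: I)| <= d) ->
  (forall x, x \in L1 -> #|nbr x setT| <= d) ->
  (forall x, x \notin K -> x \notin I -> x \notin L1 -> #|nbr x (~: L1)| <= d) ->
  gathers d G #|G|.-1.
Proof.
move=> clK clI ltIK dKI dL1 degI deg1 deg2.
pose L2 := ~: (K :|: I :|: L1).
have {}deg2 x : x \in L2 -> #|nbr x (K :|: I :|: L2)| <= d.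
  rewrite !inE !negb_or => /andP[/andP[xK xI] xL].
  apply: leq_trans (leq_nbr _ _) (deg2 x xK xI xL); apply/subsetP => y.
  rewrite !inE; have [yL|//] := boolP (y \in L1); rewrite orbT orbF /= => yKI.
  by move: (disjointFr dL1 (x := y)); rewrite inE yKI => /(_ isT); rewrite yL.
have dB2 : [disjoint K :|: I & L2].
  rewrite disjoints_subset; apply/subsetP => y; rewrite !inE => yKI.
  by rewrite yKI.
have d12 : [disjoint K :|: I :|: L2 & L1].
  rewrite disjoints_subset; apply/subsetP => y; rewrite !inE => /orP[yKI|].
    by rewrite (disjointFr dL1) // inE.
  by rewrite negb_or => /andP[].
have cover : K :|: I :|: L2 :|: L1 = setT.
  by apply/setP => y; rewrite !inE; case: (y \in K); case: (y \in I); case: (y \in L1).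
have nI v : v \in I -> v \notin K by rewrite disjoint_sym in dKI; move/(disjointFr dKI) ->.
have [pi0 st0] := settles_clique deg clK.
have [||pi1 st1] := @settles_set K I 0 2 _ st0 => // [S v SI vI vS|].
  have vP : v \notin K :|: S by rewrite inE negb_or nI.
  split.
    apply: leq_trans (leq_nbr _ _) (degI v vI); exact: setUS.
  move=> C phi c cardC pr fresh.
  have stepB := step cardC cover dB2 d12 deg2 deg1.
  have PB x : x \in K :|: S -> x \in K :|: I.
    by move=> xP; apply: subsetP xP; apply: setUS.
  have vB : v \in K :|: I by rewrite inE vI orbT.
  have Pv x : x \in K :|: S -> x != v by move=> xP; apply: contraNneq vP => <-.
  case: (boolP [exists b in I, [&& b \notin S, adj v b & phi b == c]]).
    case/existsP => b /and4P[bI bS vb /eqP bc].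
    have bP : b \notin K :|: S by rewrite inE negb_or nI.
    have bB : b \in K :|: I by rewrite inE bI orbT.
    (* Besides the at most d colors around [b], [c] itself is excluded, so that [b] really leaves
       [c]; d + 2 colors allow this. *)
    have [c1] : exists c1, c1 \notin c |: phi @: nbr b (K :|: I).
      apply: exists_color; rewrite cardC cardsU1 ltnS -add1n leq_add ?leq_b1 //.
      exact: leq_trans (leq_imset_card _ _) (degI b bI).
    rewrite !inE negb_or => /andP[c1c c1B].
    have [phi1 [pr1 e1 eq1 rec1]] := stepB _ _ _ pr bB c1B.
    have fresh1 : c \notin phi1 @: nbr v (K :|: I).
      apply/imsetP => -[y]; rewrite in_nbr => /andP[yB vy].
      have [->|yb] := eqVneq y b; first by rewrite e1 => E; rewrite E eqxx in c1c.
      rewrite eq1 // => E.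
      have yP : y \notin K :|: S.
        by apply/negP => yP; case/negP: fresh; rewrite E imset_f // in_nbr yP.
      have yI : y \in I by move: yB yP; rewrite !inE; case: (y \in K).
      (* A second vertex of color [c] in [I] would be adjacent to [b], as [I] is a clique. *)
      by move: (pr y b (in_setT _) (in_setT _) (clI _ _ yI bI yb)); rewrite bc E eqxx.
    have [psi [prp pv eqp rec2]] := stepB _ _ _ pr1 vB fresh1.
    exists psi; split=> //; last exact: recolors_weaken (recolors_trans rec1 rec2).
    move=> x xP; rewrite eqp ?PB ?Pv // eq1 ?PB //.
    by apply: contraNneq bP => <-.
  move=> /existsPn none.
  have fresh1 : c \notin phi @: nbr v (K :|: I).
    apply/imsetP => -[y]; rewrite in_nbr => /andP[yB vy] E.
    have yP : y \notin K :|: S.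
      by apply/negP => yP; case/negP: fresh; rewrite E imset_f // in_nbr yP.
    move: yB yP; rewrite !inE negb_or; case: (boolP (y \in K)) => //= _ yI yS.
    by move: (none y); rewrite yI yS vy E eqxx.
  have [psi [prp pv eqp rec2]] := stepB _ _ _ pr vB fresh1.
  exists psi; split=> //; last exact: recolors_weaken rec2.
  by move=> x xP; rewrite eqp ?PB ?Pv.
have [||pi2 st2] := @settles_set _ L2 _ 1 _ st1 => // [S v SL vL vS|].
  have vP : v \notin K :|: I :|: S.
    by rewrite inE negb_or vS andbT; apply/negP => /(disjointFr dB2); rewrite vL.
  have cov2 : v |: (K :|: I :|: S) :|: (L2 :\: (v |: S)) = K :|: I :|: L2.
    apply/setP => y; rewrite !inE -/L2.
    have [->|yv] := eqVneq y v; first by move: vL; rewrite !inE => ->; rewrite !orbT.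
    by case: (boolP (y \in S)) => [yS|_]; rewrite ?orbF //= orbT;
      move/(subsetP SL): yS; rewrite !inE => ->; rewrite orbT.
  split.
    apply: leq_trans (leq_nbr _ _) (deg2 v vL); exact: setUS.
  apply: (@settable_layers _ (L2 :\: (v |: S)) L1) => //.
  - by rewrite cov2.
  - rewrite disjoints_subset; apply/subsetP => y; rewrite in_setU1 in_setU in_setC in_setD in_setU1 => H.
    case/orP: H => [->//|/orP[yB|->]]; last by rewrite orbT.
    by rewrite (disjointFr dB2) // andbF.
  - by rewrite cov2.
  - by move=> x; rewrite cov2 inE => /andP[_ /deg2].
have [||pi3 st3] := @settles_set _ L1 _ 1 _ st2 => // [S v SL vL vS|].
  have vP : v \notin K :|: I :|: L2 :|: S.
    by rewrite inE negb_or vS andbT; apply/negP => /(disjointFr d12); rewrite vL.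
  split; first by apply: leq_trans (leq_nbr _ (subsetT _)) (deg1 v vL).
  apply: (@settable_layers _ set0 (L1 :\: (v |: S))) => //.
  - apply/setP => y; rewrite in_setT setU0 in_setU in_setU1 in_setU in_setD in_setU1.
    have : y \in K :|: I :|: L2 :|: L1 by rewrite cover.
    by rewrite in_setU; case: (_ == v); case: (y \in S); case: (y \in _ :|: L2).
  - by rewrite disjoint_sym disjoints_subset sub0set.
  - rewrite setU0 disjoints_subset; apply/subsetP => y.
    rewrite in_setU1 in_setU in_setC in_setD in_setU1 => /orP[->//|/orP[yB|->]]; last by rewrite orbT.
    by rewrite (disjointFr d12) // andbF.
  - by move=> x; rewrite inE.
  - by move=> x; rewrite inE => /andP[_ /deg1].
exists pi3; move: st3; rewrite cover => st3 C alpha cardC pr.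
have [sigma [beta [injs prb eqb rec]]] := st3 C alpha cardC pr.
(* The passes add up to [2 * #|I| + #|L2| + #|L1|], which is n - [#|K|] + [#|I|], hence below n. *)
exists sigma, beta; split=> //; apply: recolors_weaken rec => _.
have := cardsU (K :|: I :|: L2) L1; rewrite cover cardsT.
have := cardsU (K :|: I) L2; have := cardsU K I.
have -> : K :&: I = set0 by apply/eqP; rewrite setI_eq0.
have -> : (K :|: I) :&: L2 = set0 by apply/eqP; rewrite setI_eq0.
have -> : (K :|: I :|: L2) :&: L1 = set0 by apply/eqP; rewrite setI_eq0.
rewrite cards0; lia.
Qed.

End Layers.

(** * A clique and a disjoint union of cliques *)

Section CliqueAndCliques.
Variables (d : nat) (G : sgraph) (K : {set G}).
Hypothesis deg : degen d G.
Hypothesis C4G : C4_free G.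
Hypothesis clK : clique K.
Hypothesis P3K : forall a b c, a \notin K -> b \notin K -> c \notin K ->
  adj a b -> adj b c -> a != c -> adj a c.
Implicit Types (U : {set G}).

(** Otherwise a neighbour in [K] private to [x] and one private to [y] close an induced C4 with the
    edge between [x] and [y]. *)
Lemma nested_nbr x y : x \notin K -> y \notin K -> adj x y -> #|nbr x K| <= #|nbr y K| ->
  nbr x K \subset nbr y K.
Proof.
move=> xK yK xy le; apply/subsetP => p; rewrite in_nbr => /andP[pK xp].
rewrite in_nbr pK; apply: contraLR le => yp; rewrite -ltnNge; apply: proper_card.
apply/properP; split; last by exists p; rewrite in_nbr pK.
apply/subsetP => q; rewrite !in_nbr => /andP[qK yq]; rewrite qK /=.
have pq : p != q by apply: contraNneq yp => ->.
apply/negPn/negP => xq; apply: (C4G (a := p) (b := q) (c := y) (d := x)) => //.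
- exact: clK.
- by rewrite adj_sym.
- by rewrite adj_sym.
- by apply: contraNneq yK => <-.
- by apply: contraNneq xK => <-.
- by rewrite adj_sym.
- by rewrite adj_sym.
Qed.

(** Neighbours off [K] lie in the same clique as [x], and by nesting they see every neighbour of [x]
    in [K]. This dictates the order of attaching: by decreasing number of neighbours in [K], so that
    at most d processed vertices are adjacent to the new one. *)
Lemma clique_nbr_above x U : x \notin K ->
  (forall y, y \in U -> y \notin K -> #|nbr x K| <= #|nbr y K|) -> clique (nbr x U).
Proof.
move=> xK above y z; rewrite !in_nbr => /andP[yU xy] /andP[zU xz] yz.
have mixed p q : p \in K -> q \in U -> q \notin K -> adj x p -> adj x q -> adj p q.
  move=> pK qU qK xp xq; have := nested_nbr xK qK xq (above q qU qK).
  by move/subsetP/(_ p); rewrite !in_nbr pK xp adj_sym => /(_ isT).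
have [yK|yK] := boolP (y \in K); have [zK|zK] := boolP (z \in K).
- exact: clK.
- exact: mixed.
- by rewrite adj_sym; apply: mixed.
- by apply: (P3K (b := x)); rewrite // adj_sym.
Qed.

(* In a clique outside [K] the recolorings cascade along the order, and each
   one occupies a single color more than the clique had before. *)
Lemma cascade (C : finType) (phi : {ffun G -> C}) t : #|C| = d.+2 -> proper_on setT phi ->
  forall U s phi', uniq s -> moves U s phi phi' -> uniq t -> K \subset U ->
  U :|: [set x in t] = setT -> (forall x, x \in t -> x \notin U) -> {in K, phi' =1 phi} ->
  (forall x y, x \in t -> y \in U -> y \notin K -> #|nbr x K| <= #|nbr y K|) ->
  pairwise (fun x y => #|nbr y K| <= #|nbr x K|) t ->
  (forall x, x \in t -> #|(phi @: nbr x (U :\: K)) :|: (phi' @: nbr x (U :\: K))|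
     <= #|nbr x (U :\: K)|.+1) ->
  exists psi s', [/\ uniq s', moves setT s' phi psi & {in U, psi =1 phi'}].
Proof.
move=> cardC pr; elim: t => [|x t IH] U s phi' us mv ut KU cover tU eqK above sort inv.
  exists phi', s; split=> //; rewrite -cover (_ : _ :|: _ = U) //.
  by apply/setP => y; rewrite !inE orbF.
have [xt ut'] := andP ut; have xU : x \notin U by apply: tU; rewrite inE eqxx.
have xK : x \notin K by apply: contra xU => /(subsetP KU).
have aboveX y : y \in U -> y \notin K -> #|nbr x K| <= #|nbr y K|.
  by apply: above; rewrite inE eqxx.
have dUx : [disjoint U & [set x]] by rewrite disjoint_sym disjoints1.
have prU V : proper_on V phi by move=> y z _ _; apply: pr.
have partU : nbr x U = nbr x K :|: nbr x (U :\: K).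
  apply/setP => y; rewrite !inE.
  by have [/(subsetP KU)->|] := boolP (y \in K); rewrite ?orbF.
have splitU (f : G -> C) : f @: nbr x U = f @: nbr x K :|: f @: nbr x (U :\: K).
  by rewrite -imsetU -partU.
have cardU : #|nbr x U| = #|nbr x K| + #|nbr x (U :\: K)|.
  rewrite -cardsUI -partU (_ : _ :&: _ = set0) ?cards0 ?addn0 //.
  by apply/setP => y; rewrite !inE; case: (y \in K); rewrite ?andbF.
have eqimK : phi' @: nbr x K = phi @: nbr x K.
  by apply: eq_in_imset => y; rewrite in_nbr => /andP[yK _]; apply: eqK.
(* The neighbours of [x] in [K] keep their colors, so by [inv] old and new colors exceed the degree
   of [x] in [U] by at most one; this degree is at most d since the neighbourhood is a clique. *)
have [w|psi1 [s1 [us1 mv1 eq1 ch1]]] := moves_extend dUx us mv (prU _).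
  rewrite inE => /eqP->; rewrite (_ : nbr x [set x] = set0); last first.
    by apply/setP => y; rewrite !inE; case: eqVneq => [->|//]; rewrite adj_irrefl.
  rewrite cards0 add0n !splitU eqimK setUACA setUid cardC ltnS.
  apply: leq_trans (leq_card_setU _ _) _.
  apply: (@leq_trans (#|nbr x U|.+1)); last first.
    by rewrite ltnS; apply/(card_nbr_clique deg)/clique_nbr_above.
  by rewrite cardU -addnS leq_add ?leq_imset_card // inv // inE eqxx.
have tP y : y \in t -> y \notin x |: U.
  by move=> yt; rewrite !inE negb_or tU ?inE ?yt ?orbT // andbT; apply: contraNneq xt => <-.
have eqK1 : {in K, psi1 =1 phi} by move=> y yK; rewrite eq1 ?(subsetP KU) // eqK.
have [sx sort'] : all (fun y => #|nbr y K| <= #|nbr x K|) t /\ pairwise (fun x y => #|nbr y K| <= #|nbr x K|) t by apply/andP.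
have Ux : U :|: [set x] = x |: U by rewrite setUC.
rewrite Ux in mv1.
have [||||y z||w|psi [s2 [us2 mv2 eq2]]] := IH (x |: U) s1 psi1 us1 mv1 ut'.
- by apply: subset_trans KU (subsetUr _ _).
- by rewrite -cover; apply/setP => y; rewrite !inE orbCA orbA.
- exact: tP.
- exact: eqK1.
- move=> yt; rewrite in_setU1 => /orP[/eqP-> _|]; last by apply: above; rewrite inE yt orbT.
  by move/allP: sx; apply.
- exact: sort'.
- move=> wt; have wU := tP _ wt.
  have wK : w \notin K by apply: contra wU => /(subsetP KU); rewrite inE orbC => ->.
  have wtx : w \in x :: t by rewrite inE wt orbT.
  have xw : x != w by apply: contraNneq wU => <-; rewrite !inE eqxx.
  have eqim : psi1 @: nbr w (U :\: K) = phi' @: nbr w (U :\: K).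
    by apply: eq_in_imset => y; rewrite in_nbr inE => /andP[/andP[_ yU] _]; apply: eq1.
  have [wx|wx] := boolP (adj w x); last first.
    rewrite (_ : nbr w _ = nbr w (U :\: K)); first by rewrite eqim; apply: inv.
    apply/setP => y; rewrite !inE; have [->|//] := eqVneq y x.
    by rewrite (negbTE wx) !andbF.
  have nw : nbr w ((x |: U) :\: K) = x |: nbr w (U :\: K).
    apply/setP => y; rewrite !inE; have [->|//] := eqVneq y x.
    by rewrite xK wx.
  (* Being adjacent off [K], [w] and [x] belong to the same clique there. *)
  have nwx : nbr w (U :\: K) = nbr x (U :\: K).
    apply/setP => y; rewrite !inE.
    have [/andP[yK yU]|//] := boolP ((y \notin K) && (y \in U)) => /=.
    have yx : x != y by apply: contraNneq xU => ->.
    have yw : w != y by apply: contraNneq wU => ->; rewrite !inE yU orbT.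
    apply/idP/idP => [wy|xy].
      by apply: (P3K (b := w)); rewrite // adj_sym.
    by apply: (P3K (b := x)).
  have cN : #|nbr w ((x |: U) :\: K)| = #|nbr w (U :\: K)|.+1.
    by rewrite nw cardsU1 !inE (negbTE xU) andbF.
  rewrite cN nw !imsetU1 eqim setUACA.
  have [ne|ne] := eqVneq (psi1 x) (phi x).
    rewrite ne setUid; apply: leq_trans (leq_card_setU _ _) _.
    by rewrite cards1 add1n ltnS; apply: inv.
  (* [x] changed because its neighbour [y] takes its color. As [y] lies off [K], [phi x] is among
     the new colors already counted for [w], and only [psi1 x] is added. *)
  have [y [yU xy E]] := ch1 x (set11 _) ne.
  have yK : y \notin K.
    apply/negP => yK; move: (pr x y (in_setT _) (in_setT _) xy).
    by rewrite -E eqK // eqxx.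
  have yN : phi x \in phi' @: nbr w (U :\: K).
    by rewrite -E imset_f // nwx in_nbr inE yK yU.
  set A := phi @: _; set B := phi' @: _.
  have -> : [set phi x] :|: [set psi1 x] :|: (A :|: B) = [set psi1 x] :|: (A :|: B).
    by apply/setP => z; rewrite !inE; have [->|_ //] := eqVneq z (phi x); rewrite yN !orbT.
  apply: leq_trans (leq_card_setU _ _) _.
  by rewrite cards1 add1n ltnS; apply: inv.
- exists psi, s2; split=> // y yU; rewrite eq2 ?inE ?yU ?orbT //; exact: eq1.
Qed.

(** Every vertex off [K] costs one pass, in which the cascade runs through the later vertices [s2];
    a nonempty [K] keeps the number of passes below n. *)
Lemma gathers_clique_cliques : 0 < #|K| -> gathers d G #|G|.-1.
Proof.
move=> K0; have [pi0 st0] := settles_clique deg clK.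
pose r x y := #|nbr y K| <= #|nbr x K|.
have rtr : transitive r by move=> y x z; rewrite /r => xy yz; apply: leq_trans yz xy.
pose s := sort r (enum (~: K)).
have us : uniq s by rewrite sort_uniq enum_uniq.
have sE x : (x \in s) = (x \notin K) by rewrite mem_sort mem_enum inE.
have srt : pairwise r s.
  by rewrite -sorted_pairwise //; apply: sort_sorted => x y; apply: leq_total.
have [||pi1 st1] := @settles_seq d G K 0 1 pi0 s st0 us => [x|s1 v s2 E|]; first by rewrite sE.
  have vK : v \notin K by rewrite -sE E mem_cat inE eqxx orbT.
  move: us srt; rewrite E cat_uniq pairwise_cat /= negb_or => /and4P[us1 /andP[v1 s12] v2 us2].
  case/and3P => r1 _ /andP[rv r2].
  have above y : y \in K :|: [set x in s1] -> y \notin K -> #|nbr v K| <= #|nbr y K|.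
    rewrite !inE => /orP[->//|ys _].
    by move: r1; rewrite allrel_consr => /andP[/allP/(_ _ ys)].
  split; first exact/(card_nbr_clique deg)/clique_nbr_above.
  move=> C phi c cardC pr fresh; pose phi' := update phi v c.
  pose U := v |: (K :|: [set x in s1]).
  have vP : v \notin K :|: [set x in s1] by rewrite !inE negb_or vK.
  have KU : K \subset U by apply/subsetP => x xK; rewrite !inE xK orbT.
  have mv : moves U [:: v] phi phi'.
    apply: moves_cons (moves_nil _ _) => //; last by move=> x xv; rewrite updateE (negbTE xv).
      by rewrite !inE eqxx.
    have vfresh y : y \in U -> adj v y -> c != phi y.
      move=> yU vy; apply: contra fresh => /eqP->; apply: imset_f.
      by rewrite -nbrU1 in_nbr yU.
    move=> x y xB yB xy; rewrite !updateE; case: (eqVneq x v) => [xv|_]; case: (eqVneq y v) => [yv|_].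
    - by move: xy; rewrite xv yv adj_irrefl.
    - by apply: vfresh; rewrite -?xv.
    - by rewrite eq_sym; apply: vfresh; rewrite // -yv adj_sym.
    - exact: pr.
  have s2U x : x \in s2 -> x \notin U.
    move=> x2; rewrite !inE !negb_or -sE E mem_cat inE x2 !orbT /=.
    rewrite (contraNneq _ v2) /= => [|<- //].
    by apply: contra s12 => x1; apply/hasP; exists x.
  have [||||||x y xs yU yK|||psi [s' [us' mv' eqU]]] := cascade cardC pr (t := s2) _ mv => //.
  - apply/setP => x; rewrite !inE; have := sE x; rewrite E mem_cat inE.
    by case: (x \in K); case: (x == v); case: (x \in s1); case: (x \in s2).
  - by move=> x xK; rewrite updateE; case: (eqVneq x v) => // xv; rewrite xv (negbTE vK) in xK.
  - have vx : #|nbr x K| <= #|nbr v K| by move/allP: rv; apply.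
    move: yU; rewrite in_setU1 => /orP[/eqP->//|yU].
    exact: leq_trans vx (above _ yU yK).
  - move=> x _; apply: (@card_two_images _ _ _ _ _ c) => y _.
    by rewrite updateE; case: (eqVneq y v) => [_|_]; [right|rewrite eqxx].
  exists psi; split.
  - exact: moves_proper mv' pr.
  - by rewrite eqU ?inE ?eqxx // updateE eqxx.
  - move=> x xP; rewrite eqU ?inE; last by move: xP; rewrite !inE => ->; rewrite orbT.
    by rewrite updateE; case: (eqVneq x v) => // xv; rewrite -xv xP in vP.
  - by exists s' => // x; rewrite count_uniq_mem //; case: (_ \in _).
exists pi1 => C alpha cardC pr.
have [sigma [beta [injs prb eqb rec]]] := st1 C alpha cardC pr.
exists sigma, beta; split=> // [x _|].
  by apply: eqb; rewrite !inE sE; case: (x \in K).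
apply: recolors_weaken rec => _; rewrite add0n mul1n size_sort -cardE cardsCs setCK.
by rewrite -ltnS; lia.
Qed.

End CliqueAndCliques.

(** * Permuting the classes of a partition *)

Section Permuting.
Variables (G : sgraph) (C : finType).

(** No edge joins a color of [phi] to the same color of [psi], so every mixture of the two colorings
    is proper and the vertices can change over one by one. *)
Lemma recolors_compatible (phi psi : {ffun G -> C}) :
  proper_on setT phi -> proper_on setT psi -> (forall x y, adj x y -> phi x != psi y) ->
  recolors (fun x => phi x != psi x) phi psi.
Proof.
move=> prphi prpsi comp.
suff main t (chi : {ffun G -> C}) : uniq t -> (forall x, chi x = if x \in t then phi x else psi x) ->
    moves setT t chi psi.
  pose t := enum [set x | phi x != psi x]; exists t.
    apply: main => [|x]; first exact: enum_uniq.
    by rewrite mem_enum inE; case: eqP.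
  by move=> v; rewrite count_uniq_mem ?enum_uniq // mem_enum inE.
elim: t chi => [|v t IH] chi ut chiE.
  by rewrite (_ : chi = psi); [exact: moves_nil|apply/ffunP => x; rewrite chiE].
have [vt ut'] := andP ut.
have E1 x : update chi v (psi v) x = if x \in t then phi x else psi x.
  rewrite updateE; case: (eqVneq x v) => [->|xv]; first by rewrite (negbTE vt).
  by rewrite chiE inE (negbTE xv).
apply: moves_cons (IH _ ut' E1); rewrite ?inE //; last first.
  by move=> x xv; rewrite updateE (negbTE xv).
move=> x y xT yT xy; rewrite !E1.
case: ifP => _; case: ifP => _; [exact: prphi|exact: comp| |exact: prpsi].
by rewrite eq_sym; apply: comp; rewrite adj_sym.
Qed.

Variables (m : nat) (pi : G -> 'I_m).
Hypothesis pi_proper : forall x y, adj x y -> pi x != pi y.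
Implicit Types sigma tau : {ffun 'I_m -> C}.

Definition paint sigma : {ffun G -> C} := [ffun x => sigma (pi x)].

Lemma paint_proper sigma : injective sigma -> proper_on setT (paint sigma).
Proof. by move=> inj x y _ _ xy; rewrite !ffunE (inj_eq inj) pi_proper. Qed.

Definition reassign sigma i c : {ffun 'I_m -> C} := [ffun j => if j == i then c else sigma j].

Lemma reassign_inj sigma i c : injective sigma -> c \notin codom sigma -> injective (reassign sigma i c).
Proof.
move=> inj cs j l; rewrite !ffunE.
case: (eqVneq j i) => [->|_]; case: (eqVneq l i) => [->|_] //.
- by move=> E; case/negP: cs; rewrite E codom_f.
- by move=> E; case/negP: cs; rewrite -E codom_f.
- exact: inj.
Qed.

Lemma recolors_reassign sigma i c : injective sigma -> c \notin codom sigma ->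
  recolors (fun x => pi x == i) (paint sigma) (paint (reassign sigma i c)).
Proof.
move=> inj cs; have injr := reassign_inj (i := i) inj cs.
have [|] := recolors_compatible (paint_proper inj) (paint_proper injr).
  move=> x y xy; rewrite !ffunE; case: (eqVneq (pi y) i) => _.
    by apply: contraNneq cs => <-; rewrite codom_f.
  by rewrite (inj_eq inj) pi_proper.
move=> s mv cnt; exists s => // v; apply: leq_trans (cnt v) _.
by rewrite !ffunE; case: (eqVneq (pi v) i); rewrite ?eqxx // leq_b1.
Qed.

(** Both images have [m] elements, so neither can be properly contained in the other. *)
Lemma free_target sigma tau i0 : injective sigma -> injective tau -> sigma i0 \notin codom tau ->
  exists i, tau i \notin codom sigma.
Proof.
move=> injs injt no; apply/existsP; apply: contraR no => /existsPn all.
have sub : codom tau \subset codom sigma.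
  by apply/subsetP => c /codomP[i ->]; apply/negPn.
have /subset_leqif_card/leqifP : codom tau \subset codom sigma by [].
by rewrite !card_codom // ltnn; case: ifP => // /subsetP/(_ _ (codom_f sigma i0)).
Qed.

(* When no class can move to its target, one is parked on a spare color; it then
   needs just one more move. *)
Lemma recolors_permute tau n : m < #|C| -> injective tau -> forall sigma, injective sigma ->
  #|[set i | sigma i != tau i]| <= n ->
  recolors (fun x => (sigma (pi x) != tau (pi x)).*2) (paint sigma) (paint tau) /\
  forall i0, sigma i0 \notin codom tau ->
    recolors (fun x => if pi x == i0 then 1 else (sigma (pi x) != tau (pi x)).*2)
      (paint sigma) (paint tau).
Proof.
move=> ltm injt; elim: n => [|n IH] sigma injs leW.
  have E : sigma = tau.
    apply/ffunP => i; apply/eqP; move: leW; rewrite leqn0 cards_eq0 => /eqP/setP/(_ i).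
    by rewrite !inE => /negbT/negPn.
  by rewrite E; split=> [|i0]; [|rewrite codom_f]; first exact: recolors_refl.
have wrong sigma' i : tau i \notin codom sigma' -> sigma' i != tau i.
  by apply: contraNneq => <-; rewrite codom_f.
have fewer sigma' i : #|[set i | sigma' i != tau i]| <= n.+1 -> tau i \notin codom sigma' ->
    #|[set j | reassign sigma' i (tau i) j != tau j]| <= n.
  move=> le free; rewrite -ltnS; apply: leq_trans le; apply: proper_card; apply/properP; split.
    by apply/subsetP => j; rewrite !inE ffunE; case: (eqVneq j i) => [->|//]; rewrite eqxx.
  by exists i; rewrite !inE ?ffunE ?eqxx // wrong.
(* While [i0] sits on a color that [tau] does not use, some class finds its target free. This is
   stated for any [sigma'] because it is applied again after [i0] has been parked, when as many
   classes as before are misplaced. *)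
have part2 sigma' i0 : injective sigma' -> #|[set i | sigma' i != tau i]| <= n.+1 ->
    sigma' i0 \notin codom tau ->
    recolors (fun x => if pi x == i0 then 1 else (sigma' (pi x) != tau (pi x)).*2)
      (paint sigma') (paint tau).
  move=> injs' le0 no; have [i free] := free_target injs' injt no.
  have inj1 := reassign_inj (i := i) injs' free.
  have [IH1 IH2] := IH _ inj1 (fewer _ _ le0 free).
  have [ii0|ii0] := eqVneq i i0.
    apply: recolors_weaken (recolors_trans (recolors_reassign i injs' free) IH1) => x.
    rewrite ii0 ffunE; case: (eqVneq (pi x) i0) => [->|_]; first by rewrite eqxx.
    by rewrite add0n.
  have no1 : reassign sigma' i (tau i) i0 \notin codom tau.
    by rewrite ffunE eq_sym (negbTE ii0).
  apply: recolors_weaken (recolors_trans (recolors_reassign i injs' free) (IH2 _ no1)) => x.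
  rewrite ffunE; case: (eqVneq (pi x) i0) => [->|_]; first by rewrite eq_sym (negbTE ii0).
  case: (eqVneq (pi x) i) => [->|_]; last by rewrite add0n.
  by rewrite eqxx addn0 wrong.
split; last by move=> i0; apply: part2.
have [i free|none] := pickP (fun i => tau i \notin codom sigma).
  have [IH1 _] := IH _ (reassign_inj (i := i) injs free) (fewer _ _ leW free).
  apply: recolors_weaken (recolors_trans (recolors_reassign i injs free) IH1) => x.
  rewrite ffunE; case: (eqVneq (pi x) i) => [->|_]; last by rewrite add0n.
  by rewrite eqxx addn0 wrong.
have [/eqP|/set0Pn[i0]] := eqVneq [set i | sigma i != tau i] set0.
  rewrite -cards_eq0 => /eqP W0; have [|IH1 _] := IH _ injs; first by rewrite W0.
  exact: IH1.
rewrite inE => wi0.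
(* A spare color exists as there are fewer classes than colors; by [none] every target is in use, so
   the spare color is no target. *)
have [s ss] : exists c, c \notin [set c in codom sigma].
  by apply: exists_color; rewrite cardsE card_codom // card_ord.
rewrite inE in ss.
have inj1 := reassign_inj (i := i0) injs ss.
have no : reassign sigma i0 s i0 \notin codom tau.
  rewrite ffunE eqxx; apply: contra ss => /codomP[i ->].
  by move: (none i) => /negbT/negPn.
have W1 : #|[set i | reassign sigma i0 s i != tau i]| <= n.+1.
  apply: leq_trans leW; apply/subset_leq_card/subsetP => i; rewrite !inE ffunE.
  by case: (eqVneq i i0) => [->|].
apply: recolors_weaken (recolors_trans (recolors_reassign i0 injs ss) (part2 _ _ inj1 W1 no)) => x.
rewrite ffunE; case: (eqVneq (pi x) i0) => [->|_]; last by rewrite add0n.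
by rewrite wi0.
Qed.

End Permuting.

Lemma gathers_recolors d (G : sgraph) m (C : finType) (alpha beta : {ffun G -> C}) :
  gathers d G m -> #|C| = d.+2 -> proper_on setT alpha -> proper_on setT beta ->
  recolors (fun=> (m + m).+2) alpha beta.
Proof.
move=> [pi st] cardC pra prb.
have [sigma [alpha1 [injs pra1 ea reca]]] := st C alpha cardC pra.
have [tau [beta1 [injt prb1 eb recb]]] := st C beta cardC prb.
(* The classes are stable, since [alpha1] is proper and constant on them. *)
have pip x y : adj x y -> pi x != pi y.
  by move=> /(pra1 x y (in_setT _) (in_setT _)); rewrite !ea ?inE // (inj_eq injs).
pose sf := [ffun i => sigma i]; pose tf := [ffun i => tau i].
have injsf : injective sf by move=> i j; rewrite !ffunE; apply: injs.
have injtf : injective tf by move=> i j; rewrite !ffunE; apply: injt.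
have Ea : alpha1 = paint pi sf by apply/ffunP => x; rewrite !ffunE ea ?inE.
have Eb : beta1 = paint pi tf by apply/ffunP => x; rewrite !ffunE eb ?inE.
have [||rec _] := recolors_permute pip (tau := tf) (n := d.+1) _ injtf injsf.
- by rewrite cardC.
- by rewrite -[X in _ <= X]card_ord max_card.
rewrite -Ea -Eb in rec.
apply: recolors_weaken (recolors_trans (recolors_trans reca rec) (recolors_sym prb recb)) => v.
by case: (_ != _); lia.
Qed.

(** * Dominated and universal vertices *)

Section Deletion.
Variables (G : sgraph) (S : {set G}).
Local Notation H := (induced S).

Lemma adj_induced (x y : H) : adj x y = adj (val x) (val y).
Proof. by []. Qed.

Lemma induced_C4_free : C4_free G -> C4_free H.
Proof. by move=> free a b c d ab bc cd da ac bd; apply: (free (val a) (val b) (val c) (val d)). Qed.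

Lemma induced_P2P3_free : P2P3_free G -> P2P3_free H.
Proof.
by move=> free a b c d f ab cd df cf; apply: (free (val a) (val b) (val c) (val d) (val f)).
Qed.

Lemma card_nbr_induced (x : H) (X : {set H}) : #|nbr x X| = #|nbr (val x) (val @: X)|.
Proof.
rewrite -(card_imset (mem (nbr x X)) val_inj); congr #|pred_of_set _|.
apply/setP => y; rewrite in_nbr; apply/imsetP/andP => [[z]|[/imsetP[z zX ->] xz]].
  by rewrite in_nbr => /andP[zX xz] ->; rewrite imset_f.
by exists z; rewrite // in_nbr zX.
Qed.

Lemma induced_degen d : degen d G -> degen d H.
Proof.
move=> deg X /set0Pn[x0 x0X]; have [|y /imsetP[x xX ->] low] := deg (val @: X).
  by apply/set0Pn; exists (val x0); rewrite imset_f.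
by exists x; rewrite // card_nbr_induced.
Qed.

Lemma card_induced : #|H| = #|S|.
Proof. by rewrite card_sig; apply: eq_card. Qed.

(* Recolorings of an induced subgraph are simulated in [G]; [t v] lists the
   vertices of [G] that follow a move of [v]. *)
Lemma moves_simulate (C C' : finType) (lift : {ffun H -> C'} -> {ffun G -> C})
    (t : H -> seq G) :
  (forall v (f f1 : {ffun H -> C'}), proper_on setT f -> proper_on setT f1 ->
     (forall x, x != v -> f1 x = f x) -> moves setT (t v) (lift f) (lift f1)) ->
  forall s f g, moves setT s f g -> proper_on setT f ->
    moves setT (flatten (map t s)) (lift f) (lift g).
Proof.
move=> sim s f g; elim=> [f0|v s' f0 f1 g0 _ pr1 eq1 _ IH] pr0 /=; first exact: moves_nil.
exact: moves_cat (sim _ _ _ pr0 pr1 eq1) (IH pr1).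
Qed.

End Deletion.

Section Dominated.
Variables (G : sgraph) (d m : nat) (u v : G).
Hypothesis uv : u != v.
Hypothesis nadj : ~~ adj u v.
Hypothesis dom : forall x, adj u x -> adj v x.
Local Notation H := (induced [set~ u]).

Lemma mem_del x : x != u -> x \in [set~ u].
Proof. by rewrite !inE. Qed.

Let vu : v != u. Proof. by rewrite eq_sym. Qed.
Let v' : H := Sub v (mem_del vu).

(** The folding of G onto G - u that sends [u] to [v]: the default of [insubd] is taken at [u] only.
    By [dom] it is a homomorphism, so proper colorings of G - u pull back along it. *)
Definition retract (x : G) : H := insubd v' x.

Lemma val_retract x : val (retract x) = if x == u then v else x.
Proof. by rewrite /retract val_insubd !inE; case: (eqVneq x u). Qed.

Lemma retract_adj x y : adj x y -> adj (retract x) (retract y).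
Proof.
move=> xy; rewrite adj_induced !val_retract.
case: (eqVneq x u) => [xu|_]; case: (eqVneq y u) => [yu|_] //.
- by move: xy; rewrite xu yu adj_irrefl.
- by apply: dom; rewrite -xu.
- by rewrite adj_sym; apply: dom; rewrite -yu adj_sym.
Qed.

Lemma gathers_dominated : gathers d H m -> gathers d G m.+1.
Proof.
move=> [pi st]; exists (fun x => pi (retract x)) => C alpha cardC pr.
pose f0 : {ffun H -> C} := [ffun x => alpha (val x)].
pose lift (f : {ffun H -> C}) : {ffun G -> C} := [ffun x => f (retract x)].
have pr0 : proper_on setT f0.
  by move=> x y _ _ xy; rewrite !ffunE; apply: pr; rewrite ?inE // -adj_induced.
have prl (f : {ffun H -> C}) : proper_on setT f -> proper_on setT (lift f).
  by move=> prf x y _ _ xy; rewrite !ffunE; apply: prf; rewrite ?inE ?retract_adj.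
have [sigma [g [injs prg eqg [s mv cnt]]]] := st C f0 cardC pr0.
pose t (w : H) := if w == v' then [:: v; u] else [:: val w].
have sim w (f f1 : {ffun H -> C}) : proper_on setT f -> proper_on setT f1 ->
    (forall x, x != w -> f1 x = f x) -> moves setT (t w) (lift f) (lift f1).
  move=> prf prf1 eq1; rewrite /t; have [wv|wv] := eqVneq w v'; last first.
    apply: moves_cons (moves_nil _ _); rewrite ?inE //; first exact: prl.
    move=> x xw; rewrite !ffunE eq1 //; apply/eqP => /(congr1 val); rewrite val_retract.
    case: (eqVneq x u) => [_ vw|_ E]; last by rewrite E eqxx in xw.
    by case/eqP: wv; apply/val_inj; rewrite -vw.
  have same x : x != u -> x != v -> lift f1 x = lift f x.
    move=> xu xv; rewrite !ffunE eq1 // wv; apply/eqP => /(congr1 val).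
    by rewrite val_retract (negbTE xu) => /eqP; rewrite /= (negbTE xv).
  have rv : retract v = v' by apply/val_inj; rewrite val_retract (negbTE vu).
  have ru : retract u = v' by apply/val_inj; rewrite val_retract eqxx.
  (* [v] moves first, while [u] still has the former color of [v]; this is proper because [u] and
     [v] are not adjacent. *)
  pose phi1 := update (lift f) v (f1 v').
  have phi1E x : x != u -> phi1 x = lift f1 x.
    move=> xu; rewrite updateE; case: (eqVneq x v) => [->|xv]; last by rewrite same.
    by rewrite ffunE rv.
  have pr1 : proper_on setT phi1.
    have prv y : adj v y -> phi1 v != phi1 y.
      move=> vy; have yu : y != u by apply: contraNneq nadj => <-; rewrite adj_sym.
      by rewrite !phi1E //; apply: prl; rewrite ?inE.
    move=> x y _ _ xy; have [xv|xv] := eqVneq x v; first by rewrite xv prv // -xv.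
    have [yv|yv] := eqVneq y v; first by rewrite yv eq_sym prv // -yv adj_sym.
    by rewrite !updateE (negbTE xv) (negbTE yv); apply: prl; rewrite ?inE.
  apply: moves_cons pr1 _ _; rewrite ?inE //.
    by move=> x xv; rewrite updateE (negbTE xv).
  apply: moves_cons (prl _ prf1) _ (moves_nil _ _); rewrite ?inE //.
  by move=> x xu; rewrite phi1E.
have cntE w l : count_mem w (flatten (map t l)) = count_mem (retract w) l.
  elim: l => //= w0 l IH; rewrite count_cat IH; congr addn.
  rewrite /t -[w0 == retract w](inj_eq val_inj) val_retract; case: (eqVneq w0 v') => [->|wv] /=.
    case: (eqVneq w u) => [->|wu]; first by rewrite (negbTE vu) !eqxx.
    by rewrite add0n addn0.
  have wu : val w0 != u by have := valP w0; rewrite !inE.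
  rewrite addn0; case: (eqVneq w u) => [->|//].
  by rewrite (negbTE wu) (_ : val w0 == v = false) //; apply: contraNF wv => /eqP E; apply/eqP/val_inj.
exists sigma, (lift g); split=> //.
- exact: prl.
- by move=> x _; rewrite ffunE eqg ?inE.
(* An initial move gives [u] the color of [v]; it accounts for the additional unit in [m.+1]. *)
- exists (u :: flatten (map t s)).
    apply: moves_cons (moves_simulate sim mv pr0); rewrite ?inE //; first exact: prl.
    by move=> x xu; rewrite !ffunE val_retract (negbTE xu).
  move=> w; rewrite /= cntE -add1n; apply: leq_add (cnt _); exact: leq_b1.
Qed.

End Dominated.

Section Universal.
Variables (G : sgraph) (d m : nat) (w : G).
Hypothesis univ : forall x, x != w -> adj w x.
Local Notation H := (induced [set~ w]).

(** Adding [w] raises every degree in [X] by one. If the low vertex is [w] itself, then [X] has at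
    most d + 1 vertices and any of them will do. *)
Lemma degen_universal : degen d.+1 G -> degen d H.
Proof.
move=> deg X /set0Pn[x0 x0X].
have wX (x : H) : val x != w by have := valP x; rewrite !inE.
have wI : w \notin val @: X by apply/imsetP => -[x _ E]; have := wX x; rewrite -E eqxx.
have [|y yX low] := deg (w |: val @: X); first by apply/set0Pn; exists w; rewrite !inE eqxx.
have nE x : x != w -> #|nbr x (w |: val @: X)| = #|nbr x (val @: X)|.+1.
  move=> xw; rewrite (_ : nbr x _ = w |: nbr x (val @: X)).
    by rewrite cardsU1 in_nbr (negbTE wI).
  apply/setP => z; rewrite !inE; have [->|//] := eqVneq z w.
  by rewrite adj_sym univ.
move: yX low; rewrite in_setU1 => /orP[/eqP->|/imsetP[x xX ->]]; last first.
  by rewrite nE // ltnS => low; exists x; rewrite ?card_nbr_induced.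
have -> : nbr w (w |: val @: X) = val @: X.
  apply/setP => z; rewrite in_nbr in_setU1; have [->|zw] := eqVneq z w.
    by rewrite adj_irrefl (negbTE wI).
  by rewrite univ ?andbT.
rewrite card_imset; last exact: val_inj.
move=> low; exists x0 => //; rewrite -ltnS; apply: leq_trans low.
apply: proper_card; apply/properP; split; first by apply/subsetP => z; rewrite inE => /andP[].
by exists x0; rewrite // in_nbr adj_irrefl andbF.
Qed.

(** No other vertex has the color of [w], so [w] can stand still while the rest is recolored with
    the remaining colors; [w] forms the class [ord0] and [lift] shifts the other classes. *)
Lemma gathers_universal : gathers d H m -> gathers d.+1 G m.
Proof.
move=> [pi st].
pose ins x : option H := insub x.
exists (fun x => if ins x is Some y then lift ord0 (pi y) else ord0) => C alpha cardC pr.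
have insw : ins w = None by apply: insubN; rewrite !inE eqxx.
have insv (x : H) : ins (val x) = Some x by apply: valK.
have insP x : x != w -> {y : H | ins x = Some y & val y = x}.
  by move=> xw; exists (Sub x (mem_del xw)); [apply: insubT|apply: SubK].
pose C' : finType := {c : C | c != alpha w}.
have cardC' : #|C'| = d.+2.
  rewrite card_sig -[RHS]/(d.+3.-1) -cardC -(cardC1 (alpha w)).
  by apply: eq_card => c; rewrite !inE.
have away (x : H) : alpha (val x) != alpha w.
  have xw : val x != w by have := valP x; rewrite !inE.
  by apply: pr; rewrite ?inE // adj_sym univ.
pose f0 : {ffun H -> C'} := [ffun x => Sub (alpha (val x)) (away x)].
pose lft (f : {ffun H -> C'}) : {ffun G -> C} := [ffun x => if ins x is Some y then val (f y) else alpha w].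
have pr0 : proper_on setT f0.
  move=> x y _ _ xy; rewrite !ffunE -(inj_eq val_inj) /=; apply: pr; rewrite ?inE //.
have prl (f : {ffun H -> C'}) : proper_on setT f -> proper_on setT (lft f).
  move=> prf x y _ _ xy; rewrite !ffunE.
  have [xw|xw] := eqVneq x w; have [yw|yw] := eqVneq y w.
  - by move: xy; rewrite xw yw adj_irrefl.
  - by have [y' -> _] := insP y yw; rewrite xw insw eq_sym; apply: (valP (f y')).
  - by have [x' -> _] := insP x xw; rewrite yw insw; apply: (valP (f x')).
  - have [x' -> Ex] := insP x xw; have [y' -> Ey] := insP y yw.
    by rewrite (inj_eq val_inj); apply: prf; rewrite ?inE // adj_induced Ex Ey.
have [sigma [g [injs prg eqg [s mv cnt]]]] := st C' f0 cardC' pr0.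
have sim v (f f1 : {ffun H -> C'}) : proper_on setT f -> proper_on setT f1 ->
    (forall x, x != v -> f1 x = f x) -> moves setT [:: val v] (lft f) (lft f1).
  move=> prf prf1 eq1; apply: moves_cons (moves_nil _ _); rewrite ?inE //; first exact: prl.
  move=> x xv; rewrite !ffunE; have [xw|xw] := eqVneq x w; first by rewrite xw insw.
  have [x' -> Ex] := insP x xw; rewrite eq1 //.
  by apply: contraNneq xv => E; rewrite -Ex E.
exists (fun i => if unlift ord0 i is Some j then val (sigma j) else alpha w), (lft g); split.
- move=> i j; case: unliftP => [i' ->|->]; case: unliftP => [j' ->|->] //.
  + by move=> /val_inj/injs->.
  + by move=> E; have := valP (sigma i'); rewrite /= E eqxx.
  + by move=> E; have := valP (sigma j'); rewrite /= -E eqxx.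
- exact: prl.
- move=> x _; rewrite ffunE; have [->|xw] := eqVneq x w; first by rewrite insw unlift_none.
  by have [x' -> _] := insP x xw; rewrite liftK eqg ?inE.
- exists (flatten (map (fun v => [:: val v]) s)).
    have -> : alpha = lft f0.
      apply/ffunP => x; rewrite ffunE; have [->|xw] := eqVneq x w; first by rewrite insw.
      by have [x' -> <-] := insP x xw; rewrite ffunE.
    exact: moves_simulate sim _ _ _ mv pr0.
  move=> v; have -> : flatten (map (fun v : H => [:: val v]) s) = map val s.
    by elim: (s) => //= x l ->.
  have [->|vw] := eqVneq v w.
    rewrite (_ : count_mem _ _ = 0) //; apply/count_memPn/mapP => -[x _ E].
    by have := valP x; rewrite !inE -E eqxx.
  have [v' _ <-] := insP v vw; rewrite count_map -(eq_count (a1 := pred1 v')) //.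
Qed.

End Universal.

(** * Graphs without induced C5 and C6 *)

Lemma neq_adj (G : sgraph) (x y z : G) : adj x z -> ~~ adj y z -> x != y.
Proof. by move=> xz; apply: contraNneq => <-. Qed.

Ltac adj_tac := solve [assumption | rewrite adj_sym; assumption].

Ltac neq_tac :=
  match goal with |- is_true (?x != ?y) =>
    solve [ assumption | rewrite eq_sym; assumption
    | match goal with
      | H : is_true (adj x ?z) |- _ => apply: (@neq_adj _ x y z); adj_tac
      | H : is_true (adj ?z x) |- _ => apply: (@neq_adj _ x y z); adj_tac
      | H : is_true (adj y ?z) |- _ => rewrite eq_sym; apply: (@neq_adj _ y x z); adj_tac
      | H : is_true (adj ?z y) |- _ => rewrite eq_sym; apply: (@neq_adj _ y x z); adj_tac
      end ]
  end.

Ltac side_tac := solve [adj_tac | neq_tac].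

Ltac c4 a b c d :=
  exfalso; match goal with H : C4_free _ |- _ => apply: (@H a b c d); side_tac end.

(* The forbidden subgraph consists of the edge [a b] and the path [c d f]. *)
Ltac p23 a b c d f :=
  exfalso; match goal with H : P2P3_free _ |- _ => apply: (@H a b c d f); side_tac end.

Definition C5_free (G : sgraph) := forall a b c d f : G,
  adj a b -> adj b c -> adj c d -> adj d f -> adj f a ->
  ~~ adj a c -> ~~ adj a d -> ~~ adj b d -> ~~ adj b f -> ~~ adj c f -> False.

Definition C6_free (G : sgraph) := forall a b c d f g : G,
  adj a b -> adj b c -> adj c d -> adj d f -> adj f g -> adj g a ->
  ~~ adj a c -> ~~ adj a d -> ~~ adj a f -> ~~ adj b d -> ~~ adj b f -> ~~ adj b g ->
  ~~ adj c f -> ~~ adj c g -> ~~ adj d g -> False.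

Ltac c5 a b c d f :=
  exfalso; match goal with H : C5_free _ |- _ => apply: (@H a b c d f); side_tac end.

Ltac c6 a b c d f g :=
  exfalso; match goal with H : C6_free _ |- _ => apply: (@H a b c d f g); side_tac end.

Definition undominated (G : sgraph) := forall u v : G,
  u != v -> ~~ adj u v -> exists2 x, adj u x & ~~ adj v x.

Section HoleFree.
Variables (d : nat) (G : sgraph).
Hypothesis deg : degen d G.
Hypothesis C4G : C4_free G.
Hypothesis P23 : P2P3_free G.
Hypothesis C5G : C5_free G.
Hypothesis C6G : C6_free G.
Hypothesis undom : undominated G.
Implicit Types (D S W : {set G}).

Definition connected_set D := [forall A : {set G}, (A \subset D) && (A != set0) && (A != D) ==>
  [exists a in A, exists b in D :\: A, adj a b]].

Lemma connected_setP D (A : {set G}) : connected_set D -> A \subset D -> A != set0 -> A != D ->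
  exists a b, [/\ a \in A, b \in D, b \notin A & adj a b].
Proof.
move/forallP/(_ A) => + AD A0 AnD; rewrite AD A0 AnD /=.
by case/existsP=> a /andP[aA /existsP[b /andP[]]]; rewrite inE => /andP[bA bD] ab; exists a, b.
Qed.

Lemma connected_set1 x : connected_set [set x].
Proof.
apply/forallP => A; apply/implyP => /andP[/andP[]].
by rewrite subset1 => /orP[/eqP->|/eqP->]; rewrite eqxx ?andbF.
Qed.

Lemma connected_setU1 D s c : connected_set D -> c \in D -> adj c s -> connected_set (s |: D).
Proof.
move=> conD cD cs; apply/forallP => A; apply/implyP => /andP[/andP[AsD /set0Pn[a0 a0A] AnsD]].
have [sD|sD] := boolP (s \in D).
  have E : s |: D = D by apply/setUidPr; rewrite sub1set.
  move: AsD AnsD; rewrite E => AD AnD.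
  by move/forallP/(_ A): conD; rewrite AD AnD (_ : A != set0) //; apply/set0Pn; exists a0.
have [E|ne] := eqVneq (A :&: D) set0.
  have As x : x \in A -> x = s.
    move=> xA; move/subsetP/(_ x xA): AsD; rewrite in_setU1 => /orP[/eqP//|xD].
    by have := in_set0 x; rewrite -E inE xA xD.
  apply/existsP; exists s; rewrite -{1}(As a0 a0A) a0A; apply/existsP; exists c.
  rewrite adj_sym cs !inE cD orbT !andbT; apply/negP => /As cE.
  by rewrite -cE cD in sD.
have [E|ne'] := eqVneq (A :&: D) D.
  have sA : s \notin A.
    apply: contra AnsD => sA; rewrite eqEsubset AsD; apply/subsetP => x.
    by rewrite in_setU1 => /orP[/eqP->//|]; rewrite -E inE => /andP[].
  apply/existsP; exists c; apply/andP; split; first by move: cD; rewrite -{1}E inE => /andP[].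
  by apply/existsP; exists s; rewrite !inE eqxx sA cs.
have [a [b [aA bD bA ab]]] := connected_setP conD (subsetIr A D) ne ne'.
apply/existsP; exists a; move: aA; rewrite inE => /andP[-> aD]; apply/existsP; exists b.
by move: bA; rewrite !inE bD andbT orbT andbT => ->.
Qed.

(** For the largest possible [D], over all choices of [u], the boundary of [D] is complete to
    everything beyond it. *)
Definition remote u D := [&& connected_set D, D != set0 & [forall x in D, (x != u) && ~~ adj u x]].

Lemma connected_edge D x : connected_set D -> x \in D -> D != [set x] -> exists2 y, y \in D & adj x y.
Proof.
move=> con xD ne; have [|||a [b [/set1P-> bD _ xb]]] := connected_setP (A := [set x]) con.
- by rewrite sub1set.
- by apply/set0Pn; exists x; rewrite inE.
- by rewrite eq_sym.
- by exists b.
Qed.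

Section Extremal.
Variables (u : G) (D : {set G}).
Hypothesis rem : remote u D.
Hypothesis maxD : forall w D', remote w D' -> #|D'| <= #|D|.

Let con : connected_set D. Proof. by case/and3P: rem. Qed.
Let D0 : D != set0. Proof. by case/and3P: rem. Qed.

Definition boundary := [set s | (s \notin D) && [exists c in D, adj c s]].
Local Notation S := boundary.
Definition outer := ~: (D :|: S).
Local Notation W := outer.

Lemma boundaryP s : reflect (s \notin D /\ exists2 c, c \in D & adj c s) (s \in S).
Proof.
rewrite inE; apply: (iffP andP) => -[sD].
  by case/existsP => c /andP[cD cs]; split; last by exists c.
by case=> c cD cs; split=> //; apply/existsP; exists c; rewrite cD.
Qed.

Lemma outer_nadj w c : w \in W -> c \in D -> ~~ adj w c.
Proof.
rewrite !inE negb_or => /andP[wD]; rewrite wD /= => /existsPn/(_ c) none cD.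
by move: none; rewrite cD adj_sym.
Qed.

(** If [w] missed [s], then [s |: D] would be remote from [w] and larger than [D]. This is why the
    maximum is taken over all vertices and not for [u] alone. *)
Lemma outer_complete w s : w \in W -> s \in S -> adj w s.
Proof.
move=> wW sS; have [sD [c cD cs]] := boundaryP _ sS.
have wD : w \notin D by move: wW; rewrite !inE negb_or => /andP[].
have wS : w \notin S by move: wW; rewrite inE in_setU negb_or => /andP[].
apply/negPn/negP => ws; have := maxD (w := w) (D' := s |: D).
rewrite cardsU1 sD /= add1n ltnn => F; suff /F : remote w (s |: D) by [].
apply/and3P; split.
- exact: connected_setU1 cD cs.
- by apply/set0Pn; exists s; rewrite !inE eqxx.
- apply/forallP => x; apply/implyP; rewrite in_setU1 => /orP[/eqP->|xD].
    by rewrite ws andbT; apply: contraNneq wS => <-.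
  by rewrite outer_nadj // andbT; apply: contraNneq wD => <-.
Qed.

Lemma u_outer : u \in W.
Proof.
have /forallP far : [forall x in D, (x != u) && ~~ adj u x] by case/and3P: rem.
rewrite !inE negb_or; have uD : u \notin D.
  by apply/negP => uD; have := far u; rewrite uD eqxx.
rewrite uD /=; apply/existsPn => c; apply/negP => /andP[cD]; rewrite adj_sym.
by have := far c; rewrite cD /= => /andP[_ /negbTE->].
Qed.

(* If [s] misses part of [D], then an edge from [u] to [s] makes the part of [D]
   off [N(s)] a union of cliques; so a clique there touches [N(s)]. *)
Lemma reach_boundary s y : s \in S -> y \in D -> ~~ adj s y ->
  exists q x, [/\ q \in D, x \in D, ~~ adj s q, adj s x & adj q x] /\ (q = y \/ adj q y).
Proof.
move=> sS yD sy; have [sD [c cD cs]] := boundaryP _ sS.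
(* [A] consists of [y] and its neighbours in [D] off N(s); the edge sought is one that leaves [A]
   inside [D]. *)
pose A := [set z in D | ~~ adj s z && ((z == y) || adj z y)].
have [|||a [b [aA bD bA ab]]] := connected_setP (A := A) con.
- by apply/subsetP => z; rewrite inE => /andP[].
- by apply/set0Pn; exists y; rewrite inE yD sy eqxx.
- by apply: contraNneq sD => E; move: cD; rewrite -E inE adj_sym cs andbF.
move: aA; rewrite inE => /and3P[aD sa aE].
have us : adj u s := outer_complete u_outer sS.
have [ub ua uy] : [/\ ~~ adj u b, ~~ adj u a & ~~ adj u y] by split; apply: outer_nadj u_outer _.
have sb : adj s b.
  apply/negPn/negP => sb; case/negP: bA; rewrite inE bD sb /=.
  case: (eqVneq b y) => //= by_; case/orP: aE => [/eqP E|ay]; first by rewrite -E adj_sym.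
  by apply/negPn/negP => nby; p23 u s b a y.
exists a, b; split=> //; by case/orP: aE => [/eqP|]; [left|right].
Qed.

(** Nonadjacent [s] and [t] have the common neighbour [u]. A path from [s] to [t] with one, two or
    three inner vertices in [D] would close with [u] an induced C4, C5 or C6, and [reach_boundary]
    supplies such a path. *)
Lemma boundary_clique : clique S.
Proof.
move=> s t sS tS st; apply/negPn/negP => nst.
have us : adj u s := outer_complete u_outer sS.
have ut : adj u t := outer_complete u_outer tS.
have far c : c \in D -> ~~ adj u c := outer_nadj u_outer.
have private c : c \in D -> adj s c -> ~~ adj t c.
  move=> cD sc; apply/negP => tc; have uc := far c cD.
  have cu : c != u by apply: contraTneq u_outer => <-; rewrite !inE cD.
  c4 u s c t.
have noedge x y : x \in D -> y \in D -> adj s x -> adj t y -> ~~ adj x y.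
  move=> xD yD sx ty; apply/negP => xy.
  have tx := private x xD sx.
  have sy : ~~ adj s y by apply/negP => sy; move: ty; rewrite (negbTE (private y yD sy)).
  have [ux uy] : ~~ adj u x /\ ~~ adj u y by split; apply: far.
  c5 u s x y t.
have [tD [y yD yt]] := boundaryP _ tS.
have ty : adj t y by rewrite adj_sym.
have sy : ~~ adj s y by apply/negP => sy; move: ty; rewrite (negbTE (private y yD sy)).
have [q [x [[qD xD sq sx qx] qy]]] := reach_boundary sS yD sy.
have xy := noedge _ _ xD yD sx ty.
have [ux uy uq] : [/\ ~~ adj u x, ~~ adj u y & ~~ adj u q] by split; apply: far.
case: qy => [E|qy]; first by move: xy; rewrite -E adj_sym qx.
have tq : ~~ adj t q.
  by apply/negP => tq; move: (noedge _ _ xD qD sx tq); rewrite adj_sym qx.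
have tx := private x xD sx.
by c6 u s x q y t.
Qed.

(** Take [c] with the most neighbours in the boundary. If it misses [s], the vertex [x] from
    [reach_boundary] sees [s] and, since C4 and C5 are excluded, every boundary vertex that [c]
    sees. *)
Lemma hole_free_dominating : S != set0 -> exists2 c, c \in D & forall s, s \in S -> adj c s.
Proof.
move=> /set0Pn[s0 s0S]; have [_ [c0 c0D _]] := boundaryP _ s0S.
case: (arg_maxnP (fun c => #|nbr c S|) c0D) => c cD maxc.
exists c => // s sS; apply/negPn/negP => ncs.
have nsc : ~~ adj s c by rewrite adj_sym.
have [q [x [[qD xD sq sx qx] qc]]] := reach_boundary sS cD nsc.
have sD : s \notin D by have [] := boundaryP _ sS.
have cliqueS t : t \in S -> t != s -> adj s t.
  by move=> tS ts; apply: boundary_clique; rewrite // eq_sym.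
have sub z w : z \in D -> w \in D -> adj z w -> adj s w -> ~~ adj s z ->
    forall t, t \in S -> adj z t -> adj w t.
  move=> zD wD zw sw sz t tS zt; apply/negPn/negP => wt.
  have ts : t != s by apply: contraNneq sz => <-; rewrite adj_sym.
  have st := cliqueS t tS ts.
  have tw : t != w by apply: contraTneq tS => ->; rewrite inE wD.
  have sz' : s != z by apply: contraTneq sS => ->; rewrite inE zD.
  by c4 t s w z.
have sub2 t : t \in S -> adj c t -> adj x t.
  case: qc => [E|qc]; first by apply: sub; rewrite // -E.
  have [xc|xc] := boolP (adj x c); first by apply: sub; rewrite // adj_sym.
  move=> tS ct; have [qt|qt] := boolP (adj q t); first exact: (sub q x).
  apply/negPn/negP => xt.
  have ts : t != s by apply: contraNneq nsc => <-; rewrite adj_sym.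
  have st := cliqueS t tS ts.
  by c5 t c q x s.
have : #|nbr x S| <= #|nbr c S| := maxc x xD.
rewrite leqNgt; case/negP; apply: proper_card; apply/properP; split.
  by apply/subsetP => t; rewrite !in_nbr => /andP[tS /(sub2 _ tS)->]; rewrite tS.
by exists s; rewrite in_nbr sS // adj_sym.
Qed.

(** An edge in [D] makes [W] a disjoint union of cliques, and an edge in [W] does the same for [D],
    as P2+P3 is excluded. Both edges exist because no vertex is dominated. *)
Lemma gathers_extremal : gathers d G #|G|.-1.
Proof.
have P3off (x y a b c : G) : adj x y -> ~~ adj x a -> ~~ adj y a -> ~~ adj x b -> ~~ adj y b ->
    ~~ adj x c -> ~~ adj y c -> adj a b -> adj b c -> a != c -> adj a c.
  by move=> xy xa ya xb yb xc yc ab bc ac; apply/negPn/negP => nac; p23 x y a b c.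
have [c0 c0D] := set0Pn _ D0.
have uW := u_outer.
have ufar c : c \in D -> ~~ adj u c := outer_nadj uW.
have WS w s : w \in W -> s \in S -> adj w s by exact: outer_complete.
have part x : [|| x \in D, x \in S | x \in W] by rewrite in_setC in_setU; case: (x \in D); case: (x \in S).
have nbrW w x : w \in W -> adj w x -> (x \in S) || (x \in W).
  move=> wW wx; case/or3P: (part x) => [xD|->|->]; rewrite ?orbT //.
  by move: wx; rewrite (negbTE (outer_nadj wW xD)).
have nbrD c x : c \in D -> adj c x -> (x \in S) || (x \in D).
  move=> cD cx; case/or3P: (part x) => [->|->|xW]; rewrite ?orbT //.
  by move: cx; rewrite adj_sym (negbTE (outer_nadj xW cD)).
(* Otherwise [D] is the single vertex [c0], whose neighbours all lie in [S] and hence are neighbours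
   of [u]. *)
have [c1 c1D c01] : exists2 c1, c1 \in D & adj c0 c1.
  apply: (connected_edge con c0D); apply/eqP => E.
  have cu : c0 != u.
    by apply: contraTneq uW => <-; rewrite !inE c0D.
  have [|x cx ux] := undom cu; first by rewrite adj_sym ufar.
  case/orP: (nbrD _ _ c0D cx) => [xS|]; first by rewrite WS in ux.
  by rewrite E inE => /eqP xc; rewrite xc adj_irrefl in cx.
have P3W a b c : a \in W -> b \in W -> c \in W -> adj a b -> adj b c -> a != c -> adj a c.
  by move=> aW bW cW; apply: (P3off c0 c1); rewrite // adj_sym; apply: outer_nadj.
(* Otherwise all neighbours of [u] lie in [S], and [u] is dominated by a vertex of [D] that sees all
   of [S]. *)
have [w1 w1W [w2 w2W w12]] : exists2 w1, w1 \in W & exists2 w2, w2 \in W & adj w1 w2.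
  case: (boolP [exists w1 in W, exists w2 in W, adj w1 w2]) => [|/existsPn none].
    by case/existsP => w1 /andP[w1W /existsP[w2 /andP[w2W w12]]]; exists w1 => //; exists w2.
  have Nu x : adj u x -> x \in S.
    move=> ux; case/orP: (nbrW _ _ uW ux) => // xW.
    by move: (none u); rewrite uW /= => /existsPn/(_ x); rewrite xW ux.
  have S0 : S != set0.
    apply/set0Pn; have uc0 : u != c0 by apply: contraTneq uW => ->; rewrite !inE c0D.
    by have [|x ux _] := undom uc0; [apply: ufar|exists x; apply: Nu].
  have [c cD cS] := hole_free_dominating S0.
  have uc : u != c by apply: contraTneq uW => ->; rewrite !inE cD.
  by have [|x /Nu xS] := undom uc; [apply: ufar|rewrite cS].
(* [S] may be empty but the starting clique must not be, so a clique of [W] is joined to it. *)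
pose K := S :|: (w1 |: nbr w1 W).
have WK w : w \in w1 |: nbr w1 W -> w \in W.
  by rewrite in_setU1 in_nbr => /orP[/eqP->|/andP[]].
have adjK1 w : w \in w1 |: nbr w1 W -> w != w1 -> adj w1 w.
  by rewrite in_setU1 in_nbr => /orP[->//|/andP[]].
apply: (@gathers_clique_cliques d G K) => //; last 1 first.
- by apply/card_gt0P; exists w1; rewrite !inE eqxx orbT.
- move=> x y; rewrite !(in_setU _ S) => /orP[xS|xW] /orP[yS|yW] xy.
  + exact: boundary_clique.
  + by rewrite adj_sym WS ?WK.
  + by rewrite WS ?WK.
  + have [E|xw] := eqVneq x w1; first by rewrite E adjK1 // -E eq_sym.
    have [E|yw] := eqVneq y w1; first by rewrite E adj_sym adjK1.
    apply: (P3W x w1 y); rewrite ?adjK1 //; try exact: WK.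
    by rewrite adj_sym adjK1.
- move=> a b c; rewrite !(in_setU _ S) !negb_or => /andP[aS _] /andP[bS _] /andP[cS _] ab bc ac.
  have [bD|bD] := boolP (b \in D).
    have [aD cD] : a \in D /\ c \in D.
      split; [have := nbrD b a bD|have := nbrD b c bD bc]; last by rewrite (negbTE cS).
      by rewrite adj_sym ab (negbTE aS) => /(_ isT).
    by apply: (P3off w1 w2 a b c); rewrite ?outer_nadj.
  have bW : b \in W by have := part b; rewrite (negbTE bD) (negbTE bS).
  have [aW cW] : a \in W /\ c \in W.
    split; [have := nbrW b a bW|have := nbrW b c bW bc]; last by rewrite (negbTE cS).
    by rewrite adj_sym ab (negbTE aS) => /(_ isT).
  exact: (P3W a b c).
Qed.

End Extremal.

Lemma gathers_hole_free : 0 < #|G| -> gathers d G #|G|.-1.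
Proof.
move=> G0.
case: (boolP [exists p : G * G, (p.1 != p.2) && ~~ adj p.1 p.2]) => [|/existsPn complete]; last first.
  apply: (@gathers_clique_cliques d G setT) => //; last by rewrite cardsT.
  - by move=> x y _ _ xy; have := complete (x, y); rewrite /= xy negbK.
  - by move=> a b c; rewrite inE.
case/existsP => -[x y] /= /andP[xy nxy].
pose pr := fun p : G * {set G} => remote p.1 p.2.
have pr0 : pr (x, [set y]).
  apply/and3P; split; first exact: connected_set1.
    by apply/set0Pn; exists y; rewrite inE.
  by apply/forallP => z; apply/implyP => /set1P->; rewrite eq_sym xy.
case: (arg_maxnP (fun p : G * {set G} => #|p.2|) pr0) => -[u D] rem maxD.
by apply: (gathers_extremal rem) => w D' rem'; apply: (maxD (w, D')).
Qed.

End HoleFree.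

(** On explicit lists [each] and [some] compute to conjunctions and disjunctions, which can be split
    or handed to [lia]. *)
Fixpoint each (S : seq nat) (P : nat -> Prop) : Prop :=
  if S is i :: S' then P i /\ each S' P else True.

Fixpoint some (S : seq nat) (P : nat -> Prop) : Prop :=
  if S is i :: S' then P i \/ some S' P else False.

Lemma eachP S P : each S P <-> forall i, i \in S -> P i.
Proof.
elim: S => //= i S [IH1 IH2]; split=> [[Pi /IH1 PS] j|PS].
  by rewrite inE => /orP[/eqP->|/PS].
by split; [apply: PS; rewrite inE eqxx|apply: IH2 => j jS; apply: PS; rewrite inE jS orbT].
Qed.

Lemma some_intro S (P : nat -> Prop) i : i \in S -> P i -> some S P.
Proof. by elim: S => //= j S IH; rewrite inE => /orP[/eqP<-|/IH H] Pi; [left|right; apply: H]. Qed.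

(** * Blow-ups of a small graph *)

Section Blowup.
Variables (d : nat) (G : sgraph).
Hypothesis deg : degen d G.

(* [G] is obtained from the graph with adjacency table [e] by replacing its
   vertices by the sets of [Xs]; those with a diagonal entry become cliques. *)
Variables (Xs : seq {set G}) (e : seq (seq bool)).
Local Notation m := (size Xs).
Definition part i := nth set0 Xs i.
Definition entry i j := nth false (nth [::] e i) j.
Local Notation X := part.
Local Notation E := entry.

Definition blowup :=
  [/\ forall x, some (iota 0 m) (fun i => x \in X i),
      each (iota 0 m) (fun i => each (iota 0 i) (fun j => forall x, x \in X i -> x \in X j -> False)),
      all (fun i => all (fun j => E i j == E j i) (iota 0 m)) (iota 0 m) &
      each (iota 0 m) (fun i => each (iota 0 i.+1) (fun j =>
        forall x y, x \in X i -> y \in X j -> x != y -> adj x y = E i j))].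

Hypothesis blow : blowup.
Implicit Types S K I L : seq nat.

Definition merge S : {set G} := [set x | has (fun i => x \in X i) S].
Definition total S := sumn [seq #|X i| | i <- S].
(** The degree into the union of [S] of a vertex of part [i], except that the vertex itself is
    counted when its part belongs to [S] and is a clique. Adding [self] on the other side of
    inequalities corrects this without subtraction. *)
Definition weight S i := sumn [seq if E i j then #|X j| else 0 | j <- S].
Definition self i := if E i i then 1 else 0.

Lemma part_lt i x : x \in X i -> i < m.
Proof. by rewrite /X ltnNge => xi; apply/negP => le; rewrite nth_default // inE in xi. Qed.

Lemma part_inj i j x : x \in X i -> x \in X j -> i = j.
Proof.
move=> xi xj; have [_ dis _ _] := blow; move/eachP: dis => dis.
have go a b : a < b -> x \in X a -> x \in X b -> False.
  move=> ab xa xb; have := dis b; rewrite mem_iota add0n (part_lt xb) => /(_ isT)/eachP/(_ a).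
  by rewrite mem_iota ab => /(_ isT x xb xa).
by case: (ltngtP i j) => // [ij|ij]; [case: (go _ _ ij xi xj)|case: (go _ _ ij xj xi)].
Qed.

Lemma part_adj i j x y : x \in X i -> y \in X j -> x != y -> adj x y = E i j.
Proof.
have [_ _ sy ad] := blow; move/eachP: ad => ad.
wlog ij : i j x y / j <= i => [go xi yj xy|xi yj xy].
  have [|ij] := leqP j i; first by move=> ij; apply: go.
  rewrite adj_sym (go j i) 1?eq_sym //; last exact: ltnW.
  have mi : i \in iota 0 m by rewrite mem_iota (part_lt xi).
  have mj : j \in iota 0 m by rewrite mem_iota (part_lt yj).
  by move/allP: sy => /(_ i mi)/allP/(_ j mj)/eqP->.
have := ad i; rewrite mem_iota add0n (part_lt xi) => /(_ isT)/eachP/(_ j).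
by rewrite mem_iota add0n ltnS ij => /(_ isT); apply.
Qed.

Lemma part_cover x : exists i, x \in X i.
Proof.
have [cov _ _ _] := blow; have := cov x.
by elim: (iota 0 m) => //= i S IH [xi|/IH//]; exists i.
Qed.

Lemma merge_cons i S : merge (i :: S) = X i :|: merge S.
Proof. by apply/setP => x; rewrite !inE. Qed.

Lemma in_merge x i S : x \in X i -> (x \in merge S) = (i \in S).
Proof.
move=> xi; rewrite inE; apply/hasP/idP => [[j jS xj]|iS]; last by exists i.
by rewrite (part_inj xi xj).
Qed.

Lemma card_merge S : uniq S -> #|merge S| = total S.
Proof.
elim: S => [_|i S IH /andP[iS uS]]; first by apply: eq_card0 => x; rewrite inE.
rewrite merge_cons cardsU IH // (_ : _ :&: _ = set0) ?cards0 ?subn0 //.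
apply/setP => x; rewrite in_setI in_set0; apply/negP => /andP[xi].
by rewrite (in_merge S xi) (negbTE iS).
Qed.

Lemma card_nbr_merge S i x : uniq S -> x \in X i ->
  weight S i = #|nbr x (merge S)| + (if i \in S then self i else 0).
Proof.
move=> + xi; elim: S => [_|j S IH /andP[jS uS]].
  by rewrite addn0; symmetry; apply: eq_card0 => y; rewrite !inE.
rewrite /weight /= -/(weight S i) IH //.
have -> : nbr x (merge (j :: S)) = nbr x (X j) :|: nbr x (merge S).
  by apply/setP => y; rewrite merge_cons !inE andb_orl.
rewrite cardsU (_ : _ :&: _ = set0) ?cards0 ?subn0; last first.
  apply/setP => y; rewrite in_setI in_set0 !in_nbr; apply/negP => /andP[/andP[yj _] /andP[]].
  by rewrite (in_merge S yj) (negbTE jS).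
rewrite inE addnA [_ + #|nbr x (merge S)|]addnC.
have nj : #|nbr x (X j)| = if E i j then #|X j :\ x| else 0.
  case: ifP => Eij.
    apply: eq_card => y; rewrite in_nbr in_setD1; have [->|yx] := eqVneq y x.
      by rewrite adj_irrefl andbF.
    by case: (boolP (y \in X j)) => //= yj; rewrite (part_adj xi yj) 1?eq_sym.
  apply: eq_card0 => y; rewrite !inE; case: (boolP (y \in X j)) => //= yj.
  by have [<-|yx] := eqVneq x y; [rewrite adj_irrefl|rewrite (part_adj xi yj)].
rewrite nj; have [ij|ij] := eqVneq i j.
  subst j; rewrite (negbTE jS) /self; case: ifP => _ /=; last lia.
  by rewrite (cardsD1 x (X i)) xi /=; lia.
have -> : X j :\ x = X j.
  apply/setDidPl; rewrite disjoint_sym disjoints1; apply/negP => xj.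
  by rewrite (part_inj xi xj) eqxx in ij.
by rewrite /=; case: (E i j); lia.
Qed.

Lemma clique_merge S : all (fun i => all (E i) S) S -> clique (merge S).
Proof.
move=> /allP cl x y; rewrite !inE => /hasP[i iS xi] /hasP[j jS yj] xy.
by rewrite (part_adj xi yj xy); move/allP: (cl i iS); apply.
Qed.

Lemma blowup_clique S : uniq S -> all (fun i => all (E i) S) S -> total S <= d.+1.
Proof. by move=> uS cl; rewrite -card_merge // (card_clique deg) //; apply: clique_merge. Qed.

(** Degrees are constant on parts, so degeneracy on a union of parts yields one of finitely many
    inequalities between their sizes. *)
Lemma blowup_low S : uniq S -> 0 < total S ->
  some S (fun i => 0 < #|X i| /\ weight S i <= d + self i).
Proof.
move=> uS; rewrite -card_merge // => S0; have [|x xS low] := deg (X := merge S).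
  by rewrite -card_gt0.
move: (xS); rewrite inE => /hasP[i iS xi]; apply: (some_intro iS); split.
  by apply/card_gt0P; exists x.
by rewrite (card_nbr_merge uS xi) iS leq_add2r.
Qed.

(** This is [gathers_layers] with unions of parts as layers, which leaves only linear inequalities
    between sizes. Parts may be empty, hence the guards [0 < #|X i|]. *)
Lemma blowup_gathers K I L1 L2 : perm_eq (K ++ I ++ L1 ++ L2) (iota 0 m) ->
  all (fun i => all (E i) K) K -> all (fun i => all (E i) I) I -> total I < total K ->
  each I (fun i => 0 < #|X i| -> weight (K ++ I) i <= d + self i) ->
  each L1 (fun i => 0 < #|X i| -> weight (iota 0 m) i <= d + self i) ->
  each L2 (fun i => 0 < #|X i| -> weight (K ++ I ++ L2) i <= d + self i) ->
  gathers d G #|G|.-1.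
Proof.
move=> pe clK clI lt /eachP dI /eachP d1 /eachP d2.
have um : uniq (K ++ I ++ L1 ++ L2) by rewrite (perm_uniq pe) iota_uniq.
have memX i x : x \in X i -> i \in K ++ I ++ L1 ++ L2.
  by move=> xi; rewrite (perm_mem pe) mem_iota (part_lt xi).
have pos i x : x \in X i -> 0 < #|X i| by move=> xi; apply/card_gt0P; exists x.
move: (um); rewrite !cat_uniq !has_cat !negb_or => /and3P[uK /andP[KI /andP[K1 K2]]].
case/and3P=> uI /andP[I1 I2] /and3P[u1 L12 u2].
have dis S S' : ~~ has (mem S) S' -> [disjoint merge S & merge S'].
  move=> no; rewrite disjoints_subset; apply/subsetP => x; rewrite !inE => /hasP[i iS xi].
  apply/hasPn => j jS'; apply/negP => xj; case/hasP: no; exists j => //.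
  by rewrite (part_inj xj xi).
have catE S S' : merge (S ++ S') = merge S :|: merge S'.
  by apply/setP => x; rewrite !inE has_cat.
apply: (@gathers_layers d G deg (merge K) (merge I) (merge L1)).
- exact: clique_merge.
- exact: clique_merge.
- by rewrite !card_merge.
- exact: dis.
- by rewrite -catE dis //; apply/hasPn => i i1; rewrite inE mem_cat negb_or (hasPn K1) ?(hasPn I1).
- move=> x; rewrite inE => /hasP[i iI xi].
  have := dI i iI (pos _ _ xi); rewrite (card_nbr_merge _ xi) ?cat_uniq ?uK ?KI //.
  by rewrite mem_cat iI orbT leq_add2r catE.
- move=> x; rewrite inE => /hasP[i i1 xi].
  have := d1 i i1 (pos _ _ xi); rewrite (card_nbr_merge (iota_uniq _ _) xi).
  rewrite mem_iota (part_lt xi) leq_add2r; congr (_ <= _); apply: eq_card => y.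
  rewrite !in_nbr in_setT; have [j yj] := part_cover y.
  by rewrite (in_merge _ yj) mem_iota (part_lt yj).
- move=> x xK xI x1; have [i xi] := part_cover x.
  have i2 : i \in L2.
    by move: (memX i x xi) xK xI x1; rewrite !(in_merge _ xi) !mem_cat; case: (i \in K); case: (i \in I); case: (i \in L1).
  have u' : uniq (K ++ I ++ L2) by rewrite !cat_uniq !has_cat !negb_or uK KI K2 uI I2.
  have := d2 i i2 (pos _ _ xi); rewrite (card_nbr_merge u' xi) !mem_cat i2 !orbT leq_add2r.
  congr (_ <= _); apply: eq_card => y; rewrite !in_nbr in_setC; congr (_ && _).
  have [j yj] := part_cover y; rewrite !(in_merge _ yj).
  have := memX j y yj; move: um; rewrite !mem_cat.
  have [j1 _ _|j1 _ /= ->] := boolP (j \in L1); last by [].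
  apply/negP => /or3P[jK|jI|j2].
  + by move/hasPn/(_ j j1)/negP: K1; apply.
  + by move/hasPn/(_ j j1)/negP: I1; apply.
  + by move/hasPn/(_ j j2)/negP: L12; apply.
Qed.

End Blowup.

(** * Graphs with an induced C6 *)

Ltac split_hyp H :=
  lazymatch type of H with
  | is_true (_ && _) =>
      let H1 := fresh "h" in let H2 := fresh "h" in
      case/andP: H => H1 H2; split_hyp H1; split_hyp H2
  | _ => idtac
  end.

Ltac contra_adj :=
  match goal with
  | H : is_true (adj ?a ?b), H' : is_true (~~ adj ?a ?b) |- _ => by rewrite H in H'
  | H : is_true (adj ?a ?b), H' : is_true (~~ adj ?b ?a) |- _ => by rewrite adj_sym H in H'
  | H : is_true (adj ?a ?a) |- _ => by rewrite adj_irrefl in H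
  end.

Definition shift (T : Type) (v : nat -> T) i := fun j => v (j + i).

Section SixCycle.
Variables (G : sgraph) (v : nat -> G).
Hypothesis C4G : C4_free G.
Hypothesis P23 : P2P3_free G.
Hypothesis per : forall i, v i.+4.+2 = v i.
Hypothesis cyc : forall i,
  [&& adj (v i) (v i.+1), ~~ adj (v i) (v i.+2) & ~~ adj (v i) (v i.+3)].

Lemma cyc6 i : [&& adj (v i) (v i.+1), adj (v i.+1) (v i.+2), adj (v i.+2) (v i.+3),
  adj (v i.+3) (v i.+4), adj (v i.+4) (v i.+4.+1), adj (v i.+4.+1) (v i),
  ~~ adj (v i) (v i.+2), ~~ adj (v i.+1) (v i.+3), ~~ adj (v i.+2) (v i.+4),
  ~~ adj (v i.+3) (v i.+4.+1), ~~ adj (v i.+4) (v i), ~~ adj (v i.+4.+1) (v i.+1),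
  ~~ adj (v i) (v i.+3), ~~ adj (v i.+1) (v i.+4) & ~~ adj (v i.+2) (v i.+4.+1)].
Proof.
have /and3P[c0 d0 e0] := cyc i; have /and3P[c1 d1 e1] := cyc i.+1.
have /and3P[c2 d2 e2] := cyc i.+2; have /and3P[c3 d3 _] := cyc i.+3.
have /and3P[c4 d4 _] := cyc i.+4; have /and3P[c5 d5 _] := cyc i.+4.+1.
rewrite per in d4; rewrite per in c5; rewrite per in d5.
by rewrite c0 c1 c2 c3 c4 c5 d0 d1 d2 d3 d4 d5 e0 e1 e2.
Qed.

Lemma vmod i : v i = v (i %% 6).
Proof.
rewrite {1}(divn_eq i 6); elim: (i %/ 6) => [//|q IH].
by rewrite mulSn -addnA !addSn per.
Qed.

Lemma v_rel i j : exists2 r, r < 6 & v j = v (r + i).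
Proof.
exists ((j + 5 * i) %% 6); first by rewrite ltn_mod.
by rewrite [LHS]vmod [RHS]vmod; congr v; lia.
Qed.

(* By [six_types] the other vertices are attached to a pair of opposite vertices
   ([six_opp i]) or to all vertices but [v i] and [v i.+1] ([six_four i]). *)
Definition six_all := [set x | [forall j : 'I_6, adj x (v j)]].
Definition six_none := [set x | [forall j : 'I_6, ~~ adj x (v j)]].
Definition six_opp i := [set x | [&& adj x (v i), adj x (v i.+3), ~~ adj x (v i.+1),
  ~~ adj x (v i.+2), ~~ adj x (v i.+4) & ~~ adj x (v i.+4.+1)]].
Definition six_four i := [set x | [&& ~~ adj x (v i), ~~ adj x (v i.+1), adj x (v i.+2),
  adj x (v i.+3), adj x (v i.+4) & adj x (v i.+4.+1)]].
Local Notation U := six_all.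
Local Notation Z := six_none.
Local Notation O := six_opp.
Local Notation F := six_four.

Lemma all_six (P : pred G) i : [forall j : 'I_6, P (v j)] =
  [&& P (v i), P (v i.+1), P (v i.+2), P (v i.+3), P (v i.+4) & P (v i.+4.+1)].
Proof.
apply/forallP/idP => [all|].
  by do ?[apply/andP; split]; rewrite vmod; apply: (all (Ordinal (ltn_pmod _ (isT : 0 < 6)))).
case/and5P=> p0 p1 p2 p3 /andP[p4 p5] j.
by have [[|[|[|[|[|[|//]]]]]] _ ->] := v_rel i j.
Qed.

Lemma six_allE i x : (x \in U) = [&& adj x (v i), adj x (v i.+1), adj x (v i.+2),
  adj x (v i.+3), adj x (v i.+4) & adj x (v i.+4.+1)].
Proof. by rewrite inE (all_six (adj x) i). Qed.

Lemma six_noneE i x : (x \in Z) = [&& ~~ adj x (v i), ~~ adj x (v i.+1), ~~ adj x (v i.+2),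
  ~~ adj x (v i.+3), ~~ adj x (v i.+4) & ~~ adj x (v i.+4.+1)].
Proof. by rewrite inE (all_six (fun y => ~~ adj x y) i). Qed.

Ltac cyc i := let H := fresh in have H := cyc6 i; split_hyp H.
Ltac unp H := rewrite inE ?per in H; split_hyp H.
Ltac unpA i H := rewrite (six_allE i) in H; split_hyp H.
Ltac unpN i H := rewrite (six_noneE i) in H; split_hyp H.

Lemma six_gap i x : x != v i.+1 -> adj x (v i) && adj x (v i.+2) ==> adj x (v i.+1).
Proof. by move=> ne; apply/implyP => /andP[x0 x2]; apply/negPn/negP => x1; cyc i; c4 x (v i) (v i.+1) (v i.+2). Qed.

Lemma six_far i x : adj x (v i) ==> [|| adj x (v i.+2), adj x (v i.+3) | adj x (v i.+4)].
Proof.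
apply/implyP => x0; apply/negPn/negP; rewrite !negb_or => H; split_hyp H; cyc i.
by p23 x (v i) (v i.+2) (v i.+3) (v i.+4).
Qed.

(** Of the 64 possible neighbourhoods on the cycle, only these survive [six_gap], which excludes C4,
    and [six_far], which excludes P2+P3. *)
Lemma six_types i x : [|| x \in U, x \in Z,
  [|| x == v i, x == v i.+1, x == v i.+2, x == v i.+3, x == v i.+4 | x == v i.+4.+1],
  [|| x \in O i, x \in O i.+1 | x \in O i.+2] |
  [|| x \in F i, x \in F i.+1, x \in F i.+2, x \in F i.+3, x \in F i.+4 | x \in F i.+4.+1]].
Proof.
case: (boolP [|| x == v i, _, _, _, _ | _]) => [_|]; first by rewrite !orbT.
rewrite !negb_or => H; split_hyp H; rewrite (six_allE i) (six_noneE i) !inE !per /=.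
have := six_far i x.
have := six_far i.+1 x.
have := six_far i.+2 x.
have := six_far i.+3 x.
have := six_far i.+4 x.
have := six_far i.+4.+1 x.
have := @six_gap i x ltac:(rewrite ?per; assumption).
have := @six_gap i.+1 x ltac:(rewrite ?per; assumption).
have := @six_gap i.+2 x ltac:(rewrite ?per; assumption).
have := @six_gap i.+3 x ltac:(rewrite ?per; assumption).
have := @six_gap i.+4 x ltac:(rewrite ?per; assumption).
have := @six_gap i.+4.+1 x ltac:(rewrite ?per; assumption).
rewrite !per.
case: (adj x (v i)); case: (adj x (v i.+1)); case: (adj x (v i.+2)); case: (adj x (v i.+3));
  case: (adj x (v i.+4)); case: (adj x (v i.+4.+1))  => //=.
Qed.

Lemma six_oppS3 i : O i.+3 = O i.
Proof.
apply/setP => x; rewrite !inE !per.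
by case: (adj x (v i)); case: (adj x (v i.+1)); case: (adj x (v i.+2)); case: (adj x (v i.+3));
  case: (adj x (v i.+4)); case: (adj x (v i.+4.+1)).
Qed.

Lemma six_fourS6 i : F i.+4.+2 = F i.
Proof. by apply/setP => x; rewrite !inE !per. Qed.

(** * Adjacency between the types of vertices around a C6 *)

Lemma four0 i x y : x \in F i -> y \in F i -> x != y -> adj x y.
Proof.
by move=> xF yF xy; apply/negPn/negP => nxy; unp xF; unp yF; cyc i; c4 x (v i.+2) y (v i.+4).
Qed.

Lemma four1 i x y : x \in F i -> y \in F i.+1 -> adj x y.
Proof.
by move=> xF yF; apply/negPn/negP => nxy; unp xF; unp yF; cyc i; c4 x (v i.+3) y (v i.+4.+1).
Qed.

Lemma four2 i x y : x \in F i -> y \in F i.+2 -> ~~ adj x y.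
Proof.
by move=> xF yF; apply/negP => nxy; unp xF; unp yF; cyc i; c4 x (v i.+2) (v i.+1) y.
Qed.

Lemma four3 i x y : x \in F i -> y \in F i.+3 -> adj x y.
Proof.
by move=> xF yF; apply/negPn/negP => nxy; unp xF; unp yF; cyc i; c4 x (v i.+2) y (v i.+4.+1).
Qed.

Lemma opp0 i x y : x \in O i -> y \in O i -> x != y -> adj x y.
Proof.
by move=> xF yF xy; apply/negPn/negP => nxy; unp xF; unp yF; cyc i; c4 x (v i) y (v i.+3).
Qed.

Lemma opp1 i x y : x \in O i -> y \in O i.+1 -> ~~ adj x y.
Proof. by move=> xF yF; apply/negP => nxy; unp xF; unp yF; cyc i; c4 x (v i) (v i.+1) y. Qed.

Lemma opp2 i x y : x \in O i -> y \in O i.+2 -> ~~ adj x y.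
Proof. by rewrite adj_sym -(six_oppS3 i) => xF yF; apply: opp1 xF. Qed.

Lemma opp_four0 i x y : x \in O i -> y \in F i -> False.
Proof.
move=> xF yF; have xF' := xF; have yF' := yF; unp xF; unp yF; cyc i.
have [xy|xy] := boolP (adj x y); first by c4 x (v i) (v i.+4.+1) y.
by p23 x (v i) (v i.+2) y (v i.+4).
Qed.

Lemma opp_four5 i x y : x \in O i -> y \in F i.+4.+1 -> False.
Proof.
move=> xF yF; have xF' := xF; have yF' := yF; unp xF; unp yF; cyc i.
have [xy|xy] := boolP (adj x y); first by c4 x (v i) (v i.+1) y.
by p23 x (v i) (v i.+2) y (v i.+4).
Qed.

Lemma opp_four1 i x y : x \in O i -> y \in F i.+1 -> adj x y.
Proof.
by move=> xF yF; apply/negPn/negP => nxy; unp xF; unp yF; cyc i; c4 x (v i) y (v i.+3).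
Qed.

Lemma none_none x y : x \in Z -> y \in Z -> ~~ adj x y.
Proof.
by move=> xZ yZ; apply/negP => xy; unpN 0 xZ; unpN 0 yZ; cyc 0; p23 x y (v 0) (v 1) (v 2).
Qed.

Lemma none_four i x y : x \in Z -> y \in F i -> ~~ adj x y.
Proof.
move=> xZ yF; apply/negP => xy; unpN i xZ; unp yF; cyc i.
by p23 (v i) (v i.+1) x y (v i.+3).
Qed.

Lemma opp_single1 i x x' y : x \in O i -> x' \in O i -> y \in O i.+1 -> x = x'.
Proof.
move=> xO x'O yO; apply/eqP/negPn/negP => xx'; have adjxx' := opp0 xO x'O xx'.
have nxy := opp1 xO yO; have nx'y := opp1 x'O yO; unp xO; unp x'O; unp yO; cyc i.
by p23 x x' (v i.+2) (v i.+1) y.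
Qed.

Lemma opp_single2 i x x' y : x \in O i -> x' \in O i -> y \in O i.+2 -> x = x'.
Proof.
move=> xO x'O yO; apply/eqP/negPn/negP => xx'; have adjxx' := opp0 xO x'O xx'.
have nxy := opp2 xO yO; have nx'y := opp2 x'O yO; unp xO; unp x'O; unp yO; cyc i.
by p23 x x' (v i.+1) (v i.+2) y.
Qed.

Lemma four_no23 i x y z : x \in F i -> y \in F i.+2 -> z \in F i.+3 -> False.
Proof.
move=> xF yF zF; have xy := four2 xF yF; have xz := four3 xF zF; have yz := four1 yF zF.
by unp xF; unp yF; unp zF; cyc i; c4 x (v i.+4) y z.
Qed.

Lemma four_no25 i x y z : x \in F i -> y \in F i.+2 -> z \in F i.+4.+1 -> False.
Proof.
move=> xF yF zF; have xy := four2 xF yF; have yz := four3 yF zF.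
have zx : adj z x by apply: four1 zF _; rewrite six_fourS6.
by unp xF; unp yF; unp zF; cyc i; c4 x (v i.+4.+1) y z.
Qed.

Lemma four_single i x x' y z : x \in F i -> x' \in F i -> y \in F i.+2 -> z \in F i.+4 -> x = x'.
Proof.
move=> xF x'F yF zF; apply/eqP/negPn/negP => xx'; have adjxx' := four0 xF x'F xx'.
have [nxy nx'y] : ~~ adj x y /\ ~~ adj x' y by split; apply: four2 yF.
have yz := four2 yF zF.
have [zx zx'] : ~~ adj z x /\ ~~ adj z x' by split; apply: (four2 zF); rewrite six_fourS6.
by unp xF; unp x'F; unp yF; unp zF; cyc i; p23 x x' y (v i) z.
Qed.

Lemma all_four i x y : x \in U -> y \in F i -> adj x y.
Proof.
by move=> xU yF; apply/negPn/negP => nxy; unpA i xU; unp yF; cyc i; c4 x (v i.+2) y (v i.+4).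
Qed.

Lemma all_opp i x y : x \in U -> y \in O i -> adj x y.
Proof. by move=> xU yF; apply/negPn/negP => nxy; unpA i xU; unp yF; cyc i; c4 x (v i) y (v i.+3). Qed.

Lemma all_all x y : x \in U -> y \in U -> x != y -> adj x y.
Proof.
by move=> xU yU xy; apply/negPn/negP => nxy; unpA 0 xU; unpA 0 yU; cyc 0; c4 x (v 0) y (v 2).
Qed.

Lemma four4 i x y : x \in F i -> y \in F i.+4 -> ~~ adj x y.
Proof. by move=> xF yF; rewrite adj_sym; apply: four2 yF _; rewrite six_fourS6. Qed.

Lemma opp_four4 i x y : x \in O i.+2 -> y \in F i -> adj x y.
Proof.
by rewrite -[O i.+2](six_oppS3 i.+2) -(six_fourS6 i) => xO yF; apply: opp_four1 xO yF.
Qed.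

(** * Blow-ups arising from a C6 and their tables *)

Ltac unp_any H := first [unpN 0 H | unp H].

Ltac adj_lemma := solve
  [ eapply four0; eassumption | eapply four1; eassumption | eapply four2; eassumption
  | eapply four3; eassumption | eapply four4; eassumption | eapply opp0; eassumption
  | eapply opp_four4; eassumption | eapply opp1; eassumption
  | match goal with
    | N : forall z y j, _ -> _ -> is_true (adj z y) |- _ => eapply N; eassumption
    | N : forall x y, _ -> _ -> x = y, ne : is_true (?a != ?b) |- _ =>
        by rewrite (N a b) ?eqxx in ne
    end
  | eapply opp2; eassumption | eapply opp_four1; eassumption ].

Ltac adj_entry := solve
  [ adj_tac | adj_lemma | rewrite adj_sym; adj_lemma
  | apply: negbTE; solve [adj_tac | adj_lemma | rewrite adj_sym; adj_lemma] ].

Ltac disjoint_entry :=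
  let x := fresh "x" in let Hx := fresh "Hx" in let Hy := fresh "Hy" in
  move=> x Hx Hy; solve
  [ move: Hx Hy => /set1P-> /set1P/eqP; apply/negP; neq_tac
  | rewrite (set1P Hx) in Hy; unp_any Hy; contra_adj
  | rewrite (set1P Hy) in Hx; unp_any Hx; contra_adj
  | unp_any Hx; unp_any Hy; contra_adj ].

Ltac table_entry :=
  let x := fresh "x" in let y := fresh "y" in
  let Hx := fresh "Hx" in let Hy := fresh "Hy" in let ne := fresh "ne" in
  move=> x y Hx Hy ne; solve
  [ move: Hx Hy ne => /set1P-> /set1P-> ne; first [by rewrite eqxx in ne | adj_entry]
  | rewrite (set1P Hx); unp_any Hy; adj_entry
  | rewrite (set1P Hy); unp_any Hx; adj_entry
  | adj_entry ].

Lemma some_has T (S : seq nat) (X : nat -> {set T}) x :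
  has (fun i => x \in X i) S -> some S (fun i => x \in X i).
Proof. by elim: S => //= i S IH /orP[|/IH]; [left|right]. Qed.

Ltac blowup_tac H := cyc 0; split;
  [ let x := fresh "x" in move=> x; apply: some_has; have := H x;
    by rewrite /part /= !in_set1 ?orbF
  | rewrite /part /=; repeat split; disjoint_entry
  | by []
  | rewrite /part /entry /=; repeat split; table_entry ].

(** Singletons count as cliques: their diagonal entries are true, as the test in [clique_merge]
    demands. *)
Definition six_o2f03_classes :=
  [:: [set v 0]; [set v 1]; [set v 2]; [set v 3]; [set v 4]; [set v 5]; O 2; F 0; F 3].
Definition six_o2f03_table :=
  [:: [:: true; true; false; false; false; true; false; false; true];
      [:: true; true; true; false; false; false; false; false; true];
      [:: false; true; true; true; false; false; true; true; true];
      [:: false; false; true; true; true; false; false; true; false];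
      [:: false; false; false; true; true; true; false; true; false];
      [:: true; false; false; false; true; true; true; true; true];
      [:: false; false; true; false; false; true; true; true; true];
      [:: false; false; true; true; true; true; true; true; true];
      [:: true; true; true; false; false; true; true; true; true]].

Lemma six_o2f03_blowup :
  (forall x, [|| x == v 0, x == v 1, x == v 2, x == v 3, x == v 4, x == v 5,
    x \in O 2, x \in F 0 | x \in F 3]) ->
  blowup six_o2f03_classes six_o2f03_table.
Proof. move=> H; blowup_tac H. Qed.

Definition six_f024_classes :=
  [:: [set v 0]; [set v 1]; [set v 2]; [set v 3]; [set v 4]; [set v 5]; F 0; F 2; F 4].
Definition six_f024_table :=
  [:: [:: true; true; false; false; false; true; false; true; true];
      [:: true; true; true; false; false; false; false; true; true];
      [:: false; true; true; true; false; false; true; false; true];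
      [:: false; false; true; true; true; false; true; false; true];
      [:: false; false; false; true; true; true; true; true; false];
      [:: true; false; false; false; true; true; true; true; false];
      [:: false; false; true; true; true; true; true; false; false];
      [:: true; true; false; false; true; true; false; true; false];
      [:: true; true; true; true; false; false; false; false; true]].

Lemma six_f024_blowup :
  (forall x, [|| x == v 0, x == v 1, x == v 2, x == v 3, x == v 4, x == v 5,
    x \in F 0, x \in F 2 | x \in F 4]) ->
  blowup six_f024_classes six_f024_table.
Proof. move=> H; blowup_tac H. Qed.

Definition six_f012_classes :=
  [:: [set v 0]; [set v 1]; [set v 2]; [set v 3]; [set v 4]; [set v 5]; F 0; F 1; F 2].
Definition six_f012_table :=
  [:: [:: true; true; false; false; false; true; false; true; true];
      [:: true; true; true; false; false; false; false; false; true];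
      [:: false; true; true; true; false; false; true; false; false];
      [:: false; false; true; true; true; false; true; true; false];
      [:: false; false; false; true; true; true; true; true; true];
      [:: true; false; false; false; true; true; true; true; true];
      [:: false; false; true; true; true; true; true; true; false];
      [:: true; false; false; true; true; true; true; true; true];
      [:: true; true; false; false; true; true; false; true; true]].

Lemma six_f012_blowup :
  (forall x, [|| x == v 0, x == v 1, x == v 2, x == v 3, x == v 4, x == v 5,
    x \in F 0, x \in F 1 | x \in F 2]) ->
  blowup six_f012_classes six_f012_table.
Proof. move=> H; blowup_tac H. Qed.

Definition six_f01_classes :=
  [:: [set v 0]; [set v 1]; [set v 2]; [set v 3]; [set v 4]; [set v 5]; F 0; F 1].
Definition six_f01_table :=
  [:: [:: true; true; false; false; false; true; false; true];
      [:: true; true; true; false; false; false; false; false];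
      [:: false; true; true; true; false; false; true; false];
      [:: false; false; true; true; true; false; true; true];
      [:: false; false; false; true; true; true; true; true];
      [:: true; false; false; false; true; true; true; true];
      [:: false; false; true; true; true; true; true; true];
      [:: true; false; false; true; true; true; true; true]].

Lemma six_f01_blowup :
  (forall x, [|| x == v 0, x == v 1, x == v 2, x == v 3, x == v 4, x == v 5,
    x \in F 0 | x \in F 1]) ->
  blowup six_f01_classes six_f01_table.
Proof. move=> H; blowup_tac H. Qed.

Definition six_o0_classes :=
  [:: [set v 0]; [set v 1]; [set v 2]; [set v 3]; [set v 4]; [set v 5]; O 0].
Definition six_o0_table :=
  [:: [:: true; true; false; false; false; true; true];
      [:: true; true; true; false; false; false; false];
      [:: false; true; true; true; false; false; false];
      [:: false; false; true; true; true; false; true];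
      [:: false; false; false; true; true; true; false];
      [:: true; false; false; false; true; true; false];
      [:: true; false; false; true; false; false; true]].

Lemma six_o0_blowup :
  (forall x, [|| x == v 0, x == v 1, x == v 2, x == v 3, x == v 4, x == v 5
    | x \in O 0]) ->
  blowup six_o0_classes six_o0_table.
Proof. move=> H; blowup_tac H. Qed.

Definition six_o012z_classes :=
  [:: [set v 0]; [set v 1]; [set v 2]; [set v 3]; [set v 4]; [set v 5]; O 0; O 1; O 2; Z].
Definition six_o012z_table :=
  [:: [:: true; true; false; false; false; true; true; false; false; false];
      [:: true; true; true; false; false; false; false; true; false; false];
      [:: false; true; true; true; false; false; false; false; true; false];
      [:: false; false; true; true; true; false; true; false; false; false];
      [:: false; false; false; true; true; true; false; true; false; false];
      [:: true; false; false; false; true; true; false; false; true; false];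
      [:: true; false; false; true; false; false; true; false; false; true];
      [:: false; true; false; false; true; false; false; true; false; true];
      [:: false; false; true; false; false; true; false; false; true; true];
      [:: false; false; false; false; false; false; true; true; true; true]].

Lemma six_o012z_blowup :
  (forall x, [|| x == v 0, x == v 1, x == v 2, x == v 3, x == v 4, x == v 5,
    x \in O 0, x \in O 1, x \in O 2 | x \in Z]) ->
  (forall z y j, z \in Z -> y \in O j -> adj z y) ->
  (forall z z', z \in Z -> z' \in Z -> z = z') ->
  blowup six_o012z_classes six_o012z_table.
Proof. move=> H nZ Z1; blowup_tac H. Qed.

(** * Size inequalities for the blow-ups with a C6 *)

Variable d : nat.
Hypothesis deg : degen d G.

Ltac blowup_simpl :=
  rewrite /total /weight /self /part /entry /= ?cards1 /=.

Ltac low B S :=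
  let L := fresh "L" in
  have L := blowup_low deg B (S := S) isT; move: L;
  blowup_simpl; rewrite ?addn0 => L.

Ltac bound B S :=
  let L := fresh "L" in
  have L := blowup_clique deg B (S := S) isT isT; move: L; blowup_simpl => L.

Ltac conclude B K I L1 L2 :=
  apply: (blowup_gathers deg B (K := K) (I := I) (L1 := L1) (L2 := L2)) => //;
  blowup_simpl; repeat split; lia.

Lemma six_o2f03_gathers : (forall x, [|| x == v 0, x == v 1, x == v 2, x == v 3, x == v 4, x == v 5,
    x \in O 2, x \in F 0 | x \in F 3]) ->
  0 < #|F 0| -> 0 < #|O 2| + #|F 3| -> gathers d G #|G|.-1.
Proof.
move=> /six_o2f03_blowup B f0 of3.
(* The first union bounds the degree [#|F 0| + 2] of [v 3] and [v 4], the second the degree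
   [#|F 3| + 2] of [v 0] and [v 1]. Once these four are set aside, the clique bound takes care of
   [v 2] and [v 5]. *)
low B [:: 2; 3; 4; 5; 6; 7; 8]. low B [:: 5; 0; 1; 2; 6; 7; 8]. bound B [:: 2; 6; 7; 8].
conclude B [:: 6; 7; 8] (@nil nat) [:: 0; 1; 3; 4] [:: 2; 5].
Qed.

Lemma six_f024_gathers : (forall x, [|| x == v 0, x == v 1, x == v 2, x == v 3, x == v 4, x == v 5,
    x \in F 0, x \in F 2 | x \in F 4]) ->
  #|F 0| = 1 -> #|F 2| = 1 -> #|F 4| = 1 -> gathers d G #|G|.-1.
Proof.
move=> /six_f024_blowup B f0 f2 f4.
(* All parts are single vertices and the graph is 4-regular, so 4 <= d. *)
low B [:: 0; 1; 2; 3; 4; 5; 6; 7; 8].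
conclude B [:: 0] (@nil nat) [:: 1; 2; 3; 4; 5; 6; 7; 8] (@nil nat).
Qed.

Lemma six_f012_gathers : (forall x, [|| x == v 0, x == v 1, x == v 2, x == v 3, x == v 4, x == v 5,
    x \in F 0, x \in F 1 | x \in F 2]) ->
  0 < #|F 0| <= #|F 2| -> gathers d G #|G|.-1.
Proof.
move=> /six_f012_blowup B f02.
low B [:: 0; 1; 2; 3; 4; 5; 6; 7; 8]. bound B [:: 4; 5; 7; 8].
(* The degrees of [v 1] and [v 2] are [#|F 2| + 2] and [#|F 0| + 2]. The condition bounds both by d;
   if [F 1] is nonempty, this is due to the clique bound. *)
have [low12|] := boolP ((0 < #|F 1|) || (#|F 2| + 2 <= d)).
  conclude B [:: 4; 5; 7; 8] [:: 6] [:: 1; 2] [:: 0; 3].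
rewrite negb_or => no.
(* Here [F 1] is empty and d is [#|F 2| + 1]. The low vertex must lie in [F 0] or be [v 2] or [v 3],
   which gives [#|F 0| + 2 <= d]. *)
conclude B [:: 4; 5; 8] [:: 0] [:: 2; 3] [:: 1; 6; 7].
Qed.

Lemma six_f01_gathers : (forall x, [|| x == v 0, x == v 1, x == v 2, x == v 3, x == v 4, x == v 5,
    x \in F 0 | x \in F 1]) ->
  0 < #|F 0| -> gathers d G #|G|.-1.
Proof.
move=> /six_f01_blowup B f0; bound B [:: 3; 4; 6; 7].
conclude B [:: 6; 7; 3; 4] (@nil nat) [:: 0; 1] [:: 2; 5].
Qed.

Lemma six_o0_gathers : (forall x, [|| x == v 0, x == v 1, x == v 2, x == v 3, x == v 4, x == v 5 |
    x \in O 0]) -> gathers d G #|G|.-1.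
Proof.
move=> /six_o0_blowup B; low B [:: 0; 1; 2; 3; 4; 5]. bound B [:: 0; 6].
conclude B [:: 6; 0] (@nil nat) [:: 1; 2; 4; 5] [:: 3].
Qed.

Lemma six_o012z_gathers : (forall x, [|| x == v 0, x == v 1, x == v 2, x == v 3, x == v 4, x == v 5,
    x \in O 0, x \in O 1, x \in O 2 | x \in Z]) ->
  (forall z y j, z \in Z -> y \in O j -> adj z y) ->
  (forall z z', z \in Z -> z' \in Z -> z = z') ->
  #|O 0| = 1 -> #|O 1| = 1 -> #|O 2| <= 1 -> #|Z| <= 1 -> gathers d G #|G|.-1.
Proof.
move=> H nZ Z1 o0 o1 o2 z1; have B := six_o012z_blowup H nZ Z1.
(* The cycle alone gives 2 <= d. *)
low B [:: 0; 1; 2; 3; 4; 5].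
have [z0|zn] := eqVneq #|Z| 0.
  conclude B [:: 0] (@nil nat) [:: 6; 7; 8] [:: 1; 2; 3; 4; 5; 9].
have [o20|o2n] := eqVneq #|O 2| 0.
  conclude B [:: 0] (@nil nat) [:: 2; 5; 9] [:: 1; 3; 4; 6; 7; 8].
(* All ten parts are single vertices now: this is the Petersen graph, which is 3-regular, so 3 <=
   d. *)
low B [:: 0; 1; 2; 3; 4; 5; 6; 7; 8; 9].
conclude B [:: 0] (@nil nat) [:: 1; 2; 3; 4; 5; 6; 7; 8; 9] (@nil nat).
Qed.

(** * Types around a C6 without dominated or universal vertices *)

Hypothesis undom : undominated G.
Hypothesis nonuniv : forall w : G, exists2 x, x != w & ~~ adj w x.

Lemma six_oppM i : O (i %% 3) = O i.
Proof.
rewrite [in RHS](divn_eq i 3); elim: (i %/ 3) => [//|q ->].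
by rewrite mulSn -addnA !addSn six_oppS3.
Qed.

Lemma none_nbr z y : z \in Z -> adj z y -> y \in U \/ exists2 j, j < 3 & y \in O j.
Proof.
move=> zZ zy; have zZ' := zZ; unpN 0 zZ'.
case/or4P: (six_types 0 y) => [yU|yZ|yv|yOF]; first by left.
- by move: zy; rewrite (negbTE (none_none zZ yZ)).
- exfalso; move: zy; do ?[case/orP: yv => [/eqP->|yv]]; try exact/negP.
  by rewrite (eqP yv); apply/negP.
- case/orP: yOF => [/or3P[] yO|yF]; first by right; exists 0.
  + by right; exists 1.
  + by right; exists 2.
  + exfalso; move: zy; do ?[case/orP: yF => [/(none_four zZ)/negP//|yF]].
    by move: yF => /(none_four zZ)/negP.
Qed.

Lemma none_away z j : z \in Z -> exists l y, [/\ l < 3, y \in O l, adj z y & ~~ adj (v j) y].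
Proof.
move=> zZ; have zZ' := zZ; unpN j zZ'; cyc j.
have zv : z != v j by neq_tac.
have [|y zy vy] := undom zv; first by [].
case: (none_nbr zZ zy) => [yU|[l l3 yO]]; last by exists l, y.
by unpA j yU; case/negP: vy; rewrite adj_sym.
Qed.

(** Every vertex of [O j] sees [v j], so a neighbour of [z] that misses [v j] lies in another set
    [O l]. Comparing [z] with two vertices of the cycle yields two different sets, which are
    consecutive because [O 3] is [O 0]. *)
Lemma none_pair z : z \in Z -> exists i y1 y2,
  [/\ i < 3, y1 \in O i, y2 \in O i.+1, adj z y1 & adj z y2].
Proof.
move=> zZ.
have nO j y : y \in O j -> ~~ adj (v j) y -> False.
  by move=> yO vy; unp yO; contra_adj.
have [l [y [l3 yO zy vy]]] := none_away 0 zZ.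
case: l l3 yO => [|[|[|//]]] _ yO; first by case: (nO 0 y).
- have [l [y' [l3 y'O zy' vy']]] := none_away 1 zZ.
  case: l l3 y'O => [|[|[|//]]] _ y'O; [by exists 0, y', y|by case: (nO 1 y')|by exists 1, y, y'].
- have [l [y' [l3 y'O zy' vy']]] := none_away 2 zZ.
  case: l l3 y'O => [|[|[|//]]] _ y'O; last by case: (nO 2 y').
    by exists 2, y, y'; rewrite six_oppS3.
  by exists 1, y', y.
Qed.

(** A vertex of [U] sees all vertices of every type and would be universal. *)
Lemma six_all0 u : u \notin U.
Proof.
apply/negP => uU; have [x xu ux] := nonuniv u; have uU' := uU; unpA 0 uU'.
case/negP: ux; case/or4P: (six_types 0 x) => [xU|xZ|xv|xOF].
- by apply: all_all; rewrite // eq_sym.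
- have [i [y1 [y2 [_ y1O y2O xy1 xy2]]]] := none_pair xZ.
  have uy1 := all_opp uU y1O; have uy2 := all_opp uU y2O; have ny := opp1 y1O y2O.
  by apply/negPn/negP => ux; unp y1O; unp y2O; c4 u y1 x y2.
- by do ?[case/orP: xv => [/eqP->//|xv]]; rewrite (eqP xv).
- case/orP: xOF => [/or3P[] xO|xF]; try exact: all_opp xO.
  do ?[case/orP: xF => [xF|xF]; first exact: all_four xF].
  exact: all_four xF.
Qed.

Lemma opp_none i w y1 y2 z : w \in O i.+2 -> y1 \in O i -> y2 \in O i.+1 -> z \in Z ->
  adj z y1 -> adj z y2 -> adj z w.
Proof.
move=> wO y1O y2O zZ zy1 zy2; apply/negPn/negP => zw.
have y12 := opp1 y1O y2O; have y1w := opp2 y1O wO; have y2w := opp1 y2O wO.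
by unp wO; unp y1O; unp y2O; unpN i zZ; p23 w (v i.+2) y1 z y2.
Qed.

Lemma six_typesE x : [|| x \in Z,
  [|| x == v 0, x == v 1, x == v 2, x == v 3, x == v 4 | x == v 5],
  [|| x \in O 0, x \in O 1 | x \in O 2] |
  [|| x \in F 0, x \in F 1, x \in F 2, x \in F 3, x \in F 4 | x \in F 5]].
Proof. by have := six_types 0 x; rewrite (negbTE (six_all0 x)). Qed.

Lemma opp_no_four01 j : O 0 != set0 -> O 1 != set0 -> j < 6 -> F j = set0.
Proof.
move=> /set0Pn[a aO] /set0Pn[b bO] j6; apply/setP => x; rewrite in_set0; apply/negP => xF.
have a3 : a \in O 3 by rewrite six_oppS3.
have b4 : b \in O 4 by rewrite six_oppS3.
case: j j6 xF => [|[|[|[|[|[|//]]]]]] _ xF.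
- exact: opp_four0 aO xF.
- exact: opp_four0 bO xF.
- by apply: (opp_four5 a3 (y := x)); rewrite six_fourS6.
- exact: opp_four0 a3 xF.
- exact: opp_four0 b4 xF.
- exact: opp_four5 aO xF.
Qed.

(** Two nonempty sets [O] exclude every [F] and leave at most one vertex in each other part, so G is
    an induced subgraph of the Petersen graph. *)
Lemma gathers_two_opp : O 0 != set0 -> O 1 != set0 -> gathers d G #|G|.-1.
Proof.
move=> o0 o1; have noF j := opp_no_four01 o0 o1 (j := j).
have [/set0Pn[a aO] /set0Pn[b bO]] := (o0, o1).
have a3 : a \in O 3 by rewrite six_oppS3.
have uniqO j x y : j < 3 -> x \in O j -> y \in O j -> x = y.
  case: j => [|[|[|//]]] _ xO yO.
  - exact: opp_single1 xO yO bO.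
  - exact: opp_single2 xO yO a3.
  - exact: opp_single1 xO yO a3.
have nZ z y j : z \in Z -> y \in O j -> adj z y.
  move=> zZ; rewrite -six_oppM; have := ltn_mod j 3; move: (j %% 3) => {}j /= j3 yO.
  have [i [y1 [y2 [i3 y1O y2O zy1 zy2]]]] := none_pair zZ.
  have := @opp_none i y y1 y2 z; case: i i3 y1O y2O => [|[|[|//]]] _ y1O y2O.
  - case: j j3 yO => [|[|[|//]]] j3 yO; [by rewrite (uniqO 0 y y1)|by rewrite (uniqO 1 y y2)|].
    by move=> c; apply: c.
  - case: j j3 yO => [|[|[|//]]] j3 yO; [|by rewrite (uniqO 1 y y1)|by rewrite (uniqO 2 y y2)].
    by move=> c; apply: c; rewrite // six_oppS3.
  - rewrite six_oppS3 in y2O.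
    case: j j3 yO => [|[|[|//]]] j3 yO; [by rewrite (uniqO 0 y y2)| |by rewrite (uniqO 2 y y1)].
    by move=> c; apply: c; rewrite // six_oppS3.
have Z1 z z' : z \in Z -> z' \in Z -> z = z'.
  move=> zZ z'Z; apply/eqP/negPn/negP => ne; have nadj := none_none zZ z'Z.
  have za := nZ z a 0 zZ aO; have z'a := nZ z' a 0 z'Z aO.
  by unpN 0 zZ; unpN 0 z'Z; unp aO; cyc 0; p23 (v 1) (v 2) z a z'.
have le1 (A : {set G}) : {in A &, forall x y, x = y} -> #|A| <= 1.
  by move=> eqA; apply/card_le1_eqP => x y xA yA; apply: eqA.
apply: (six_o012z_gathers _ nZ Z1).
- move=> x; have := six_typesE x; rewrite !noF // !in_set0 !orbF.
  case/or3P=> [->|xv|]; first by rewrite !orbT.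
    by do ?[case/orP: xv => [->|xv]]; rewrite ?xv ?orbT.
  by case/or3P=> ->; rewrite !orbT.
- apply/eqP; rewrite eqn_leq le1 => [|x y xO yO]; last exact: (uniqO 0).
  by apply/card_gt0P; exists a.
- apply/eqP; rewrite eqn_leq le1 => [|x y xO yO]; last exact: (uniqO 1).
  by apply/card_gt0P; exists b.
- by apply: le1 => x y; apply: (uniqO 2).
- by apply: le1 => x y; apply: Z1.
Qed.

Ltac cover_tac x :=
  have := six_typesE x;
  repeat match goal with E : _ = set0 |- _ => rewrite E; clear E end;
  rewrite ?in_set0 /= ?orbF;
  let H := fresh "H" in move=> H;
  repeat (case/orP: H => H); rewrite ?H ?orbT //.

Lemma gathers_one_opp : Z = set0 -> O 1 = set0 -> O 2 = set0 ->
  (forall j, j < 6 -> F j = set0) -> gathers d G #|G|.-1.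
Proof.
move=> z0 o1 o2 noF; apply: six_o0_gathers => x.
have [f0 f1 f2] := And3 (noF 0 isT) (noF 1 isT) (noF 2 isT).
have [f3 f4 f5] := And3 (noF 3 isT) (noF 4 isT) (noF 5 isT).
by cover_tac x.
Qed.

Lemma four_no_opp i : F i != set0 -> O i = set0 /\ O i.+1 = set0.
Proof.
move=> /set0Pn[f fF]; split; apply/setP => x; rewrite in_set0; apply/negP => xO.
  exact: opp_four0 xO fF.
by apply: (opp_four5 xO (y := f)); rewrite six_fourS6.
Qed.

Ltac empty H := apply/setP; let x := fresh "x" in move=> x; rewrite in_set0; apply/negP => H.

Lemma gathers_four_o2f03 : Z = set0 -> F 0 != set0 -> (O 2 != set0) || (F 3 != set0) ->
  gathers d G #|G|.-1.
Proof.
move=> z0 f0 of3; have [o0 o1] := four_no_opp f0; have /set0Pn[f fF] := f0.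
have [f1 f2 f4 f5] : [/\ F 1 = set0, F 2 = set0, F 4 = set0 & F 5 = set0].
  case/orP: of3 => /set0Pn[y yO].
    have y5 : y \in O 5 by rewrite six_oppS3.
    split; empty xF.
    - by apply: (opp_four5 yO (y := x)); rewrite six_fourS6.
    - exact: opp_four0 yO xF.
    - by apply: (opp_four5 y5 (y := x)); rewrite six_fourS6.
    - exact: opp_four0 y5 xF.
  have f6 : f \in F 6 by rewrite six_fourS6.
  split; empty xF.
  - exact: four_no25 xF yO f6.
  - exact: four_no23 fF xF yO.
  - by apply: (four_no25 xF f6 (z := y)); rewrite six_fourS6.
  - exact: four_no23 yO xF f6.
apply: six_o2f03_gathers; last 2 first.
- by rewrite card_gt0.
- by move: of3; rewrite -!card_gt0; lia.
by move=> x; cover_tac x.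
Qed.

Lemma gathers_four_f024 : Z = set0 -> F 0 != set0 -> F 2 != set0 -> F 4 != set0 ->
  gathers d G #|G|.-1.
Proof.
move=> z0 f0 f2 f4; have [o0 o1] := four_no_opp f0; have [o2 _] := four_no_opp f2.
have [/set0Pn[x0 F0] /set0Pn[x2 F2] /set0Pn[x4 F4]] := And3 f0 f2 f4.
have F6 : x0 \in F 6 by rewrite six_fourS6.
have F8 : x2 \in F 8 by rewrite six_fourS6.
have f1 : F 1 = set0 by empty xF; apply: (four_no25 F2 F4 (z := x)); rewrite six_fourS6.
have f3 : F 3 = set0 by empty xF; apply: four_no23 F0 F2 xF.
have f5 : F 5 = set0 by empty xF; apply: four_no23 F2 F4 xF.
have one i x : x \in F i -> (forall y, y \in F i -> y = x) -> #|F i| = 1.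
  move=> xF eqx; apply/eqP/cards1P; exists x; apply/setP => y; rewrite in_set1.
  by apply/idP/eqP => [/eqx|->].
apply: six_f024_gathers; last 3 first.
- by apply: (one 0 x0) => // y yF; apply: four_single yF F0 F2 F4.
- by apply: (one 2 x2) => // y yF; apply: four_single yF F2 F4 F6.
- by apply: (one 4 x4) => // y yF; apply: four_single yF F4 F6 F8.
by move=> x; cover_tac x.
Qed.

Lemma gathers_four_f02 : Z = set0 -> F 0 != set0 -> F 2 != set0 -> F 4 = set0 ->
  #|F 0| <= #|F 2| -> gathers d G #|G|.-1.
Proof.
move=> z0 f0 f2 f4 le; have [o0 o1] := four_no_opp f0; have [o2 _] := four_no_opp f2.
have [/set0Pn[x0 F0] /set0Pn[x2 F2]] := (f0, f2).
have f3 : F 3 = set0 by empty xF; apply: four_no23 F0 F2 xF.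
have f5 : F 5 = set0 by empty xF; apply: four_no25 F0 F2 xF.
apply: six_f012_gathers; last by rewrite le card_gt0 f0.
by move=> x; cover_tac x.
Qed.

Lemma gathers_four_f0 : Z = set0 -> F 0 != set0 -> O 2 = set0 -> F 2 = set0 -> F 3 = set0 ->
  F 4 = set0 -> F 5 = set0 -> gathers d G #|G|.-1.
Proof.
move=> z0 f0 o2 f2 f3 f4 f5; have [o0 o1] := four_no_opp f0.
apply: six_f01_gathers; last by rewrite card_gt0.
by move=> x; cover_tac x.
Qed.

End SixCycle.

Section SixCycleMain.
Variables (d : nat) (G : sgraph).
Hypothesis deg : degen d G.
Hypothesis C4G : C4_free G.
Hypothesis P23 : P2P3_free G.
Hypothesis undom : undominated G.
Hypothesis nonuniv : forall w : G, exists2 x, x != w & ~~ adj w x.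

Definition six_cycle (v : nat -> G) := (forall i, v i.+4.+2 = v i) /\
  forall i, [&& adj (v i) (v i.+1), ~~ adj (v i) (v i.+2) & ~~ adj (v i) (v i.+3)].

Lemma six_cycle_shift v i : six_cycle v -> six_cycle (shift v i).
Proof. by case=> per cyc; split=> j; [apply: per|apply: cyc]. Qed.

Lemma six_none_shift v i : six_cycle v -> six_none (shift v i) = six_none v.
Proof.
move=> cv; have [per cyc] := cv; have [per' cyc'] := six_cycle_shift i cv.
by apply/setP => x; rewrite (six_noneE per i) (six_noneE per' 0).
Qed.

(** Modulo 6 this is the reflection taking j to 3 - j. It exchanges [six_four v 0] and
    [six_four v 2] and fixes [six_four v 4]. *)
Definition reverse (T : Type) (v : nat -> T) := fun j => v (5 * j + 3).

Lemma six_cycle_reverse v : six_cycle v -> six_cycle (reverse v).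
Proof.
move=> [per cyc]; have vE := vmod per.
split=> i; first by rewrite /reverse vE [RHS]vE; congr v; lia.
rewrite /reverse; have /and3P[c _ _] := cyc (5 * i + 2); have /and3P[_ n _] := cyc (5 * i + 1).
have /and3P[_ _ n'] := cyc (5 * i).
have E1 : v (5 * i.+1 + 3) = v (5 * i + 2) by rewrite vE [RHS]vE; congr v; lia.
have E2 : v (5 * i.+2 + 3) = v (5 * i + 1) by rewrite vE [RHS]vE; congr v; lia.
have E3 : v (5 * i.+3 + 3) = v (5 * i) by rewrite vE [RHS]vE; congr v; lia.
have F3 : v (5 * i + 3) = v (5 * i).+3 by congr v; lia.
have F2 : v (5 * i + 2).+1 = v (5 * i).+3 by congr v; lia.
have F1 : v (5 * i + 1).+2 = v (5 * i).+3 by congr v; lia.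
rewrite E1 E2 E3 F3; rewrite F2 in c; rewrite F1 in n.
by rewrite ![adj (v (5 * i).+3) _]adj_sym c n n'.
Qed.

Lemma six_cycle_gathers v : six_cycle v -> gathers d G #|G|.-1.
Proof.
move=> cv; have [per cyc] := cv.
have emp (A B : {set G}) : ~~ ((A != set0) && (B != set0)) -> A != set0 -> B = set0.
  by move=> no A0; apply/eqP; move: no; rewrite A0 negbK.
case: (boolP [exists i : 'I_6, (six_opp v i != set0) && (six_opp v i.+1 != set0)]).
  case/existsP => i /andP[o0 o1]; have [per' cyc'] := six_cycle_shift i cv.
  exact: (gathers_two_opp C4G P23 per' cyc' deg undom nonuniv o0 o1).
move=> /existsPn noA.
have noO i : six_opp v i != set0 -> six_opp v i.+1 = set0.
  rewrite -(six_oppM per i) -(six_oppM per i.+1) -[in i.+1]add1n -modnDmr.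
  rewrite add1n (six_oppM per (_ %% 3).+1) => oi.
  have lt : i %% 3 < 6 by apply: leq_trans (ltn_pmod _ _) _.
  exact: emp (noA (Ordinal lt)) oi.
(* By [none_pair], a vertex without neighbours on the cycle would need two consecutive nonempty sets
   [six_opp]. *)
have z0 : six_none v = set0.
  apply/setP => z; rewrite in_set0; apply/negP => zZ.
  have [i [y1 [y2 [i3 y1O y2O _ _]]]] := none_pair C4G P23 per cyc undom zZ.
  have o1 : six_opp v i != set0 by apply/set0Pn; exists y1.
  by have := in_set0 y2; rewrite -(noO i o1) y2O.
have zs i : six_none (shift v i) = set0 by rewrite six_none_shift.
have fmod i : six_four v (i %% 6) = six_four v i.
  rewrite [in RHS](divn_eq i 6); elim: (i %/ 6) => [//|q ->].
  by rewrite mulSn -addnA !addSn (six_fourS6 per).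
case: (boolP [forall i : 'I_6, six_four v i == set0]) => [/forallP noF|].
  have {}noF i : six_four v i = set0.
    by rewrite -fmod; apply/eqP; exact: (noF (Ordinal (ltn_pmod i (isT : 0 < 6)))).
  have base i : six_opp v i.+1 = set0 -> six_opp v i.+2 = set0 -> gathers d G #|G|.-1.
    move=> o1 o2; have [per' cyc'] := six_cycle_shift i cv.
    apply: (gathers_one_opp C4G P23 per' cyc' deg undom nonuniv (zs i) o1 o2) => j _.
    exact: noF.
  have around i : six_opp v i != set0 -> gathers d G #|G|.-1.
    move=> oi; apply: (base i (noO i oi)); apply/eqP/negPn/negP => o2.
    by have := noO _ o2; rewrite (six_oppS3 per) => E; rewrite E eqxx in oi.
  have [o1|/around//] := eqVneq (six_opp v 1) set0.
  have [o2|/around//] := eqVneq (six_opp v 2) set0.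
  exact: base 0 o1 o2.
move=> /forallPn[i0 /= f0].
case: (boolP [exists i : 'I_6, (six_four v i != set0) &&
    ((six_opp v i.+2 != set0) || (six_four v i.+3 != set0))]).
  case/existsP => i /andP[fi ofi]; have [per' cyc'] := six_cycle_shift i cv.
  exact: (gathers_four_o2f03 C4G P23 per' cyc' deg undom nonuniv (zs i) fi ofi).
move=> /existsPn noC.
have {}noC i : six_four v i != set0 -> six_opp v i.+2 = set0 /\ six_four v i.+3 = set0.
  have := noC (Ordinal (ltn_pmod i (isT : 0 < 6))) => /=.
  have -> : six_opp v (i %% 6).+2 = six_opp v i.+2.
    by rewrite -(six_oppM per i.+2) -(six_oppM per (_ %% _).+2); congr six_opp; lia.
  have -> : six_four v (i %% 6).+3 = six_four v i.+3.
    by rewrite -(fmod i.+3) -(fmod (_ %% _).+3); congr six_four; lia.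
  by rewrite fmod => + fi; rewrite fi /= negb_or !negbK => /andP[/eqP-> /eqP->].
case: (boolP [exists i : 'I_6, (six_four v i != set0) && (six_four v i.+2 != set0)]).
  case/existsP => i /andP[fi f2]; have cs := six_cycle_shift i cv; have [per' cyc'] := cs.
  have [f4|f4] := eqVneq (six_four v i.+4) set0; last first.
    exact: (gathers_four_f024 C4G P23 per' cyc' deg undom nonuniv (zs i) fi f2 f4).
  have [le|/ltnW le] := leqP #|six_four v i| #|six_four v i.+2|.
    exact: (gathers_four_f02 C4G P23 per' cyc' deg undom nonuniv (zs i) fi f2 f4 le).
  (* The smaller of the two sets has to come first, so the cycle is reflected. *)
  have cr := six_cycle_reverse cs; have [per2 cyc2] := cr.
  pose w := reverse (shift v i).
  have E0 : six_four w 0 = six_four v i.+2.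
    apply/setP => x; rewrite !inE /w /reverse /shift /= !per.
    by case: (adj x (v i)); case: (adj x (v i.+1)); case: (adj x (v i.+2)); case: (adj x (v i.+3));
      case: (adj x (v i.+4)); case: (adj x (v i.+4.+1)).
  have E2 : six_four w 2 = six_four v i.
    apply/setP => x; rewrite !inE /w /reverse /shift /= !per.
    by case: (adj x (v i)); case: (adj x (v i.+1)); case: (adj x (v i.+2)); case: (adj x (v i.+3));
      case: (adj x (v i.+4)); case: (adj x (v i.+4.+1)).
  have E4 : six_four w 4 = six_four v i.+4.
    apply/setP => x; rewrite !inE /w /reverse /shift /= !per.
    by case: (adj x (v i)); case: (adj x (v i.+1)); case: (adj x (v i.+2)); case: (adj x (v i.+3));
      case: (adj x (v i.+4)); case: (adj x (v i.+4.+1)).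
  have zw : six_none w = set0.
    apply/setP => x; rewrite (six_noneE per2 0) -(zs i) (six_noneE per' 0) /w /reverse /shift /= !per.
    by case: (adj x (v i)); case: (adj x (v i.+1)); case: (adj x (v i.+2)); case: (adj x (v i.+3));
      case: (adj x (v i.+4)); case: (adj x (v i.+4.+1)).
  by apply: (gathers_four_f02 C4G P23 per2 cyc2 deg undom nonuniv zw); rewrite ?E0 ?E2 ?E4.
move=> /existsPn noE.
have {}noE i : six_four v i != set0 -> six_four v i.+2 = set0.
  have := noE (Ordinal (ltn_pmod i (isT : 0 < 6))) => /=.
  have -> : six_four v (i %% 6).+2 = six_four v i.+2.
    by rewrite -(fmod i.+2) -(fmod (_ %% _).+2); congr six_four; lia.
  by rewrite fmod => /emp.
(* At most two of the sets [six_four] are nonempty now, and two of them are consecutive; the cycle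
   is shifted so as to start at the first one. *)
have base i : six_four v i != set0 -> six_four v i.+4.+1 = set0 -> gathers d G #|G|.-1.
  move=> fi f5; have [per' cyc'] := six_cycle_shift i cv; have [o2 f3] := noC i fi.
  apply: (gathers_four_f0 C4G P23 per' cyc' deg undom nonuniv (zs i) fi o2 (noE i fi) f3 _ f5).
  apply/eqP/negPn/negP => f4; have := noE i.+4 f4; rewrite (six_fourS6 per) => E.
  by rewrite E eqxx in fi.
have [f5|f5] := eqVneq (six_four v i0.+4.+1) set0; first exact: base i0 f0 f5.
apply: (base i0.+4.+1 f5); apply/eqP/negPn/negP => f4.
have f4' : six_four v i0.+4 != set0 by move: f4; rewrite -(six_fourS6 per i0.+4).
by have := noE _ f4'; rewrite (six_fourS6 per) => E; rewrite E eqxx in f0.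
Qed.

End SixCycleMain.

(** * Graphs with an induced C5 *)

Section FiveCycle.
Variables (G : sgraph) (v : nat -> G).
Hypothesis C4G : C4_free G.
Hypothesis P23 : P2P3_free G.
Hypothesis C6G : C6_free G.
Hypothesis per : forall i, v i.+4.+1 = v i.
Hypothesis cyc : forall i, adj (v i) (v i.+1) && ~~ adj (v i) (v i.+2).

Lemma cyc5 i : [&& adj (v i) (v i.+1), adj (v i.+1) (v i.+2), adj (v i.+2) (v i.+3),
  adj (v i.+3) (v i.+4), adj (v i.+4) (v i), ~~ adj (v i) (v i.+2), ~~ adj (v i.+1) (v i.+3),
  ~~ adj (v i.+2) (v i.+4), ~~ adj (v i.+3) (v i) & ~~ adj (v i.+4) (v i.+1)].
Proof.
have /andP[c0 d0] := cyc i; have /andP[c1 d1] := cyc i.+1.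
have /andP[c2 d2] := cyc i.+2; have /andP[c3 d3] := cyc i.+3; have /andP[c4 d4] := cyc i.+4.
rewrite per in d3; rewrite per in c4; rewrite per in d4.
by rewrite c0 c1 c2 c3 c4 d0 d1 d2 d3 d4.
Qed.

Lemma vmod5 i : v i = v (i %% 5).
Proof.
rewrite {1}(divn_eq i 5); elim: (i %/ 5) => [//|q IH].
by rewrite mulSn -addnA !addSn per.
Qed.

(* [five_edge i] collects the vertices attached to the edge opposite to [v i], and
   [five_arc i] the possible replacements of [v i] in the cycle, [v i] included. *)
Definition five_all := [set x | [forall j : 'I_5, adj x (v j)]].
Definition five_none := [set x | [forall j : 'I_5, ~~ adj x (v j)]].
Definition five_one i := [set x | [&& adj x (v i), ~~ adj x (v i.+1), ~~ adj x (v i.+2),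
  ~~ adj x (v i.+3) & ~~ adj x (v i.+4)]].
Definition five_edge i := [set x | [&& ~~ adj x (v i), ~~ adj x (v i.+1), adj x (v i.+2),
  adj x (v i.+3) & ~~ adj x (v i.+4)]].
Definition five_arc i := [set x | [&& adj x (v i.+1), ~~ adj x (v i.+2),
  ~~ adj x (v i.+3) & adj x (v i.+4)]].
Local Notation U := five_all.
Local Notation Z := five_none.
Local Notation B := five_one.
Local Notation E := five_edge.
Local Notation A := five_arc.

Lemma all_five (P : pred G) i : [forall j : 'I_5, P (v j)] =
  [&& P (v i), P (v i.+1), P (v i.+2), P (v i.+3) & P (v i.+4)].
Proof.
apply/forallP/idP => [all|].
  by do ?[apply/andP; split]; rewrite vmod5; apply: (all (Ordinal (ltn_pmod _ (isT : 0 < 5)))).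
case/and5P=> p0 p1 p2 p3 p4 j.
have [r r5 ->] : exists2 r, r < 5 & v j = v (r + i).
  exists ((j + 4 * i) %% 5); first by rewrite ltn_mod.
  by rewrite [LHS]vmod5 [RHS]vmod5; congr v; lia.
by case: r r5 => [|[|[|[|[|//]]]]] _.
Qed.

Lemma five_allE i x : (x \in U) = [&& adj x (v i), adj x (v i.+1), adj x (v i.+2),
  adj x (v i.+3) & adj x (v i.+4)].
Proof. by rewrite inE (all_five (adj x) i). Qed.

Lemma five_noneE i x : (x \in Z) = [&& ~~ adj x (v i), ~~ adj x (v i.+1), ~~ adj x (v i.+2),
  ~~ adj x (v i.+3) & ~~ adj x (v i.+4)].
Proof. by rewrite inE (all_five (fun y => ~~ adj x y) i). Qed.

Ltac cyc i := let H := fresh in have H := cyc5 i; split_hyp H.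
Ltac unp H := rewrite inE ?per in H; split_hyp H.
Ltac unpA i H := rewrite (five_allE i) in H; split_hyp H.
Ltac unpN i H := rewrite (five_noneE i) in H; split_hyp H.

Lemma five_gap i x : x != v i.+1 -> adj x (v i) && adj x (v i.+2) ==> adj x (v i.+1).
Proof.
move=> ne; apply/implyP => /andP[x0 x2]; apply/negPn/negP => x1; cyc i.
by c4 x (v i) (v i.+1) (v i.+2).
Qed.

Lemma arc_v i : v i \in A i.
Proof. by cyc i; rewrite inE; do ?[apply/andP; split]; adj_tac. Qed.

(** As C4 is excluded, the neighbours of an outside vertex on the cycle are consecutive, and four of
    them force the fifth. The vertices of the cycle itself lie in the arcs. *)
Lemma five_types i x : [|| x \in U, x \in Z,
  [|| x \in A i, x \in A i.+1, x \in A i.+2, x \in A i.+3 | x \in A i.+4],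
  [|| x \in B i, x \in B i.+1, x \in B i.+2, x \in B i.+3 | x \in B i.+4] |
  [|| x \in E i, x \in E i.+1, x \in E i.+2, x \in E i.+3 | x \in E i.+4]].
Proof.
case: (boolP [|| x == v i, x == v i.+1, x == v i.+2, x == v i.+3 | x == v i.+4]) => [H|].
  by do ?[case/orP: H => [/eqP->|H]; first by rewrite arc_v ?orbT]; rewrite (eqP H) arc_v ?orbT.
rewrite !negb_or => H; split_hyp H; rewrite (five_allE i) (five_noneE i) !inE !per /=.
have := @five_gap i x ltac:(rewrite ?per; assumption).
have := @five_gap i.+1 x ltac:(rewrite ?per; assumption).
have := @five_gap i.+2 x ltac:(rewrite ?per; assumption).
have := @five_gap i.+3 x ltac:(rewrite ?per; assumption).
have := @five_gap i.+4 x ltac:(rewrite ?per; assumption).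
rewrite !per.
by case: (adj x (v i)); case: (adj x (v i.+1)); case: (adj x (v i.+2)); case: (adj x (v i.+3));
  case: (adj x (v i.+4)).
Qed.

Lemma arcS5 i : A i.+4.+1 = A i.
Proof. by apply/setP => x; rewrite !inE !per. Qed.

Lemma edgeS5 i : E i.+4.+1 = E i.
Proof. by apply/setP => x; rewrite !inE !per. Qed.

Lemma oneS5 i : B i.+4.+1 = B i.
Proof. by apply/setP => x; rewrite !inE !per. Qed.

(** * Adjacency between the types of vertices around a C5 *)

Lemma arc0 i x y : x \in A i -> y \in A i -> x != y -> adj x y.
Proof.
by move=> xA yA xy; apply/negPn/negP => nxy; unp xA; unp yA; cyc i; c4 x (v i.+1) y (v i.+4).
Qed.

Lemma arc2 i x y : x \in A i -> y \in A i.+2 -> ~~ adj x y.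
Proof. by move=> xA yA; apply/negP => xy; unp xA; unp yA; cyc i; c4 x (v i.+4) (v i.+3) y. Qed.

Lemma arc3 i x y : x \in A i -> y \in A i.+3 -> ~~ adj x y.
Proof. by move=> xA yA; rewrite adj_sym; apply: arc2 yA _; rewrite arcS5. Qed.

Lemma all_arc i x y : x \in U -> y \in A i -> adj x y.
Proof.
by move=> xU yA; apply/negPn/negP => xy; unpA i xU; unp yA; cyc i; c4 x (v i.+1) y (v i.+4).
Qed.

Lemma five_all_all x y : x \in U -> y \in U -> x != y -> adj x y.
Proof.
by move=> xU yU xy; apply/negPn/negP => nxy; unpA 0 xU; unpA 0 yU; cyc 0; c4 x (v 0) y (v 2).
Qed.

Lemma none_arc i z x : z \in Z -> x \in A i -> ~~ adj z x.
Proof.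
move=> zZ xA; apply/negP => zx; have zZ' := zZ; unpN i zZ'.
have xv : x != v i by neq_tac.
have xi := arc0 xA (arc_v i) xv; unp xA; cyc i.
by p23 (v i.+2) (v i.+3) z x (v i).
Qed.

Lemma none_one i z x : z \in Z -> x \in B i -> ~~ adj z x.
Proof.
move=> zZ xB; apply/negP => zx; unpN i zZ; unp xB; cyc i.
by p23 z x (v i.+1) (v i.+2) (v i.+3).
Qed.

Lemma none_edge i z x : z \in Z -> x \in E i -> ~~ adj z x.
Proof.
move=> zZ xE; apply/negP => zx; unpN i zZ; unp xE; cyc i.
by p23 z x (v i.+4) (v i) (v i.+1).
Qed.

Lemma five_none_none z z' : z \in Z -> z' \in Z -> ~~ adj z z'.
Proof.
by move=> zZ z'Z; apply/negP => zx; unpN 0 zZ; unpN 0 z'Z; cyc 0; p23 z z' (v 0) (v 1) (v 2).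
Qed.

Lemma one0 i x y : x \in B i -> y \in B i -> ~~ adj x y.
Proof.
by move=> xB yB; apply/negP => xy; unp xB; unp yB; cyc i; p23 x y (v i.+1) (v i.+2) (v i.+3).
Qed.

Lemma one1 i x y : x \in B i -> y \in B i.+1 -> ~~ adj x y.
Proof. by move=> xB yB; apply/negP => xy; unp xB; unp yB; cyc i; c4 x (v i) (v i.+1) y. Qed.

Lemma one2 i x y : x \in B i -> y \in B i.+2 -> ~~ adj x y.
Proof.
move=> xB yB; apply/negP => xy; unp xB; unp yB; cyc i.
by c6 x (v i) (v i.+4) (v i.+3) (v i.+2) y.
Qed.

Lemma one_arc1 i x y : x \in B i -> y \in A i.+1 -> ~~ adj x y.
Proof.
move=> xB yA; apply/negP => xy; have xB' := xB; unp xB'.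
have yv : y != v i.+1 by neq_tac.
have yi := arc0 yA (arc_v i.+1) yv; unp yA; cyc i.
by p23 (v i.+3) (v i.+4) (v i.+1) y x.
Qed.

Lemma one_arc2 i x y : x \in B i -> y \in A i.+2 -> ~~ adj x y.
Proof. by move=> xB yA; apply/negP => xy; unp xB; unp yA; cyc i; c4 x (v i) (v i.+1) y. Qed.

Lemma one_arc3 i x y : x \in B i -> y \in A i.+3 -> ~~ adj x y.
Proof. by move=> xB yA; apply/negP => xy; unp xB; unp yA; cyc i; c4 x (v i) (v i.+4) y. Qed.

Lemma one_arc4 i x y : x \in B i -> y \in A i.+4 -> ~~ adj x y.
Proof.
move=> xB yA; apply/negP => xy; have xB' := xB; unp xB'.
have yv : y != v i.+4 by neq_tac.
have yi := arc0 yA (arc_v i.+4) yv; unp yA; cyc i.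
by p23 (v i.+1) (v i.+2) (v i.+4) y x.
Qed.

Lemma one_edge1 i x y : x \in B i -> y \in E i.+1 -> ~~ adj x y.
Proof. by move=> xB yA; apply/negP => xy; unp xB; unp yA; cyc i; c4 x (v i) (v i.+4) y. Qed.

Lemma one_edge4 i x y : x \in B i -> y \in E i.+4 -> ~~ adj x y.
Proof. by move=> xB yA; apply/negP => xy; unp xB; unp yA; cyc i; c4 x (v i) (v i.+1) y. Qed.

Lemma one_edge2 i x y : x \in B i -> y \in E i.+2 -> ~~ adj x y.
Proof.
by move=> xB yA; apply/negP => xy; unp xB; unp yA; cyc i; p23 (v i.+1) (v i.+2) (v i.+4) y x.
Qed.

Lemma one_edge3 i x y : x \in B i -> y \in E i.+3 -> ~~ adj x y.
Proof.
by move=> xB yA; apply/negP => xy; unp xB; unp yA; cyc i; p23 (v i.+3) (v i.+4) (v i.+1) y x.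
Qed.

Lemma edge_unique i x y : x \in E i -> y \in E i -> x = y.
Proof.
move=> xE yE; apply/eqP/negPn/negP => ne; unp xE; unp yE; cyc i.
have [xy|xy] := boolP (adj x y); first by p23 x y (v i.+4) (v i) (v i.+1).
by p23 (v i.+4) (v i) x (v i.+2) y.
Qed.

Lemma edge_no1 i x y : x \in E i -> y \in E i.+1 -> False.
Proof.
move=> xE yE; unp xE; unp yE; cyc i.
have [xy|xy] := boolP (adj x y); first by c6 (v i.+2) x y (v i.+4) (v i) (v i.+1).
by p23 x (v i.+2) y (v i.+4) (v i).
Qed.

Lemma edge_no2 i x y : x \in E i -> y \in E i.+2 -> False.
Proof.
move=> xE yE; unp xE; unp yE; cyc i.
have [xy|xy] := boolP (adj x y); first by c4 x (v i.+3) (v i.+4) y.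
by p23 x (v i.+3) y (v i) (v i.+1).
Qed.

Lemma edge_arc0 i x y : x \in E i -> y \in A i -> ~~ adj x y.
Proof. by move=> xE yA; apply/negP => xy; unp xE; unp yA; cyc i; c4 x (v i.+2) (v i.+1) y. Qed.

Lemma edge_arc2 i x y : x \in E i -> y \in A i.+2 -> adj x y.
Proof.
move=> xE yA; apply/negPn/negP => xy; have xE' := xE; unp xE'.
have yv : y != v i.+2 by neq_tac.
have yi := arc0 yA (arc_v i.+2) yv; unp yA; cyc i.
by p23 (v i.+4) (v i) x (v i.+2) y.
Qed.

Lemma edge_arc3 i x y : x \in E i -> y \in A i.+3 -> adj x y.
Proof.
move=> xE yA; apply/negPn/negP => xy; have xE' := xE; unp xE'.
have yv : y != v i.+3 by neq_tac.
have yi := arc0 yA (arc_v i.+3) yv; unp yA; cyc i.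
by p23 (v i) (v i.+1) x (v i.+3) y.
Qed.

(** * Types around a C5 without dominated or universal vertices *)

Hypothesis undom : undominated G.
Hypothesis nonuniv : forall w : G, exists2 x, x != w & ~~ adj w x.

(** The neighbours of such a vertex could only lie in [U], so [v 0] would dominate it. *)
Lemma five_none0 z : z \notin Z.
Proof.
apply/negP => zZ; have zZ' := zZ; unpN 0 zZ'; cyc 0.
have zv : z != v 0 by neq_tac.
have [|y zy vy] := undom zv; first by [].
have ny (P : {set G}) : y \in P -> (forall x, x \in P -> ~~ adj z x) -> False.
  by move=> yP no; move: (no y yP); rewrite zy.
case/or4P: (five_types 0 y) => [yU|yZ|yA|]; last case/orP=> [yB|yE].
- by unpA 0 yU; case/negP: vy; rewrite adj_sym.
- by apply: (ny _ yZ) => x; apply: five_none_none.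
- do ?[case/orP: yA => [yA|yA]; first by apply: (ny _ yA) => x; apply: none_arc].
  by apply: (ny _ yA) => x; apply: none_arc.
- do ?[case/orP: yB => [yB|yB]; first by apply: (ny _ yB) => x; apply: none_one].
  by apply: (ny _ yB) => x; apply: none_one.
- do ?[case/orP: yE => [yE|yE]; first by apply: (ny _ yE) => x; apply: none_edge].
  by apply: (ny _ yE) => x; apply: none_edge.
Qed.

(** Compare [b] with [v i.+1]: outside [E i], the neighbours of [b] can only lie in [U] or [A i],
    and [v i.+1] sees all of these. *)
Lemma one_edge i b : b \in B i -> exists2 e, e \in E i & adj b e.
Proof.
move=> bB; have bB' := bB; unp bB'; cyc i.
have bv : b != v i.+1 by neq_tac.
have [|y b_y vy] := undom bv; first by [].
have nby (P : {set G}) : y \in P -> (forall x, x \in P -> ~~ adj b x) -> False.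
  by move=> yP no; move: (no y yP); rewrite b_y.
case/or4P: (five_types i y) => [yU|yZ|yA|]; last case/orP=> [yB|yE].
- by unpA i yU; case/negP: vy; rewrite adj_sym.
- by rewrite (negbTE (five_none0 y)) in yZ.
- exfalso; case/orP: yA => [yA|/or4P[]yA].
  + by unp yA; case/negP: vy; rewrite adj_sym.
  + by apply: (nby _ yA) => x; apply: one_arc1.
  + by apply: (nby _ yA) => x; apply: one_arc2.
  + by apply: (nby _ yA) => x; apply: one_arc3.
  + by apply: (nby _ yA) => x; apply: one_arc4.
- exfalso; case/orP: yB => [yB|/or4P[]yB].
  + by apply: (nby _ yB) => x; apply: one0.
  + by apply: (nby _ yB) => x; apply: one1.
  + by apply: (nby _ yB) => x; apply: one2.
  + by apply: (nby _ yB) => x xB; rewrite adj_sym; apply: one2 xB _; rewrite oneS5.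
  + by apply: (nby _ yB) => x xB; rewrite adj_sym; apply: one1 xB _; rewrite oneS5.
- case/orP: yE => [yE|/or4P[]yE]; first by exists y.
  + by case: (nby _ yE) => x; apply: one_edge1.
  + by case: (nby _ yE) => x; apply: one_edge2.
  + by case: (nby _ yE) => x; apply: one_edge3.
  + by case: (nby _ yE) => x; apply: one_edge4.
Qed.

Lemma one_unique i x y : x \in B i -> y \in B i -> x = y.
Proof.
move=> xB yB; apply/eqP/negPn/negP => ne; have nxy := one0 xB yB.
have [e eE xe] := one_edge xB; have [f fE yf] := one_edge yB.
rewrite (edge_unique fE eE) in yf; unp xB; unp yB; unp eE; cyc i.
by c4 x e y (v i).
Qed.

Lemma one_edge_adj i b e : b \in B i -> e \in E i -> adj b e.
Proof. by move=> bB eE; have [f fE bf] := one_edge bB; rewrite (edge_unique eE fE). Qed.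

(** Different sets [E] exclude each other, and a vertex of [B j] requires one in [E j]. *)
Lemma five_typesE i e x : e \in E i ->
  [|| x \in U, x \in A i, x \in A i.+1, x \in A i.+2, x \in A i.+3, x \in A i.+4, x \in B i | x == e].
Proof.
move=> eE.
have noE j y : y \in E j -> j \in [:: i.+1; i.+2; i.+3; i.+4] -> False.
  move=> yE; rewrite !inE => /or4P[] /eqP jE; subst j.
  - exact: edge_no1 eE yE.
  - exact: edge_no2 eE yE.
  - by apply: (edge_no2 yE (y := e)); rewrite edgeS5.
  - by apply: (edge_no1 yE (y := e)); rewrite edgeS5.
have noB j y : y \in B j -> j \in [:: i.+1; i.+2; i.+3; i.+4] -> False.
  by move=> /one_edge[f fE _]; apply: noE fE.
case/or4P: (five_types i x) => [->//|xZ|xA|].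
- by rewrite (negbTE (five_none0 x)) in xZ.
- by case/or4P: xA => [->|->|->|/orP[]->]; rewrite ?orbT.
- case/orP=> [xB|xE].
    by case/or4P: xB => [->|/noB|/noB|/orP[/noB|/noB]]; rewrite ?orbT // !inE ?eqxx ?orbT => /(_ isT).
  case/or4P: xE => [xE|/noE|/noE|/orP[/noE|/noE]]; try by rewrite !inE ?eqxx ?orbT => /(_ isT).
  by rewrite (edge_unique xE eE) eqxx !orbT.
Qed.

Lemma five_all0 u : u \notin U.
Proof.
apply/negP => uU; have [x xu ux] := nonuniv u.
(* If [e] missed [u], some neighbour of [e] would miss [u] as well, [e] not being dominated; it
   could only lie in [B i], where it creates P2+P3. *)
have Uedge i e : e \in E i -> adj u e.
  move=> eE; apply/negPn/negP => ue; have eE' := eE; unp eE'; have uU' := uU; unpA i uU'.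
  have eu : e != u by neq_tac.
  have [|y ey uy] := undom eu; first by rewrite adj_sym.
  have := five_typesE y eE; case/or4P=> [yU|yA|yA|].
  - have uney : u != y by apply: contraNneq ue => ->; rewrite adj_sym.
    by rewrite (five_all_all uU yU uney) in uy.
  - by rewrite (all_arc uU yA) in uy.
  - by rewrite (all_arc uU yA) in uy.
  - case/or4P=> [yA|yA|yA|/orP[bB|/eqP E1]]; try by rewrite (all_arc uU yA) in uy.
      by unp bB; cyc i; p23 y e (v i.+1) u (v i.+4).
    by move: ey; rewrite E1 adj_irrefl.
have Uone i b : b \in B i -> adj u b.
  move=> bB; apply/negPn/negP => ub; have [e eE be] := one_edge bB; have ue := Uedge i e eE.
  by unp bB; unp eE; unpA i uU; cyc i; c4 b e u (v i).
case/negP: ux; case/or4P: (five_types 0 x) => [xU|xZ|xA|].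
- by apply: five_all_all; rewrite // eq_sym.
- by rewrite (negbTE (five_none0 x)) in xZ.
- by case/or4P: xA => [xA|xA|xA|/orP[]xA]; apply: (all_arc uU xA).
- case/orP=> [xB|xE].
    by case/or4P: xB => [|||/orP[]] /Uone.
  by case/or4P: xE => [|||/orP[]] /Uedge.
Qed.

Definition arcs_classes := [:: A 0; A 1; A 2; A 3; A 4].
Definition arcs_table :=
  [:: [:: true; true; false; false; true];
      [:: true; true; true; false; false];
      [:: false; true; true; true; false];
      [:: false; false; true; true; true];
      [:: true; false; false; true; true]].

(** Consecutive arcs are complete to each other but for one missing edge between [a] and [b], which
    therefore become parts of their own. *)
Definition notch_classes a b := [:: A 4; A 0 :\ a; [set a]; [set b]; A 1 :\ b; A 2; A 3].
Definition notch_table :=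
  [:: [:: true; true; true; false; false; false; true];
      [:: true; true; true; true; true; false; false];
      [:: true; true; true; false; true; false; false];
      [:: false; true; false; true; true; true; false];
      [:: false; true; true; true; true; true; false];
      [:: false; false; false; true; true; true; true];
      [:: true; false; false; false; false; true; true]].

Definition edge_classes := [:: A 0; A 1; A 2; A 3; A 4; E 0; B 0].
Definition edge_table :=
  [:: [:: true; true; false; false; true; false; true];
      [:: true; true; true; false; false; false; false];
      [:: false; true; true; true; false; true; false];
      [:: false; false; true; true; true; true; false];
      [:: true; false; false; true; true; false; false];
      [:: false; false; true; true; false; true; true];
      [:: true; false; false; false; false; true; true]].

(** * Blow-ups arising from a C5 and their size inequalities *)

Variable d : nat.
Hypothesis deg : degen d G.

Ltac blowup_simpl :=
  rewrite /total /weight /self /part /entry /= ?cards1 /=.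

Ltac low S :=
  let L := fresh "L" in
  match goal with W : blowup _ _ |- _ => have L := blowup_low deg W (S := S) isT end; move: L;
  blowup_simpl; rewrite ?addn0 => L.

Ltac bound S :=
  let L := fresh "L" in
  match goal with W : blowup _ _ |- _ => have L := blowup_clique deg W (S := S) isT isT end; move: L;
  blowup_simpl => L.

Ltac clean := repeat match goal with
  | H : is_true (adj _ _) |- _ => clear H
  | H : is_true (~~ adj _ _) |- _ => clear H
  end.

Ltac conclude K I L1 L2 :=
  clean; match goal with W : blowup _ _ |- _ =>
    apply: (blowup_gathers deg W (K := K) (I := I) (L1 := L1) (L2 := L2)) => //;
    blowup_simpl; repeat split; lia
  end.

Ltac set_norm H := try
  first [ rewrite in_setD1 in H; case/andP: H => ? H
        | rewrite in_set1 in H; move/eqP: H => H; subst ].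

Ltac arc_lemma := solve
  [ adj_tac
  | eapply arc0; eassumption | eapply arc2; eassumption | eapply arc3; eassumption
  | eapply edge_arc0; eassumption | eapply edge_arc2; eassumption | eapply edge_arc3; eassumption
  | eapply one_arc1; eassumption | eapply one_arc2; eassumption | eapply one_arc3; eassumption
  | eapply one_arc4; eassumption | eapply one_edge_adj; eassumption
  | match goal with
    | N : forall x y, _ -> _ -> is_true (adj x y) |- _ => eapply N; eassumption
    | N : forall x y, _ -> _ -> _ -> is_true (adj x y) |- _ => eapply N; eassumption
    | N : forall x y, _ -> _ -> is_true (~~ adj x y) |- _ => eapply N; eassumption
    end ].

Ltac arc_entry :=
  let x := fresh "x" in let y := fresh "y" in
  let Hx := fresh "Hx" in let Hy := fresh "Hy" in let ne := fresh "ne" in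
  move=> x y Hx Hy ne; set_norm Hx; set_norm Hy; solve
  [ by rewrite eqxx in ne
  | arc_lemma | rewrite adj_sym; arc_lemma
  | apply: negbTE; solve [arc_lemma | rewrite adj_sym; arc_lemma]
  | by rewrite (edge_unique Hx Hy) eqxx in ne | by rewrite (one_unique Hx Hy) eqxx in ne ].

Ltac arc_disjoint :=
  let x := fresh "x" in let Hx := fresh "Hx" in let Hy := fresh "Hy" in
  move=> x Hx Hy; set_norm Hx; set_norm Hy; solve
  [ match goal with N : is_true (?a != ?a) |- _ => by rewrite eqxx in N end
  | unp Hx; unp Hy; contra_adj
  | match goal with X : is_true (?a \in _), Y : is_true (?a \in _) |- _ => unp X; unp Y; contra_adj end ].

Ltac cover_entry H := let x := fresh "x" in
  move=> x; apply: some_has; have := H x; rewrite /part /= ?orbF //.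

Lemma arcs_gathers : (forall x, [|| x \in A 0, x \in A 1, x \in A 2, x \in A 3 | x \in A 4]) ->
  (forall i x y, x \in A i -> y \in A i.+1 -> adj x y) -> gathers d G #|G|.-1.
Proof.
move=> cover comp.
have c40 x y : x \in A 4 -> y \in A 0 -> adj x y.
  by rewrite -(arcS5 0) => xA yA; apply: comp xA yA.
have [c01 [c12 [c23 c34]]] := (comp 0, (comp 1, (comp 2, comp 3))).
have W : blowup arcs_classes arcs_table.
  split; [cover_entry cover|rewrite /part /=; repeat split; arc_disjoint|by []|].
  rewrite /part /entry /=; repeat split; arc_entry.
bound [:: 0; 1]. bound [:: 1; 2]. bound [:: 2; 3]. bound [:: 3; 4]. bound [:: 4; 0].
have p i : 0 < #|A i| by apply/card_gt0P; exists (v i); apply: arc_v.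
have [p0 p1 p2] := And3 (p 0) (p 1) (p 2). have [p3 p4 _] := And3 (p 3) (p 4) (p 0).
(* The arc of low degree is attached last and the two arcs opposite to it form the starting clique.
   The other two have degree at most d without the low arc, because consecutive arcs form
   cliques. *)
low [:: 0; 1; 2; 3; 4]; case: L4 => [|[_ l]|[[_ l]|[[_ l]|[[_ l]|[[_ l]|//]]]]]; first by lia.
- conclude [:: 2; 3] (@nil nat) [:: 0] [:: 1; 4].
- conclude [:: 3; 4] (@nil nat) [:: 1] [:: 2; 0].
- conclude [:: 4; 0] (@nil nat) [:: 2] [:: 3; 1].
- conclude [:: 0; 1] (@nil nat) [:: 3] [:: 4; 2].
- conclude [:: 1; 2] (@nil nat) [:: 4] [:: 0; 3].
Qed.

Section Notch.
Variables (i : nat) (x0 x1 : G).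
Hypothesis x0A : x0 \in A i.
Hypothesis x1A : x1 \in A i.+1.
Hypothesis nx : ~~ adj x0 x1.

Lemma notch_neq0 : v i != x0.
Proof. by have x1A' := x1A; unp x1A'; neq_tac. Qed.

Lemma notch_neq1 : v i.+1 != x1.
Proof. by have x0A' := x0A; unp x0A'; neq_tac. Qed.

Lemma notch_adj0 : adj (v i) x0.
Proof. exact: arc0 (arc_v i) x0A notch_neq0. Qed.

Lemma notch_single z z' : z \in A i.+3 -> z' \in A i.+3 -> z = z'.
Proof.
move=> zA z'A; apply/eqP/negPn/negP => ne; have zz' := arc0 zA z'A ne.
have a0 := notch_adj0; have nx' := nx.
have [n1 n2 n3 n4] : [/\ ~~ adj x0 z, ~~ adj x0 z', ~~ adj x1 z & ~~ adj x1 z'].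
  by split; [apply: arc3 zA|apply: arc3 z'A|apply: arc2 zA|apply: arc2 z'A].
by have x1A' := x1A; have x0A' := x0A; unp x1A'; unp x0A'; unp zA; unp z'A; cyc i; p23 z z' x0 (v i) x1.
Qed.

(** A vertex of [A i.+1] missing [x0] must see [y2], as P2+P3 is excluded. So [x1] sees [y2], and
    [y1], missing [y2], sees [x0]; this leaves an induced C6 through [x0], [y1], [x1], [y2]. *)
Lemma notch_next y1 y2 : y1 \in A i.+1 -> y2 \in A i.+2 -> adj y1 y2.
Proof.
move=> y1A y2A; apply/negPn/negP => ny.
have touch w : w \in A i.+1 -> ~~ adj x0 w -> adj w y2.
  move=> wA x0w; apply/negPn/negP => wy2.
  have n02 := arc2 x0A y2A; have wA' := wA; have y2A' := y2A; have x0A' := x0A.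
  have xv : v i != x0 by unp wA'; neq_tac.
  have a0 := arc0 (arc_v i) x0A xv.
  by clear wA'; unp wA; unp y2A'; unp x0A'; cyc i; p23 (v i.+3) y2 x0 (v i) w.
have x1y2 := touch x1 x1A nx.
have x0y1 : adj x0 y1 by apply/negPn/negP => n; move: ny; rewrite touch.
have ne : x1 != y1 by neq_tac.
have x1y1 := arc0 x1A y1A ne; have n02 := arc2 x0A y2A; have nx' := nx.
have x0A' := x0A; have x1A' := x1A; unp x0A'; unp x1A'; unp y1A; unp y2A; cyc i.
by c6 x0 y1 x1 y2 (v i.+3) (v i.+4).
Qed.

(** Two missing edges with a common end create P2+P3; two disjoint ones create C4. *)
Lemma notch_unique a0 a1 : a0 \in A i -> a1 \in A i.+1 -> ~~ adj a0 a1 -> a0 = x0 /\ a1 = x1.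
Proof.
move=> a0A a1A na; have nx' := nx.
have U0 b0 c0 b1 : b0 \in A i -> c0 \in A i -> b1 \in A i.+1 -> ~~ adj b0 b1 -> ~~ adj c0 b1 -> b0 = c0.
  move=> b0A c0A b1A n1 n2; apply/eqP/negPn/negP => ne; have bc := arc0 b0A c0A ne.
  by unp b0A; unp c0A; unp b1A; cyc i; p23 b0 c0 (v i.+3) (v i.+2) b1.
have U1 b0 b1 c1 : b0 \in A i -> b1 \in A i.+1 -> c1 \in A i.+1 -> ~~ adj b0 b1 -> ~~ adj b0 c1 -> b1 = c1.
  move=> b0A b1A c1A n1 n2; apply/eqP/negPn/negP => ne; have bc := arc0 b1A c1A ne.
  by unp b0A; unp c1A; unp b1A; cyc i; p23 b1 c1 (v i.+3) (v i.+4) b0.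
have [E1|ne1] := eqVneq a1 x1; first by split=> //; apply: (U0 _ _ x1) => //; rewrite -E1.
have [E0|ne0] := eqVneq a0 x0; first by split=> //; apply: (U1 x0) => //; rewrite -E0.
have x0a1 : adj x0 a1 by apply: contraNT ne1 => n; apply/eqP; apply: (U1 x0).
have a0x1 : adj a0 x1 by apply: contraNT ne0 => n; apply/eqP; apply: (U0 _ _ x1).
have a00 := arc0 a0A x0A ne0; have a11 := arc0 a1A x1A ne1.
by have [x0A' x1A'] := (x0A, x1A); unp x0A'; unp x1A'; unp a0A; unp a1A; c4 x0 a0 x1 a1.
Qed.

End Notch.

Lemma notch_gathers x0 x1 :
  (forall x, [|| x \in A 0, x \in A 1, x \in A 2, x \in A 3 | x \in A 4]) ->
  x0 \in A 0 -> x1 \in A 1 -> ~~ adj x0 x1 -> gathers d G #|G|.-1.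
Proof.
move=> cover x0A x1A nx.
have one3 z : z \in A 3 -> z = v 3 by move=> zA; apply: (notch_single x0A x1A nx zA (arc_v 3)).
have c01l x y : x \in A 0 -> y \in A 1 -> x != x0 -> adj x y.
  by move=> xA yA; apply: contraNT => n; have [->] := notch_unique x0A x1A nx xA yA n.
have c01r x y : x \in A 0 -> y \in A 1 -> y != x1 -> adj x y.
  by move=> xA yA; apply: contraNT => n; have [_ ->] := notch_unique x0A x1A nx xA yA n.
have c12 x y : x \in A 1 -> y \in A 2 -> adj x y := notch_next x0A x1A nx (y1 := x) (y2 := y).
have c23 x y : x \in A 2 -> y \in A 3 -> adj x y by move=> xA /one3->; unp xA; adj_tac.
have c34 x y : x \in A 3 -> y \in A 4 -> adj x y by move=> /one3-> yA; unp yA; adj_tac.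
(* A missing edge here would be a notch one place earlier, and [notch_next] would make [A 0]
   complete to [A 1]. *)
have c40 x y : x \in A 4 -> y \in A 0 -> adj x y.
  move=> xA yA; apply/negPn/negP => n.
  have yA' : y \in A 5 by rewrite arcS5.
  have x0A' : x0 \in A 5 by rewrite arcS5.
  have x1A' : x1 \in A 6 by rewrite arcS5.
  by move: nx; rewrite (notch_next xA yA' n x0A' x1A').
have W : blowup (notch_classes x0 x1) notch_table.
  split.
  - move=> x; apply: some_has; have := cover x; rewrite /part /= !in_setD1 !in_set1.
    by case: (eqVneq x x0) => _; case: (eqVneq x x1) => _; rewrite /= ?orbT // orbF;
      case: (x \in A 0); case: (x \in A 1); case: (x \in A 2); case: (x \in A 3); case: (x \in A 4).
  - rewrite /part /=; repeat split; arc_disjoint.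
  - by [].
  - rewrite /part /entry /=; repeat split; arc_entry.
have p0 : 0 < #|A 0 :\ x0|.
  by apply/card_gt0P; exists (v 0); rewrite in_setD1 arc_v andbT (notch_neq0 x1A nx).
have p1 : 0 < #|A 1 :\ x1|.
  by apply/card_gt0P; exists (v 1); rewrite in_setD1 arc_v andbT (notch_neq1 x0A nx).
have p3 : #|A 3| = 1.
  apply/eqP/cards1P; exists (v 3); apply/setP => z; rewrite in_set1.
  by apply/idP/eqP => [/one3|->]; last exact: arc_v.
have p2 : 0 < #|A 2| by apply/card_gt0P; exists (v 2); apply: arc_v.
have p4 : 0 < #|A 4| by apply/card_gt0P; exists (v 4); apply: arc_v.
bound [:: 0; 1; 2]. bound [:: 1; 2; 4]. bound [:: 1; 3; 4]. bound [:: 3; 4; 5].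
low [:: 0; 1; 2; 3; 4; 5; 6].
(* The arcs [A 3], [A 4], [A 2], [A 0] are tried in turn as the one of degree at most d to be
   attached last; if all fail, the degeneracy bound leaves [A 1]. *)
have [l6|n6] := leqP (#|A 4| + #|A 2|) d.
  conclude [:: 1; 4; 2] [:: 3] [:: 6] [:: 0; 5].
have [l0|n0] := leqP (#|A 4| + #|A 0 :\ x0| + 1) d.
  conclude [:: 3; 4; 5] (@nil nat) [:: 0] [:: 6; 1; 2].
have [l5|n5] := leqP (#|A 2| + #|A 1 :\ x1| + 1) d.
  conclude [:: 1; 2; 0] (@nil nat) [:: 5] [:: 6; 3; 4].
have [l1|n1] := leqP (#|A 4| + #|A 0 :\ x0| + #|A 1 :\ x1| + 1) d.
  conclude [:: 5; 6] (@nil nat) [:: 1; 2] [:: 0; 3; 4].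
conclude [:: 0; 6] (@nil nat) [:: 3; 4] [:: 5; 1; 2].
Qed.

(** The missing edges between [E 0] and the arcs [A 1] and [A 4] shrink these arcs to [v 1] and
    [v 4]; a vertex in [B 0] does the same to [A 2] and [A 3]. *)
Lemma edge_gathers :
  (forall x, [|| x \in A 0, x \in A 1, x \in A 2, x \in A 3, x \in A 4, x \in E 0 | x \in B 0]) ->
  E 0 != set0 ->
  (forall e a, e \in E 0 -> a \in A 1 -> ~~ adj e a) ->
  (forall e a, e \in E 0 -> a \in A 4 -> ~~ adj e a) -> gathers d G #|G|.-1.
Proof.
move=> cover /set0Pn[e eE] e1 e4; have eE' := eE; unp eE'; cyc 0.
have one1 a : a \in A 1 -> a = v 1.
  move=> aA; apply/eqP/negPn/negP => ne; have aa := arc0 aA (arc_v 1) ne; have ea := e1 e a eE aA.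
  by unp aA; p23 a (v 1) (v 4) (v 3) e.
have one4 a : a \in A 4 -> a = v 4.
  move=> aA; apply/eqP/negPn/negP => ne; have aa := arc0 aA (arc_v 4) ne; have ea := e4 e a eE aA.
  by unp aA; p23 a (v 4) (v 1) (v 2) e.
have c01 x y : x \in A 0 -> y \in A 1 -> adj x y by move=> xA /one1->; unp xA; adj_tac.
have c12 x y : x \in A 1 -> y \in A 2 -> adj x y by move=> /one1-> yA; unp yA; adj_tac.
have c34 x y : x \in A 3 -> y \in A 4 -> adj x y by move=> xA /one4->; unp xA; adj_tac.
have c40 x y : x \in A 4 -> y \in A 0 -> adj x y by move=> /one4-> yA; unp yA; adj_tac.
have c23 x y : x \in A 2 -> y \in A 3 -> adj x y.
  move=> xA yA; apply/negPn/negP => n; have ex := edge_arc2 eE xA; have ey := edge_arc3 eE yA.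
  by unp xA; unp yA; c6 (v 0) (v 1) x e y (v 4).
have cB b x : b \in B 0 -> x \in A 0 -> adj b x.
  move=> bB xA; apply/negPn/negP => n; have be := one_edge_adj bB eE; have ex := edge_arc0 eE xA.
  by unp bB; unp xA; p23 b e (v 1) x (v 4).
have W : blowup edge_classes edge_table.
  split; [cover_entry cover|rewrite /part /=; repeat split; arc_disjoint|by []|].
  rewrite /part /entry /=; repeat split; arc_entry.
have card1 (P : {set G}) a : a \in P -> (forall x, x \in P -> x = a) -> #|P| = 1.
  move=> aP eqa; apply/eqP/cards1P; exists a; apply/setP => x; rewrite in_set1.
  by apply/idP/eqP => [/eqa|->].
have s1 : #|A 1| = 1 by apply: card1 (arc_v 1) one1.
have s4 : #|A 4| = 1 by apply: card1 (arc_v 4) one4.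
have sE : #|E 0| = 1 by apply: (card1 _ _ eE) => x xE; apply: edge_unique xE eE.
have p0 : 0 < #|A 0| by apply/card_gt0P; exists (v 0); apply: arc_v.
have p2 : 0 < #|A 2| by apply/card_gt0P; exists (v 2); apply: arc_v.
have p3 : 0 < #|A 3| by apply/card_gt0P; exists (v 3); apply: arc_v.
have [b0|/set0Pn[b bB]] := eqVneq (B 0) set0.
  have sB : #|B 0| = 0 by rewrite b0 cards0.
  bound [:: 2; 3; 5]. bound [:: 0; 1].
  conclude [:: 0; 1] [:: 4] [:: 5] [:: 2; 3; 6].
have bB' := bB; unp bB'; have be := one_edge_adj bB eE.
have sB : #|B 0| = 1 by apply: (card1 _ _ bB) => x xB; apply: one_unique xB bB.
have s2 : #|A 2| = 1.
  apply: card1 (arc_v 2) _ => a aA; apply/eqP/negPn/negP => ne; have aa := arc0 aA (arc_v 2) ne.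
  by have ba := one_arc2 bB aA; unp aA; p23 a (v 2) (v 4) (v 0) b.
have s3 : #|A 3| = 1.
  apply: card1 (arc_v 3) _ => a aA; apply/eqP/negPn/negP => ne; have aa := arc0 aA (arc_v 3) ne.
  by have ba := one_arc3 bB aA; unp aA; p23 a (v 3) (v 1) (v 0) b.
(* All parts but [A 0] are single vertices. Those of [A 2], [A 3] and [E 0] have degree 3, all other
   vertices at least [#|A 0| + 1]. *)
clean; have [l|l] : 3 <= d \/ #|A 0| + 1 <= d.
  low [:: 0; 1; 2; 3; 4; 5; 6]; rewrite s1 s2 s3 s4 sE sB in L.
  case: L => [|[_ l]|[[_ l]|[[_ l]|[[_ l]|[[_ l]|[[_ l]|[[_ l]|//]]]]]]]; lia.
- bound [:: 0; 1]; conclude [:: 0] (@nil nat) [:: 5; 2; 3] [:: 6; 1; 4].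
- bound [:: 2; 3; 5]; conclude [:: 0] (@nil nat) [:: 6; 1; 4] [:: 5; 2; 3].
Qed.

End FiveCycle.

(** Reads a list cyclically; on an explicit list the periodicity holds by computation. *)
Fixpoint cycling (T : Type) (x0 : T) (s : seq T) (i : nat) : T :=
  if i is j.+1 then cycling x0 (rot 1 s) j else head x0 s.

Section FiveCycleMain.
Variables (d : nat) (G : sgraph).
Hypothesis deg : degen d G.
Hypothesis C4G : C4_free G.
Hypothesis P23 : P2P3_free G.
Hypothesis C6G : C6_free G.
Hypothesis undom : undominated G.
Hypothesis nonuniv : forall w : G, exists2 x, x != w & ~~ adj w x.

Implicit Type v : nat -> G.

Definition five_cycle (v : nat -> G) := (forall i, v i.+4.+1 = v i) /\
  (forall i, adj (v i) (v i.+1) && ~~ adj (v i) (v i.+2)).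

Definition arcs_cover (v : nat -> G) := forall x, [|| x \in five_arc v 0, x \in five_arc v 1,
  x \in five_arc v 2, x \in five_arc v 3 | x \in five_arc v 4].

Lemma five_cycle_cycling x0 a b c e f : adj a b -> adj b c -> adj c e -> adj e f -> adj f a ->
  ~~ adj a c -> ~~ adj a e -> ~~ adj b e -> ~~ adj b f -> ~~ adj c f ->
  five_cycle (cycling x0 [:: a; b; c; e; f]).
Proof.
move=> ab bc ce ef fa ac ae be bf cf; split=> // i; rewrite adj_sym in ae; rewrite adj_sym in bf.
elim: i a b c e f ab bc ce ef fa ac be cf ae bf => [|i IH] a b c e f ab bc ce ef fa ac be cf ea fb.
  by rewrite /= ab ac.
by apply: (IH b c e f a).
Qed.

Lemma five_arc_mod v i : five_cycle v -> five_arc v (i %% 5) = five_arc v i.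
Proof.
case=> per _; rewrite {2}(divn_eq i 5); elim: (i %/ 5) => [//|q IH].
by rewrite mulSn -addnA !addSn (arcS5 per).
Qed.

Lemma arcs_coverE v : five_cycle v -> arcs_cover v <-> forall x, exists i, x \in five_arc v i.
Proof.
move=> cv; split=> cov x.
  by case/or4P: (cov x) => [|||/orP[]]; [exists 0|exists 1|exists 2|exists 3|exists 4].
have [i] := cov x; rewrite -(five_arc_mod i cv); have := ltn_pmod i (isT : 0 < 5).
by move: (i %% 5) => [|[|[|[|[|//]]]]] _ ->; rewrite ?orbT.
Qed.

Lemma five_cycle_shift v i : five_cycle v -> five_cycle (shift v i).
Proof. by case=> per cyc; split=> j; rewrite /shift ?addSn; [apply: per|apply: cyc]. Qed.

Lemma five_arc_shift v i j : five_arc (shift v i) j = five_arc v (j + i).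
Proof. by apply/setP => x; rewrite !inE /shift !addSn. Qed.

Lemma five_edge_shift v i j : five_edge (shift v i) j = five_edge v (j + i).
Proof. by apply/setP => x; rewrite !inE /shift !addSn. Qed.

Lemma arcs_cover_gathers v : five_cycle v -> arcs_cover v -> gathers d G #|G|.-1.
Proof.
move=> cv cov; have [per cyc] := cv.
case: (boolP [exists i : 'I_5, exists x, exists y,
  [&& x \in five_arc v i, y \in five_arc v i.+1 & ~~ adj x y]]).
  case/existsP => i /existsP[x /existsP[y /and3P[xA yA xy]]].
  have cs := five_cycle_shift i cv; have [per' cyc'] := cs.
  apply: (notch_gathers C4G P23 C6G per' cyc' deg _ (x0 := x) (x1 := y)); rewrite ?five_arc_shift //.
  apply/(arcs_coverE cs) => z; have [j zA] := (arcs_coverE cv).1 cov z.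
  (* Modulo 5, [4 * i] undoes the shift by [i]. *)
  exists (j + 4 * i); rewrite five_arc_shift -(five_arc_mod _ cv).
  by rewrite (_ : (_ + _) %% 5 = j %% 5) ?five_arc_mod //; lia.
move=> /existsPn all; apply: (arcs_gathers C4G per cyc deg cov) => i x y xA yA.
have /existsPn/(_ x)/existsPn/(_ y) := all (Ordinal (ltn_pmod i (isT : 0 < 5))).
rewrite /= five_arc_mod // xA -(five_arc_mod (i %% 5).+1) // (_ : _.+1 %% 5 = i.+1 %% 5); last by lia.
by rewrite five_arc_mod // yA negbK.
Qed.

Ltac unp H := rewrite inE in H; split_hyp H.
Ltac unpP per H := rewrite inE /= ?per in H; split_hyp H.

(** With [a] in place of [v 1], the vertex [e] sees three consecutive vertices of the cycle and
    becomes an arc vertex; the arcs of the new cycle then cover G. *)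
Lemma edge_swap_gathers v e a : five_cycle v -> e \in five_edge v 0 -> a \in five_arc v 1 ->
  adj e a -> gathers d G #|G|.-1.
Proof.
move=> cv eE aA ea; have [per cyc] := cv.
have eE' := eE; unpP per eE'; have aA' := aA; unpP per aA'.
have := cyc5 per cyc 0; move=> C; split_hyp C.
have cw : five_cycle (cycling a [:: v 0; a; v 2; v 3; v 4]).
  by apply: five_cycle_cycling; side_tac.
apply: (arcs_cover_gathers cw); apply/(arcs_coverE cw) => x.
have a1 : adj a (v 1).
  apply: (arc0 C4G per cyc aA (arc_v per cyc 1)).
  by neq_tac.
case/or4P: (five_typesE C4G P23 C6G per cyc undom x eE) => [xU|xA|xA|].
- by case/negP: (five_all0 C4G P23 C6G per cyc undom nonuniv x).
- have ex := edge_arc0 C4G per cyc eE xA; exists 0; unpP per xA; rewrite inE /=.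
  apply/and4P; split=> //; apply/negPn/negP => xa.
  by c6 x (v 4) (v 3) e a (v 1).
- by exists 1; unpP per xA; rewrite inE /=; apply/and4P.
case/or4P=> [xA|xA|xA|/orP[xB|/eqP->]].
- have ex := edge_arc2 C4G P23 per cyc eE xA; exists 2; unpP per xA; rewrite inE /=.
  apply/and4P; split=> //; apply/negPn/negP => xa.
  by c4 a e x (v 1).
- have ax := arc2 C4G per cyc aA xA; exists 3; unpP per xA; rewrite inE /=.
  by apply/and4P; split; rewrite // adj_sym.
- have xa := arc2 C4G per cyc xA (y := a); rewrite (arcS5 per 1) in xa.
  have {}xa := xa aA; exists 4; unpP per xA; rewrite inE /=.
  by apply/and4P; split.
- have be := one_edge_adj C4G P23 C6G per cyc undom xB eE.
  have ba := one_arc1 C4G P23 per cyc xB aA; unpP per xB.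
  by c4 x (v 0) a e.
by exists 2; rewrite inE /=; apply/and4P.
Qed.

(** Modulo 5 this is the reflection at [v 0]; it preserves [five_edge v 0] and exchanges
    [five_arc v 1] with [five_arc v 4]. *)
Lemma five_cycle_dilate v : five_cycle v -> five_cycle (fun j => v (4 * j)).
Proof.
case=> per cyc; split=> i; first by rewrite (vmod5 per) [RHS](vmod5 per); congr v; lia.
have E1 : v (4 * i) = v (4 * i.+2).+2 by rewrite (vmod5 per) [RHS](vmod5 per); congr v; lia.
have E2 : v (4 * i.+1) = v (4 * i.+2).+1 by rewrite (vmod5 per) [RHS](vmod5 per); congr v; lia.
have [c1 _] := andP (cyc (4 * i.+2).+1); have [_ c2] := andP (cyc (4 * i.+2)).
by rewrite E1 E2 (adj_sym _ (v (4 * i.+2).+1)) c1 adj_sym.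
Qed.

Lemma five_edge_gathers v : five_cycle v -> five_edge v 0 != set0 -> gathers d G #|G|.-1.
Proof.
move=> cv ne; have [per cyc] := cv.
case: (boolP [exists e in five_edge v 0, exists a in five_arc v 1, adj e a]).
  by case/exists_inP => e eE /exists_inP[a aA]; apply: edge_swap_gathers cv eE aA.
move=> no1; case: (boolP [exists e in five_edge v 0, exists a in five_arc v 4, adj e a]).
  case/exists_inP => e eE /exists_inP[a aA]; apply: (edge_swap_gathers (five_cycle_dilate cv)).
    by unpP per eE; rewrite inE /= !(vmod5 per (4 * _)); apply/and5P.
  by unpP per aA; rewrite inE /= !(vmod5 per (4 * _)); apply/and4P.
move=> no4; apply: (edge_gathers C4G P23 C6G per cyc undom deg _ ne).
- have [e eE] := set0Pn _ ne; move=> x.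
  have := five_typesE C4G P23 C6G per cyc undom x eE.
  rewrite (negbTE (five_all0 C4G P23 C6G per cyc undom nonuniv x)) /=.
  case/or4P=> [->|->|->|/or4P[->|->|->|/eqP->]]; rewrite ?orbT //.
  by rewrite eE !orbT.
- move=> e a eE aA; apply: contraNN no1 => ea; apply/exists_inP; exists e => //.
  by apply/exists_inP; exists a.
- move=> e a eE aA; apply: contraNN no4 => ea; apply/exists_inP; exists e => //.
  by apply/exists_inP; exists a.
Qed.

Lemma five_cycle_gathers v : five_cycle v -> gathers d G #|G|.-1.
Proof.
move=> cv; have [per cyc] := cv.
have edge i : five_edge v i != set0 -> gathers d G #|G|.-1.
  by move=> ne; apply: (five_edge_gathers (five_cycle_shift i cv)); rewrite five_edge_shift.
case: (boolP [exists i : 'I_5, five_edge v i != set0]) => [/existsP[i /edge //]|/existsPn no].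
have noE i x : x \in five_edge v i -> i < 5 -> False.
  move=> xE i5; have := no (Ordinal i5); rewrite negbK => /eqP E.
  by rewrite /= in E; rewrite E in_set0 in xE.
have noB i x : x \in five_one v i -> i < 5 -> False.
  by move=> /(one_edge C4G P23 C6G per cyc undom)[e /noE].
apply: (arcs_cover_gathers cv) => x; case/or4P: (five_types C4G per cyc 0 x) => //.
- by rewrite (negbTE (five_all0 C4G P23 C6G per cyc undom nonuniv x)).
- by rewrite (negbTE (five_none0 C4G P23 per cyc undom x)).
case/orP=> [xB|xE]; exfalso.
  by case/or4P: xB => [|||/orP[]] /noB; apply.
by case/or4P: xE => [|||/orP[]] /noE; apply.
Qed.

End FiveCycleMain.

(** * Induced subgraphs and reconfiguration graphs *)

Section Translation.
Variable G : sgraph.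

Lemma embedding_isomorphic (H : sgraph) (h : H -> G) : injective h ->
  (forall x y, adj (h x) (h y) = adj x y) -> isomorphic (induced [set h x | x in H]) H.
Proof.
move=> inj hadj; pose S := [set h x | x in H].
have mem x : h x \in S by apply: imset_f.
have pre (y : induced S) : exists x, h x == val y.
  by have /imsetP[x _ ->] := valP y; exists x.
pose f (y : induced S) : H := xchoose (pre y).
have fK y : h (f y) = val y by apply/eqP/(xchooseP (pre y)).
exists f; last by move=> x y; rewrite -hadj !fK.
exists (fun x => Sub (h x) (mem x)) => [y|x]; first by apply/val_inj; rewrite /= fK.
by apply: inj; rewrite fK.
Qed.

Lemma free_C4_free F : free F G -> List.In (cycle_graph 4) F -> C4_free G.
Proof.
move=> freeG inF a b c d ab bc cd da ac bd nac nbd.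
have ba : adj b a by rewrite adj_sym.
have cb : adj c b by rewrite adj_sym.
have dc : adj d c by rewrite adj_sym.
have ad : adj a d by rewrite adj_sym.
have nca : adj c a = false by rewrite adj_sym (negbTE nac).
have ndb : adj d b = false by rewrite adj_sym (negbTE nbd).
have ne (x y : G) : adj x y -> (x == y) = false.
  by move=> xy; apply/eqP => E; rewrite E adj_irrefl in xy.
pose h (i : cycle_graph 4) := nth a [:: a; b; c; d] (val i).
apply: (freeG _ [set h x | x in cycle_graph 4] inF); apply: embedding_isomorphic.
- have u4 : uniq [:: a; b; c; d] by rewrite /= !inE (ne _ _ ab) (ne _ _ bc) (ne _ _ cd) (ne _ _ ad) (negbTE ac) (negbTE bd).
  move=> i j; rewrite /h => E; apply/val_inj/eqP.
  by rewrite -(nth_uniq a _ _ u4) ?ltn_ord // E.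
- move=> [[|[|[|[|//]]]] i4] [[|[|[|[|//]]]] j4]; rewrite /h /= ?adj_irrefl //;
    by rewrite ?ab ?bc ?cd ?da ?ba ?cb ?dc ?ad ?nca ?ndb ?(negbTE nac) ?(negbTE nbd).
Qed.

Lemma free_P2P3_free F : free F G ->
  List.In (disjoint_union (path_graph 2) (path_graph 3)) F -> P2P3_free G.
Proof.
move=> freeG inF a b c d f ab cd df cf ncf nac nad naf nbc nbd nbf.
have [ba dc fd] : [/\ adj b a, adj d c & adj f d] by split; rewrite adj_sym.
have nfc : adj f c = false by rewrite adj_sym (negbTE ncf).
have [nca nda nfa] : [/\ adj c a = false, adj d a = false & adj f a = false].
  by split; rewrite adj_sym; apply: negbTE.
have [ncb ndb nfb] : [/\ adj c b = false, adj d b = false & adj f b = false].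
  by split; rewrite adj_sym; apply: negbTE.
have ne (x y : G) : adj x y -> (x == y) = false.
  by move=> xy; apply/eqP => E; rewrite E adj_irrefl in xy.
have ne2 (x y z : G) : adj x z = false -> adj y z -> (x == y) = false.
  by move=> xz yz; apply/eqP => E; rewrite E yz in xz.
pose h (i : disjoint_union (path_graph 2) (path_graph 3)) : G :=
  match i with inl i => nth a [:: a; b] (val i) | inr i => nth a [:: c; d; f] (val i) end.
have u2 : uniq [:: a; b] by rewrite /= !inE ne.
have u3 : uniq [:: c; d; f] by rewrite /= !inE (ne _ _ cd) (ne _ _ df) (negbTE cf).
have ab3 x y : x \in [:: a; b] -> y \in [:: c; d; f] -> x != y.
  move=> xab y3; apply/negP => /eqP E; rewrite E in xab.
  have ay : adj a y || adj b y by move: xab; rewrite !inE => /orP[]/eqP->; rewrite ?ab ?ba ?orbT.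
  move: ay y3; rewrite !inE => H /or3P[] /eqP Ey; move: H;
    by rewrite Ey ?(negbTE nac) ?(negbTE nad) ?(negbTE naf) ?(negbTE nbc) ?(negbTE nbd) ?(negbTE nbf).
apply: (freeG _ [set h x | x in disjoint_union (path_graph 2) (path_graph 3)] inF).
apply: embedding_isomorphic.
- move=> [i|i] [j|j]; rewrite /h => E.
  + by congr inl; apply/val_inj/eqP; rewrite -(nth_uniq a _ _ u2) ?ltn_ord // E.
  + have := ab3 (nth a [:: a; b] (val i)) (nth a [:: c; d; f] (val j)).
    by rewrite !mem_nth ?ltn_ord // E eqxx => /(_ isT isT).
  + have := ab3 (nth a [:: a; b] (val j)) (nth a [:: c; d; f] (val i)).
    by rewrite !mem_nth ?ltn_ord // E eqxx => /(_ isT isT).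
  + by congr inr; apply/val_inj/eqP; rewrite -(nth_uniq a _ _ u3) ?ltn_ord // E.
- move=> [[[|[|//]] i2]|[[|[|[|//]]] i3]] [[[|[|//]] j2]|[[|[|[|//]]] j3]];
    rewrite /h /= ?adj_irrefl //;
    by rewrite ?ab ?ba ?cd ?dc ?df ?fd ?(negbTE ncf) ?nfc ?(negbTE nac) ?(negbTE nad) ?(negbTE naf)
      ?(negbTE nbc) ?(negbTE nbd) ?(negbTE nbf) ?nca ?nda ?nfa ?ncb ?ndb ?nfb.
Qed.

Lemma degen_degeneracy : degen (degeneracy G) G.
Proof.
move=> X X0; rewrite /degeneracy; case: ex_minnP => dd /andP[_ dg] _.
pose E := [set p : G * G | [&& p.1 \in X, p.2 \in X & adj p.1 p.2]].
have sub : is_subgraph X E.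
  apply/forallP => x; apply/forallP => y; apply/implyP; rewrite !inE /= => /and3P[xX yX xy].
  by rewrite xX yX xy /= adj_sym.
move/forallP/(_ X)/forallP/(_ E): dg; rewrite X0 sub /= => /existsP[x /andP[xX low]].
exists x => //; apply: leq_trans low; rewrite /subdegree.
by apply/subset_leq_card/subsetP => y; rewrite !inE /= xX.
Qed.

Lemma recolors_walk k m (alpha beta : coloring k G) :
  recolors (fun=> m) (val alpha) (val beta) ->
  exists2 p : seq (reconfiguration_graph k G),
    path (@adj (reconfiguration_graph k G)) alpha p && (last alpha p == beta) & size p <= m * #|G|.
Proof.
move=> [s mv cnt].
suff [p walk le] : exists2 p : seq (reconfiguration_graph k G),
    path (@adj (reconfiguration_graph k G)) alpha p && (last alpha p == beta) & size p <= size s.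
  exists p => //; apply: leq_trans le _.
  have -> : size s = \sum_(v : G) count_mem v s.
    elim: (s) => [|x l IH] /=; first by rewrite big1.
    rewrite big_split /= -IH (bigD1 x) //= eqxx big1 ?addn0 // => y.
    by rewrite eq_sym => /negbTE->.
  by rewrite mulnC -sum_nat_const leq_sum.
clear cnt; move: (erefl (val alpha)) mv; move: {1 3}(val alpha) => f Ef mv.
move: (erefl (val beta)) mv; move: {1 3}(val beta) => g Eg mv.
elim: mv alpha Ef Eg => [f0|v l f0 f1 g0 _ pr1 eq1 _ IH] alpha E0 Eg.
  by exists [::] => //=; apply/eqP/val_inj; rewrite -E0.
have P1 : proper_coloring f1.
  apply/forallP => x; apply/forallP => y; apply/implyP => xy.
  by apply: pr1; rewrite ?inE.
pose alpha1 : coloring k G := Sub f1 P1.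
have [p /andP[pth lst] le] := IH alpha1 erefl Eg.
(* A step of [moves] may repeat the old color; it is then left out of the walk. *)
have [same|diff] := eqVneq f1 f0.
  have E : alpha1 = alpha by apply/val_inj; rewrite /= same.
  by exists p; [rewrite -E pth|apply: leqW].
exists (alpha1 :: p) => //=; rewrite lst pth !andbT.
have fv : f1 v != f0 v.
  apply: contraNneq diff => fv; apply/eqP/ffunP => x.
  by have [->|] := eqVneq x v; last exact: eq1.
apply/cards1P; exists v => //; apply/setP => x; rewrite !inE -E0 /=.
by have [->|/eq1->] := eqVneq x v; rewrite ?eqxx // eq_sym.
Qed.

Lemma reconfiguration_bound k m :
  (forall alpha beta : {ffun G -> 'I_k}, proper_on setT alpha -> proper_on setT beta ->
     recolors (fun=> m) alpha beta) ->
  connected (reconfiguration_graph k G) /\ diameter (reconfiguration_graph k G) <= m * #|G|.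
Proof.
move=> rec.
have prC (a : coloring k G) : proper_on setT (val a).
  move=> x y _ _; apply/implyP; have := valP a.
  by move/forallP/(_ x)/forallP/(_ y).
split=> [a b|].
  have [p /andP[pth /eqP lst] _] := recolors_walk (rec _ _ (prC a) (prC b)).
  by apply/connectP; exists p.
apply/bigmax_leqP => a _; apply/bigmax_leqP => b _.
have [p walk le] := recolors_walk (rec _ _ (prC a) (prC b)).
apply: leq_trans le; rewrite /dist; set V := #|_|.
(* [dist] never exceeds the order of the graph; a walk shorter than that has its length in the range
   searched by [find]. *)
have [big|small] := leqP V (size p).
  by apply: leq_trans (find_size _ _) _; rewrite size_iota.
rewrite leqNgt; apply/negP => /(before_find 0); rewrite nth_iota // add0n.
by move/negbT/existsPn/(_ (in_tuple p)); rewrite walk.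
Qed.

End Translation.

(** * Extracting induced cycles of length five and six *)

Lemma six_cycle_cycling (G : sgraph) (x0 a b c e f g : G) :
  adj a b -> adj b c -> adj c e -> adj e f -> adj f g -> adj g a ->
  ~~ adj a c -> ~~ adj a e -> ~~ adj a f -> ~~ adj b e -> ~~ adj b f -> ~~ adj b g ->
  ~~ adj c f -> ~~ adj c g -> ~~ adj e g -> six_cycle (cycling x0 [:: a; b; c; e; f; g]).
Proof.
move=> ab bc ce ef fg ga ac ae af be bf bg cf cg eg; split=> // i.
rewrite adj_sym in af; rewrite adj_sym in bg.
elim: i a b c e f g ab bc ce ef fg ga ac be cf eg af bg ae bf cg =>
  [|i IH] a b c e f g ab bc ce ef fg ga ac be cf eg fa gb ae bf cg.
  by rewrite /= ab ac ae.
by apply: (IH b c e f g a) => //; rewrite adj_sym.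
Qed.

Lemma C5_free_or_cycle (G : sgraph) : C5_free G \/ exists v : nat -> G, five_cycle v.
Proof.
case: (boolP [exists a : G, exists b : G, exists c : G, exists e : G, exists f : G,
  [&& adj a b, adj b c, adj c e, adj e f, adj f a,
      ~~ adj a c, ~~ adj a e, ~~ adj b e, ~~ adj b f & ~~ adj c f]]) => [|no].
  case/existsP => a /existsP[b /existsP[c /existsP[e /existsP[f H]]]]; split_hyp H.
  by right; exists (cycling a [:: a; b; c; e; f]); apply: five_cycle_cycling.
left=> a b c e f ab bc ce ef fa ac ae be bf cf; case/existsP: no.
exists a; apply/existsP; exists b; apply/existsP; exists c; apply/existsP; exists e.
by apply/existsP; exists f; rewrite ab bc ce ef fa ac ae be bf cf.
Qed.

Lemma C6_free_or_cycle (G : sgraph) : C6_free G \/ exists v : nat -> G, six_cycle v.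
Proof.
case: (boolP [exists a : G, exists b : G, exists c : G, exists e : G, exists f : G, exists g : G,
  [&& adj a b, adj b c, adj c e, adj e f, adj f g, adj g a, ~~ adj a c, ~~ adj a e, ~~ adj a f,
      ~~ adj b e, ~~ adj b f, ~~ adj b g, ~~ adj c f, ~~ adj c g & ~~ adj e g]])
  => [|no].
  case/existsP => a /existsP[b /existsP[c /existsP[e /existsP[f /existsP[g H]]]]]; split_hyp H.
  by right; exists (cycling a [:: a; b; c; e; f; g]); apply: six_cycle_cycling.
left=> a b c e f g ab bc ce ef fg ga ac ae af be bf bg cf cg eg; case/existsP: no.
exists a; apply/existsP; exists b; apply/existsP; exists c; apply/existsP; exists e.
apply/existsP; exists f; apply/existsP; exists g.
by rewrite ab bc ce ef fg ga ac ae af be bf bg cf cg eg.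
Qed.

(** * Induction on the number of vertices and the final bound *)

Lemma gathers_weaken d (G : sgraph) m n : m <= n -> gathers d G m -> gathers d G n.
Proof.
move=> mn [pi st]; exists pi => C alpha cardC pra.
have [sigma [beta [injs prb eqb rec]]] := st C alpha cardC pra.
by exists sigma, beta; split=> //; apply: recolors_weaken rec.
Qed.

Lemma gathers_complete d (G : sgraph) : degen d G -> clique [set: G] -> gathers d G 0.
Proof. by move=> deg cl; apply: settles_clique. Qed.

Lemma gathers_C4_P2P3_free d (G : sgraph) : degen d G -> C4_free G -> P2P3_free G ->
  gathers d G #|G|.-1.
Proof.
(* [d] varies in the induction, as deleting a universal vertex lowers it. *)
have [n] := ubnP #|G|; elim: n => [//|n IH] in d G *; move=> le deg C4G P23.
case: (posnP #|G|) => [G0|G_gt0].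
  by apply: (gathers_weaken (leq0n _)); apply: gathers_complete => // x; have /card0_eq/(_ x) := G0.
have del (u : G) : #|induced [set~ u]| = #|G|.-1 by rewrite card_induced cardsC1.
case: (boolP [exists u : G, exists v, [&& u != v, ~~ adj u v & [forall x, adj u x ==> adj v x]]]).
  case/existsP => u /existsP[v /and3P[uv nadj /forallP dom]].
  have {}dom x : adj u x -> adj v x by apply/implyP.
  (* The bound of the smaller graph plus one equals n - 1 only if n is at least 2, since [.-1]
     truncates. *)
  have card2 : 1 < #|G|.
    by rewrite (cardD1 u) (cardD1 v) !inE eq_sym uv.
  apply: (@gathers_weaken _ _ (#|induced [set~ u]|.-1).+1); first by rewrite del; lia.
  apply: (gathers_dominated uv nadj dom); apply: IH; first by rewrite del; lia.
  - exact: induced_degen.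
  - exact: induced_C4_free.
  - exact: induced_P2P3_free.
move=> undom0.
have undom : undominated G.
  move=> u v uv nadj; have /existsPn/(_ v) := (existsPn undom0) u.
  by rewrite uv nadj /= => /forallPn[x]; rewrite negb_imply => /andP[]; exists x.
case: (boolP [exists w : G, [forall x, (x != w) ==> adj w x]]).
  case/existsP => w /forallP univ0.
  have univ x : x != w -> adj w x by apply/implyP.
  case: d deg => [|d] deg.
    (* For d = 0 some vertex [z] is isolated, so the universal vertex is [z] itself and G has no
       other vertex. *)
    apply: (gathers_weaken (leq0n _)); apply: gathers_complete => // x y _ _ xy.
    have [z _] := deg [set: G] (introT (set0Pn _) (ex_intro _ w (in_setT w))).
    rewrite leqn0 cards_eq0 => /eqP z0.
    have iso t : ~~ adj z t by have := in_set0 t; rewrite -z0 in_nbr in_setT => /negbT.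
    have zw : z = w.
      by apply/eqP/negPn/negP => zw; have := iso w; rewrite adj_sym univ.
    have one t : t = w by apply/eqP/negPn/negP => /univ; rewrite -zw (negbTE (iso t)).
    by rewrite (one x) (one y) eqxx in xy.
  apply: (@gathers_weaken _ _ #|induced [set~ w]|.-1); first by rewrite del; lia.
  apply: (gathers_universal univ); apply: IH; first by rewrite del; lia.
  - exact: degen_universal deg.
  - exact: induced_C4_free.
  - exact: induced_P2P3_free.
move=> nonuniv0.
have nonuniv (w : G) : exists2 x, x != w & ~~ adj w x.
  by have /forallPn[x] := (existsPn nonuniv0) w; rewrite negb_imply => /andP[xw wx]; exists x.
have [C6G|[v cv]] := C6_free_or_cycle G; last exact: (six_cycle_gathers deg C4G P23 undom nonuniv cv).
have [C5G|[v cv]] := C5_free_or_cycle G; last exact: (five_cycle_gathers deg C4G P23 C6G undom nonuniv cv).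
exact: gathers_hole_free.
Qed.

Theorem theorem4 (G : sgraph) (n : nat) (card_G : #|G| = n)
    (free_G : free [:: disjoint_union (path_graph 2) (path_graph 3); cycle_graph 4] G)
    (k : nat) (le_k : degeneracy G + 2 <= k) :
  connected (reconfiguration_graph k G) /\
  diameter (reconfiguration_graph k G) <= 2 * n ^ 2.
Proof.
have C4G := free_C4_free free_G (or_intror (or_introl erefl)).
have P23 := free_P2P3_free free_G (or_introl erefl).
pose d := k - 2.
have deg : degen d G.
  move=> X /(degen_degeneracy)[x xX low]; exists x => //.
  by apply: leq_trans low _; rewrite /d; lia.
have kd : #|'I_k| = d.+2 by rewrite card_ord /d; lia.
have gath := gathers_C4_P2P3_free deg C4G P23.
have [conn diam] := @reconfiguration_bound G k (#|G|.-1 + #|G|.-1).+2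
  (fun alpha beta pra prb => gathers_recolors gath kd pra prb).
split=> //; apply: leq_trans diam _; rewrite -card_G.
(* For n = 0 the number of moves per vertex reads 2 instead of 2n, but it is multiplied by n. *)
by case: #|G| => [|p]; [rewrite muln0|rewrite /= addnn -doubleS -mul2n -mulnA].
Qed.
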